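(* There exists an absolute constant $C>0$ such that the following holds. For all integers $d\ge 2$ and reals $\lambda>0$, $\rho>0$, $\alpha>0$, there is an algorithm, running in time polynomial in $n$ and $d$, which takes as input $n$ samples in $\{\pm1\}^d$ (and the parameters $\lambda,\rho,\alpha$), is $\rho$-zCDP with respect to its input dataset, and satisfies: for every $d$-variable Ising model $\mathcal{D}(A,\theta)$ with $\lambda(A,\theta) \le \lambda$, if $$n \ge C\left(\frac{\lambda^2\log(d)\, e^{12\lambda}}{\alpha^4} + \frac{\sqrt{d}\,\lambda^2\log^2(d)\, e^{9\lambda}}{\sqrt{\rho}\,\alpha^3}\right),$$ then given $n$ i.i.d. samples from $\mathcal{D}(A,\theta)$, with probability greater than $2/3$ the algorithm outputs $\hat A \in \mathbb{R}^{d\times d}$ with $\max_{i,j\in[d]}|A_{i,j} - \hat A_{i,j}| \le \alpha$.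
   Context: The $d$-variable Ising model $\mathcal{D}(A,\theta)$ is the distribution on $\{-1,1\}^d$ with $\Pr[Z = z] \propto \exp\left(\sum_{1\le i\le j\le d} A_{i,j}z_iz_j + \sum_{i\in[d]}\theta_i z_i\right)$, where $A \in\mathbb{R}^{d\times d}$ is symmetric with $A_{ii} = 0$ and $\theta\in\mathbb{R}^d$. Its width is $\lambda(A,\theta) = \max_{i\in[d]}\left(\sum_{j\in[d]}|A_{i,j}| + |\theta_i|\right)$. A randomized algorithm $M$ is $\rho$-zCDP if for all datasets $X, X'$ differing in one element and all orders $a\in(1,\infty)$, the Rényi divergence satisfies $D_a(M(X)\|M(X')) \le \rho a$; the privacy guarantee must hold for all datasets. *)

(* Defs.v *)
From HB Require Import structures.
From mathcomp Require Import all_boot all_order all_algebra.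
From mathcomp Require Import all_classical all_reals all_analysis.

Set Implicit Arguments.
Unset Strict Implicit.
Unset Printing Implicit Defensive.

Import Order.TTheory GRing.Theory Num.Theory.

Import numFieldNormedType.Exports.

Local Open Scope classical_set_scope.
Local Open Scope ring_scope.

(* {-1,1}^d is encoded as [d.-tuple bool], with [true] for +1. *)
Definition spin (R : realType) (b : bool) : R := if b then 1 else -1.

Section ising.
Variables (R : realType) (d : nat).
Implicit Types (A : 'M[R]_d) (theta : 'rV[R]_d) (z : d.-tuple bool).

Definition ising_parameters A : Prop := A^T = A /\ forall i, A i i = 0.

Definition ising_weight A theta z : R :=
  expR (\sum_(i < d) \sum_(j < d | (i <= j)%N)
           A i j * spin R (tnth z i) * spin R (tnth z j)
        + \sum_(i < d) theta 0 i * spin R (tnth z i)).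

Definition ising_pmf A theta z : R :=
  ising_weight A theta z / \sum_(y : d.-tuple bool) ising_weight A theta y.

(* The maximum is over nonnegative quantities, so 0 is a neutral default. *)
Definition ising_width A theta : R :=
  \big[Num.max/0]_(i < d) (\sum_(j < d) `|A i j| + `|theta 0 i|).

Definition max_dist A (B : 'M[R]_d) : R :=
  \big[Num.max/0]_(i < d) \big[Num.max/0]_(j < d) `|A i j - B i j|.

End ising.

Section matrix_space.
Variables (R : realType) (d : nat).

Definition entry_cylinders : set (set 'M[R]_d) :=
  [set S | exists i j (B : set R),
     measurable B /\ S = (fun M : 'M[R]_d => M i j) @^-1` B].

(* 'M[R]_d with the smallest sigma-algebra that makes every entry measurable,
   i.e. the Borel sigma-algebra of R^(d x d). *)
Definition matrix_space : measurableType (sigma_display entry_cylinders) :=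
  g_sigma_algebraType entry_cylinders.

End matrix_space.

Section zcdp.
Variables (R : realType) (disp : measure_display) (T : measurableType disp).
Local Open Scope ereal_scope.
Local Open Scope charge_scope.

(* D_a(P || Q) = ln (int (dP/dQ)^a dQ) / (a - 1), and +oo when P is not
   absolutely continuous with respect to Q. *)
Definition renyi_div (a : R) (P Q : probability T R) : \bar R :=
  if `[< P `<< Q >] then
    ((a - 1)^-1)%:E *
    lne (\int[Q]_x (('d (charge_of_finite_measure P) '/d Q) x `^ a))
  else +oo.

Definition neighbors (S : eqType) (n : nat) (X X' : n.-tuple S) : Prop :=
  #|[pred k | tnth X k != tnth X' k]| = 1%N.

Definition zCDP (S : eqType) (n : nat) (rho : R)
    (M : n.-tuple S -> probability T R) : Prop :=
  forall X X', neighbors X X' ->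
  forall a : R, (1 < a)%R -> renyi_div a (M X) (M X') <= (rho * a)%:E.

End zcdp.

(* Programs use natural-number variables, which serve as counters and indices,
   and two-dimensional arrays of reals; both are named by natural numbers.
   Index arithmetic has no multiplication, so that after t steps every index
   has O(t) bits and unit-cost accounting is legitimate.  There are no real
   constants other than casts of natural numbers, and no rounding operation
   from reals to natural numbers. *)
Inductive iexp : Type :=
| IConst of nat
| IVar of nat
| IAdd of iexp & iexp
| ISub of iexp & iexp.

Inductive rexp : Type :=
| RNat of iexp
| RCell of nat & iexp & iexp
| RAdd of rexp & rexp
| RSub of rexp & rexp
| RMul of rexp & rexp
| RDiv of rexp & rexp
| RExp of rexp
| RLn of rexp.

Inductive bexp : Type :=
| ILe of iexp & iexp
| RLe of rexp & rexp
| BNot of bexp.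

(* [Draw a i j] stores a fresh uniform sample from [0,1] in cell (i, j) of
   array a. *)
Inductive cmd : Type :=
| Skip
| ISet of nat & iexp
| RSet of nat & iexp & iexp & rexp
| Draw of nat & iexp & iexp
| Seq of cmd & cmd
| If of bexp & cmd & cmd
| While of bexp & cmd.

Section semantics.
Variable R : realType.

Record store := Store {
  ivar : nat -> nat ;
  rcell : nat -> nat -> nat -> R }.

Fixpoint ieval (s : store) (e : iexp) : nat :=
  match e with
  | IConst n => n
  | IVar x => ivar s x
  | IAdd e1 e2 => (ieval s e1 + ieval s e2)%N
  | ISub e1 e2 => (ieval s e1 - ieval s e2)%N
  end.

Fixpoint reval (s : store) (e : rexp) : R :=
  match e with
  | RNat e => (ieval s e)%:R
  | RCell a i j => rcell s a (ieval s i) (ieval s j)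
  | RAdd e1 e2 => reval s e1 + reval s e2
  | RSub e1 e2 => reval s e1 - reval s e2
  | RMul e1 e2 => reval s e1 * reval s e2
  | RDiv e1 e2 => reval s e1 / reval s e2
  | RExp e => expR (reval s e)
  | RLn e => ln (reval s e)
  end.

Fixpoint beval (s : store) (e : bexp) : bool :=
  match e with
  | ILe e1 e2 => (ieval s e1 <= ieval s e2)%N
  | RLe e1 e2 => reval s e1 <= reval s e2
  | BNot e => ~~ beval s e
  end.

Definition iset (s : store) (x v : nat) : store :=
  Store (fun y => if y == x then v else ivar s y) (rcell s).

Definition rset (s : store) (a i j : nat) (v : R) : store :=
  Store (ivar s) (fun b k l =>
    if [&& b == a, k == i & l == j] then v else rcell s b k l).

(* [exec c s u t s' u']: started in store s with u the sequence of random
   numbers still to be drawn, c halts after t steps in store s' with u' left.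
   Skips, assignments, draws and tests cost one step each.  A draw from an
   empty sequence is stuck. *)
Inductive exec :
  cmd -> store -> seq R -> nat -> store -> seq R -> Prop :=
| exec_Skip s u : exec Skip s u 1 s u
| exec_ISet x e s u : exec (ISet x e) s u 1 (iset s x (ieval s e)) u
| exec_RSet a i j e s u :
    exec (RSet a i j e) s u 1
      (rset s a (ieval s i) (ieval s j) (reval s e)) u
| exec_Draw a i j s r u :
    exec (Draw a i j) s (r :: u) 1 (rset s a (ieval s i) (ieval s j) r) u
| exec_Seq c1 c2 s0 u0 t1 s1 u1 t2 s2 u2 :
    exec c1 s0 u0 t1 s1 u1 -> exec c2 s1 u1 t2 s2 u2 ->
    exec (Seq c1 c2) s0 u0 (t1 + t2) s2 u2
| exec_If b c1 c2 s u t s' u' :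
    exec (if beval s b then c1 else c2) s u t s' u' ->
    exec (If b c1 c2) s u t.+1 s' u'
| exec_WhileF b c s u : ~~ beval s b -> exec (While b c) s u 1 s u
| exec_WhileT b c s0 u0 t1 s1 u1 t2 s2 u2 :
    beval s0 b -> exec c s0 u0 t1 s1 u1 ->
    exec (While b c) s1 u1 t2 s2 u2 ->
    exec (While b c) s0 u0 (t1 + t2).+1 s2 u2.

Local Notation coin := (measurableTypeR R).

Definition uniform01 : probability coin R :=
  uniform_prob (@ltr01 R).

Definition push_coin (n : nat) (p : coin * n.-tuple coin) : n.+1.-tuple coin :=
  [tuple of p.1 :: p.2].

Lemma measurable_push_coin (n : nat) : measurable_fun setT (@push_coin n).
Proof. exact: measurable_cons. Qed.

HB.instance Definition _ (n : nat) :=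
  isMeasurableFun.Build _ _ _ _ (@push_coin n) (@measurable_push_coin n).

(* The law of n independent uniform samples from [0,1]. *)
Fixpoint coins_law (n : nat) : probability (n.-tuple coin) R :=
  match n with
  | 0 => \d_([tuple])
  | m.+1 => distribution (uniform01 \x coins_law m)%E (@push_coin m)
  end.

(* Started in store s, c halts within T steps whatever the random numbers, and
   the law of [out] of its final store is P.  Since each draw costs one step,
   T random numbers suffice. *)
Definition implements (disp : measure_display) (O : measurableType disp)
    (c : cmd) (T : nat) (s : store) (out : store -> O)
    (P : probability O R) : Prop :=
  (forall u : T.-tuple coin, all (fun r => 0 <= r <= 1) u ->
     exists t s' u', exec c s u t s' u' /\ (t <= T)%N) /\
  (forall E : set O, measurable E ->
     P E = coins_law T
       [set u : T.-tuple coin | exists t s' u', exec c s u t s' u' /\ E (out s')]).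

End semantics.

(* Calling convention: variables 0 and 1 hold n and d; array 0 holds the
   samples, one per row, with entries 1 and -1; row 0 of array 1 holds lambda,
   rho and alpha; everything else is 0.  The output is read from array 2. *)
Definition learner_input (R : realType) (n d : nat) (lambda rho alpha : R)
    (X : n.-tuple (d.-tuple bool)) : store R :=
  Store (nth 0%N [:: n; d])
    (fun a i j => nth 0 (nth [::] (nth [::]
       [:: [seq [seq spin R b | b <- x] | x : d.-tuple bool <- X];
           [:: [:: lambda; rho; alpha]]] a) i) j).

Definition learner_output (R : realType) (d : nat) (s : store R) :
    matrix_space R d :=
  \matrix_(i < d, j < d) rcell s 2 i j.

(* The probability that the output of M on n independent samples from the Ising
   model (A, theta) is within alpha of A entrywise. *)
Definition success_probability (R : realType) (n d : nat) (A : 'M[R]_d)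
    (theta : 'rV[R]_d) (alpha : R)
    (M : n.-tuple (d.-tuple bool) -> probability (matrix_space R d) R) :
    \bar R :=
  (\sum_(X : n.-tuple (d.-tuple bool))
     (\prod_(k < n) ising_pmf A theta (tnth X k))%:E *
     M X [set B : 'M[R]_d | (max_dist A B <= alpha)%R])%E.

(* Main.v *)
(* Each coordinate i is regressed on the others by minimising the interaction
   screening loss L(w) = mean_k exp(- <w, a_k>) over the l1 ball of radius lambda,
   where a_k collects the products of the label x_{k,i} with the features
   (x_{k,j} for j <> i, and the constant 1, placed at position i, for theta_i).
   The minimisation is Frank-Wolfe with steps 2/(t+2), each vertex being chosen by
   the exponential mechanism from one uniform coin.

   Privacy: changing one sample moves every score by at most eps/2, hence each
   choice is eps-differentially private and costs 9 eps^2 in zCDP; the output is a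
   function of the finite sequence of choices, so the Renyi divergences are finite
   sums, which compose over the d T choices by induction.

   Accuracy: the exponential moment of the excess of each choice is at most 2d, so
   the average excess over T steps is O(log d / eta) without a log T factor, and
   Frank-Wolfe turns it into an optimality gap.  The gradient of the population
   loss vanishes at the true parameters, because exp(- margin) cancels the
   dependence of the probability on x_i; Hoeffding bounds for the d^2 gradient
   entries and the d^3 second moments then bound the quadratic part of the loss
   difference, which dominates exp(- 3 lambda) (A_ij - w_j)^2 / 4, since flipping
   x_j changes the probability by a factor at least exp(- 2 lambda). *)

Require Import Defs.
From HB Require Import structures.
From mathcomp Require Import all_boot all_order all_algebra.
From mathcomp Require Import all_classical all_reals all_analysis measurable_realfun.
From mathcomp Require Import ring lra zify.

Set Implicit Arguments.
Unset Strict Implicit.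
Unset Printing Implicit Defensive.

Import Order.TTheory GRing.Theory Num.Theory.

Local Open Scope ring_scope.

(** * Exponential inequalities *)

Section exponential_inequalities.
Variable R : realType.
Implicit Types t u v x y : R.

(** The error budget exp(- 3 lam) alpha^2 / 4 is cut into three equal parts: optimisation gap,
    gradient deviation, second-moment deviation. Curvature then asks for T of order lam^2 exp(4 lam)
    / alpha^2; rho-zCDP over d T choices allows eps = sqrt(rho / (9 d T)) each, and eta = eps / (4
    lam exp lam). An excess of order log d / eta per step is affordable once n is of order sqrt d
    lam^2 log d exp(6 lam) / (sqrt rho alpha^3); the deviations need log d (lam^2 exp(8 lam) + lam^4
    exp(4 lam)) / alpha^4. Both lie below the two terms of the hypothesis, whose larger exponents
    and extra logarithm absorb powers of lam and lower-order terms.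

    The learner has to be at once a program reading coins and a law with tractable Renyi
    divergences. The bridge is [selections], a deterministic function of the coin sequence: its law
    is a finite product of softmax probabilities, and the program is shown to compute the same path
    on every coin sequence, so the program logic involves no probability. *)

Lemma sqr_le_of_norm x y : `|x| <= y -> x ^+ 2 <= y ^+ 2.
Proof.
move=> h; rewrite -[x ^+ 2]real_normK ?num_real // lerXn2r ?nnegrE //.
exact: le_trans h.
Qed.

Lemma expR_le_quad x : x <= 1 / 2 -> expR x <= 1 + x + 2 * x ^+ 2.
Proof.
move=> hx; have := expR_ge1Dx (- x); have := expR_gt0 x => h1 h2.
have e : expR x * expR (- x) = 1 by rewrite -expRD subrr expR0.
have h3 : expR x * (1 - x) <= 1 by rewrite -[leRHS]e ler_wpM2l // ltW.
have h4 : 1 <= (1 + x + 2 * x ^+ 2) * (1 - x).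
  have -> : (1 + x + 2 * x ^+ 2) * (1 - x) = 1 + x ^+ 2 * (1 - 2 * x) by ring.
  have : 0 <= x ^+ 2 * (1 - 2 * x) by apply: mulr_ge0; [exact: sqr_ge0|lra].
  by lra.
have h5 : 0 < 1 - x by lra.
by rewrite -(ler_pM2r h5); apply: le_trans h3 h4.
Qed.

(** The linear term stands outside the exponential so that it vanishes in expectation for a centred
    variable. Beyond 1/2 the bound is immediate, as then [x <= 2 * x ^+ 2]. *)
Lemma expR_le_addl_sqr x : expR x <= x + expR (2 * x ^+ 2).
Proof.
have h := expR_ge1Dx (2 * x ^+ 2).
case: (leP x (1 / 2)) => hx; first by have := expR_le_quad hx; lra.
have h1 : expR x <= expR (2 * x ^+ 2) by rewrite ler_expR; nra.
by lra.
Qed.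

(** Taylor bound without calculus: [1 - t <= expR (- t)] gives [expR t <= 1 + t * expR t], and
    bounding [expR t - 1] once more inside [t * expR t = t + t * (expR t - 1)] produces the
    square. *)
Lemma expR_ltD1x_quad t : expR t <= 1 + t + t ^+ 2 * Num.max 1 (expR t).
Proof.
have e : expR t * expR (- t) = 1 by rewrite -expRD subrr expR0.
have := expR_ge1Dx (- t); have := expR_gt0 t; have := expR_ge1Dx t => h0 h1 h2.
have h3 : expR t <= 1 + t * expR t.
  have : expR t * (1 - t) <= expR t * expR (- t) by rewrite ler_wpM2l // ltW.
  by rewrite e; lra.
case: (leP 0 t) => ht.
  have -> : Num.max 1 (expR t) = expR t.
    by apply/max_idPr; rewrite -expR0 ler_expR.
  have : t * (expR t - 1) <= t * (t * expR t) by rewrite ler_wpM2l //; lra.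
  by rewrite expr2; lra.
have -> : Num.max 1 (expR t) = 1.
  by apply/max_idPl; rewrite -expR0 ler_expR ltW.
have : t * (expR t - 1) <= t * t by rewrite ler_wnM2l; lra.
by rewrite expr2; lra.
Qed.

(** The factor 1/4 comes from squaring [1 + t / 2 <= expR (t / 2)], which is legitimate for t >= -2.
    Below -2 the left side is negative, because there [t ^+ 2 * m <= - t]. *)
Lemma expR_gtD1x_quad t : 1 + t + t ^+ 2 / 4 * Num.min 1 (expR t) <= expR t.
Proof.
have hm1 : Num.min 1 (expR t) <= 1 by rewrite ge_min lexx.
have hm2 : Num.min 1 (expR t) <= expR t by rewrite ge_min lexx orbT.
have hm3 : 0 < Num.min 1 (expR t) by rewrite lt_min ltr01 expR_gt0.
set m := Num.min _ _ in hm1 hm2 hm3 *.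
have tm : t ^+ 2 / 4 * m <= t ^+ 2 / 4 by rewrite ler_piMr // divr_ge0 // sqr_ge0.
case: (leP (- 2) t) => ht.
  have h := expR_ge1Dx (t / 2).
  have -> : expR t = expR (t / 2) ^+ 2 by rewrite -expRM_natl mulrC divfK.
  have : (1 + t / 2) ^+ 2 <= expR (t / 2) ^+ 2 by rewrite lerXn2r ?nnegrE ?expR_ge0 //; lra.
  by rewrite sqrrD expr1n mul1r; lra.
have h1 : m * (1 - t) <= 1.
  have h2 := expR_ge1Dx (- t).
  have e : expR t * expR (- t) = 1 by rewrite -expRD subrr expR0.
  by rewrite -[leRHS]e ler_pM //; lra.
have h4 := expR_gt0 t.
have h5 : t ^+ 2 * m <= - t.
  have : (- t) * (m * (1 - t)) <= (- t) * 1 by rewrite ler_wpM2l //; lra.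
  by nra.
by lra.
Qed.

(** Smoothness of the loss on [-L, L]: the remainder factor is the larger of exp(- u) and exp(-
    v). *)
Lemma exp_neg_upper u v L : `|u| <= L -> `|v| <= L ->
  expR (- v) <= expR (- u) - expR (- u) * (v - u) + expR L * (v - u) ^+ 2.
Proof.
rewrite !ler_norml => /andP[u1 u2] /andP[v1 v2].
have h := expR_ltD1x_quad (u - v).
have e : expR (- v) = expR (- u) * expR (u - v) by rewrite -expRD; congr expR; ring.
have hp := expR_gt0 (- u).
have : expR (- u) * expR (u - v) <=
   expR (- u) * (1 + (u - v) + (u - v) ^+ 2 * Num.max 1 (expR (u - v))).
  by rewrite ler_pM2l.
rewrite -e => h1; apply: (le_trans h1).
have h2 : expR (- u) * Num.max 1 (expR (u - v)) <= expR L.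
  rewrite maxr_pMr ?(ltW hp) // mulr1 -e ge_max !ler_expR; apply/andP; split; lra.
have h3 : (u - v) ^+ 2 * (expR (- u) * Num.max 1 (expR (u - v))) <= (u - v) ^+ 2 * expR L.
  by rewrite ler_wpM2l // sqr_ge0.
have -> : (v - u) ^+ 2 = (u - v) ^+ 2 by ring.
lra.
Qed.

(** Strong convexity on [-L, L], the remainder factor being the smaller of exp(- u) and exp(- v).
    Frank-Wolfe uses it with the square dropped; parameter recovery lives on the square. *)
Lemma exp_neg_lower u v L : `|u| <= L -> `|v| <= L ->
  expR (- u) - expR (- u) * (v - u) + expR (- L) / 4 * (v - u) ^+ 2 <= expR (- v).
Proof.
rewrite !ler_norml => /andP[u1 u2] /andP[v1 v2].
have h := expR_gtD1x_quad (u - v).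
have e : expR (- v) = expR (- u) * expR (u - v) by rewrite -expRD; congr expR; ring.
have hp := expR_gt0 (- u).
have : expR (- u) * (1 + (u - v) + (u - v) ^+ 2 / 4 * Num.min 1 (expR (u - v)))
   <= expR (- u) * expR (u - v).
  by rewrite ler_pM2l.
rewrite -e => h1; apply: (le_trans _ h1).
have h2 : expR (- L) <= expR (- u) * Num.min 1 (expR (u - v)).
  rewrite minr_pMr ?(ltW hp) // mulr1 -e le_min !ler_expR; apply/andP; split; lra.
have h3 : (u - v) ^+ 2 / 4 * expR (- L) <= (u - v) ^+ 2 / 4 * (expR (- u) * Num.min 1 (expR (u - v))).
  by rewrite ler_wpM2l // divr_ge0 // sqr_ge0.
have -> : (v - u) ^+ 2 = (u - v) ^+ 2 by ring.
lra.
Qed.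

End exponential_inequalities.

(** * Sequential random choices *)

Section chain.
Variables (R : realType) (K : finType).
Implicit Types (p q f : seq K -> K -> R) (past ks : seq K).

(** Each factor may depend on all earlier choices. When [f] is a transition probability, this is the
    probability of the path [ks] after [past]. *)
Fixpoint chain f past ks : R :=
  if ks is k :: ks' then f past k * chain f (rcons past k) ks' else 1.

Lemma chain_ge0 f past ks : (forall s k, 0 <= f s k) -> 0 <= chain f past ks.
Proof. by move=> h; elim: ks past => //= k ks IH past; rewrite mulr_ge0. Qed.

Lemma chain_gt0 f past ks : (forall s k, 0 < f s k) -> 0 < chain f past ks.
Proof. by move=> h; elim: ks past => //= k ks IH past; rewrite mulr_gt0. Qed.

Lemma sum_tuple_cons (V : nmodType) n (F : seq K -> V) :
  \sum_(t : n.+1.-tuple K) F t = \sum_k \sum_(t : n.-tuple K) F (k :: t).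
Proof.
rewrite pair_big /=.
rewrite (reindex (fun x : K * n.-tuple K => [tuple of x.1 :: x.2])) //=.
exists (fun t : n.+1.-tuple K => (thead t, [tuple of behead t])).
  by move=> [k t] _ /=; congr pair; apply/val_inj.
by move=> t _; rewrite [in RHS](tuple_eta t).
Qed.

Lemma sum_tuple0 (V : nmodType) (F : seq K -> V) :
  \sum_(t : 0.-tuple K) F t = F [::].
Proof.
rewrite (big_pred1 [tuple]) //= => t.
by apply/esym/eqP; exact: tuple0.
Qed.

Lemma chain_sum1 p past N : (forall s, \sum_k p s k = 1) ->
  \sum_(t : N.-tuple K) chain p past t = 1.
Proof.
move=> h; elim: N past => [|N IH] past.
  by rewrite (sum_tuple0 (fun t => chain p past t)).
rewrite (sum_tuple_cons _ (fun t => chain p past t)) /=.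
by under eq_bigr do rewrite -mulr_sumr IH mulr1.
Qed.

(** Conditioning on the first choice leaves a bound uniform in the past. This one induction gives
    the composition of Renyi moments, the exponential tail of the excess, and the moment generating
    function of an i.i.d. sum. *)
Lemma chain_expectation_le p f (b : nat -> R) past N :
  (forall s k, 0 <= p s k) -> (forall s k, 0 <= f s k) ->
  (forall m, 0 <= b m) ->
  (forall s, \sum_k p s k * f s k <= b (size s)) ->
  \sum_(t : N.-tuple K) chain p past t * chain f past t <=
    \prod_(i < N) b (size past + i)%N.
Proof.
move=> p0 f0 b0 h; elim: N past => [|N IH] past.
  by rewrite (sum_tuple0 (fun t => chain p past t * chain f past t)) big_ord0 mulr1.
rewrite (sum_tuple_cons _ (fun t => chain p past t * chain f past t)) /=.
rewrite big_ord_recl addn0.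
apply: (@le_trans _ _ (\sum_k (p past k * f past k) * \prod_(i < N) b (size past + i.+1)%N)).
  apply: ler_sum => k _.
  under eq_bigr do rewrite mulrACA.
  rewrite -mulr_sumr; apply: ler_wpM2l; first by rewrite mulr_ge0.
  have := IH (rcons past k); rewrite size_rcons.
  by under [X in _ <= X -> _]eq_bigr do rewrite addSnnS.
rewrite -mulr_suml; apply: ler_wpM2r (h past).
exact: prodr_ge0.
Qed.

Lemma chain_powR p q (a : R) past ks :
  (forall s k, 0 < p s k) -> (forall s k, 0 < q s k) ->
  chain (fun s k => (p s k / q s k) `^ a) past ks =
  (chain p past ks / chain q past ks) `^ a.
Proof.
move=> p0 q0; elim: ks past => [|k ks IH] past /=; first by rewrite divr1 powR1.
rewrite IH -powRM ?divr_ge0 ?chain_ge0 ?(ltW (p0 _ _)) ?(ltW (q0 _ _)) //; last 2 first.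
- by move=> *; apply: ltW.
- by move=> *; apply: ltW.
by rewrite mulrACA invfM.
Qed.

End chain.

(** * Renyi moment of a single differentially private choice *)

Section renyi_step.
Variables (R : realType) (K : finType).

(** Weighted AM-GM between x and 1: take the tangent of exp at s ln x, evaluate it at ln x and at 0,
    and average with weights s and 1 - s; the linear terms cancel. *)
Lemma powR_le_affine (x s : R) : 0 < x -> 0 <= s <= 1 ->
  x `^ s <= 1 + s * (x - 1).
Proof.
move=> x0 /andP[s0 s1].
rewrite /powR gt_eqF //; set l := ln x.
have xe : x = expR l by rewrite lnK.
have h0 := expR_gt0 (s * l).
have h1 : expR (s * l) * (1 + (l - s * l)) <= x.
  rewrite xe -[X in _ <= X](_ : expR (s * l) * expR (l - s * l) = _); last first.
    by rewrite -expRD; congr expR; ring.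
  by rewrite ler_pM2l // expR_ge1Dx.
have h2 : expR (s * l) * (1 + (- (s * l))) <= 1.
  rewrite -[leRHS](_ : expR (s * l) * expR (- (s * l)) = _); last by rewrite -expRD subrr expR0.
  by rewrite ler_pM2l // expR_ge1Dx.
have h3 : s * (expR (s * l) * (1 + (l - s * l))) <= s * x by rewrite ler_wpM2l.
have h4 : (1 - s) * (expR (s * l) * (1 + (- (s * l)))) <= (1 - s) * 1.
  by rewrite ler_wpM2l //; lra.
nra.
Qed.

Lemma expR1_le4 : expR 1 <= 4 :> R.
Proof.
have h : expR (1 / 2) <= 1 + 1 / 2 + 2 * (1 / 2) ^+ 2 :> R by apply: expR_le_quad.
have -> : (1 : R) = 1 / 2 + 1 / 2 by lra.
have := expR_gt0 (1 / 2 : R).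
by rewrite expRD; nra.
Qed.

(* The second-order expansion is needed only when a * e < 1: otherwise the trivial
   bound e on the divergence is enough. *)
Lemma renyi_pure_dp (p q : K -> R) (e a : R) :
  (forall k, 0 < p k) -> (forall k, 0 < q k) ->
  \sum_k p k = 1 -> \sum_k q k = 1 -> 0 <= e -> 1 < a ->
  (forall k, p k <= expR e * q k) -> (forall k, q k <= expR e * p k) ->
  \sum_k q k * (p k / q k) `^ a <= expR (a * (a - 1) * (9 * e ^+ 2)).
Proof.
move=> p0 q0 p1 q1 e0 a1 pq qp.
have r0 k : 0 < p k / q k by rewrite divr_gt0.
have rle k : p k / q k <= expR e by rewrite ler_pdivrMr.
have rge k : expR (- e) <= p k / q k.
  by rewrite ler_pdivlMr // expRN mulrC ler_pdivrMr ?expR_gt0 // mulrC.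
have qr k : q k * (p k / q k) = p k by rewrite mulrC divfK // gt_eqF.
have [ae|ae] := leP 1 (a * e).
  have : \sum_k q k * (p k / q k) `^ a <= \sum_k p k * expR ((a - 1) * e).
    apply: ler_sum => k _.
    have -> : (p k / q k) `^ a = (p k / q k) * (p k / q k) `^ (a - 1).
      rewrite -[X in _ = X * _]powRr1; last exact: ltW.
      by rewrite -powRD ?(gt_eqF (r0 k)) ?implybT //; congr (_ `^ _); ring.
    rewrite mulrA qr ler_pM2l // (mulrC (a - 1)) expRM.
    by apply: ge0_ler_powR; rewrite ?nnegrE ?expR_ge0 ?(ltW (r0 _)) //; lra.
  move=> h; apply: (le_trans h); rewrite -mulr_suml p1 mul1r ler_expR.
  have h1 : 0 <= (a - 1) * e * (a * e - 1).
    by apply: mulr_ge0; [apply: mulr_ge0|]; lra.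
  have h2 : 0 <= a * (a - 1) * e ^+ 2.
    by apply: mulr_ge0; [apply: mulr_ge0; lra|exact: sqr_ge0].
  by lra.
have e1 : e < 1 by nra.
have eae : 1 + a * (a - 1) * (9 * e ^+ 2) <= expR (a * (a - 1) * (9 * e ^+ 2)).
  exact: expR_ge1Dx.
apply: le_trans eae.
(* The exponent must vanish as a tends to 1. The expansion of [r ^ a] used for a > 2 gives 4 a^2
   e^2, which is below 9 a (a - 1) e^2 only when 5 a >= 9; near 1 the factor a - 1 is obtained by
   treating [r ^ (a - 1)] with the affine bound. *)
have [a2|a2] := leP a 2.
  (* This gives |r - 1| <= 3 e, whose square is the 9 e^2 of the statement. *)
  have ee : expR e <= 1 + 3 * e.
    have h : expR (e / 2) <= 1 + e / 2 + 2 * (e / 2) ^+ 2 by apply: expR_le_quad; lra.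
    have h' : expR (e / 2) <= 1 + e by nra.
    have : expR (e / 2) * expR (e / 2) <= (1 + e) * (1 + e).
      by rewrite ler_pM ?expR_ge0.
    by rewrite -expRD -splitr; nra.
  have en : 1 - e <= expR (- e) by have := expR_ge1Dx (- e).
  have : \sum_k q k * (p k / q k) `^ a <=
         \sum_k (p k + (a - 1) * (p k - q k) + (a - 1) * (9 * e ^+ 2) * q k).
    apply: ler_sum => k _.
    have -> : (p k / q k) `^ a = (p k / q k) * (p k / q k) `^ (a - 1).
      rewrite -[X in _ = X * _]powRr1; last exact: ltW.
      by rewrite -powRD ?(gt_eqF (r0 k)) ?implybT //; congr (_ `^ _); ring.
    have hb : (p k / q k) `^ (a - 1) <= 1 + (a - 1) * (p k / q k - 1).
      by apply: powR_le_affine => //; lra.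
    have := qr k; have := rle k; have := rge k; have := r0 k; have := q0 k; move: hb.
    set r := p k / q k; set y := r `^ _; move=> hb qk0 rk0 rl ru pe.
    rewrite -pe.
    have h1 : r * y <= r * (1 + (a - 1) * (r - 1)) by rewrite ler_pM2l.
    have h2 : (r - 1) ^+ 2 <= 9 * e ^+ 2.
      rewrite -[9 * _](_ : (3 * e) ^+ 2 = _); last by ring.
      by apply: sqr_le_of_norm; rewrite ler_norml; apply/andP; split; lra.
    have h3 : (a - 1) * (r - 1) ^+ 2 <= (a - 1) * (9 * e ^+ 2).
      by rewrite ler_wpM2l //; lra.
    have h4 : q k * (r * y) <= q k * (r + (a - 1) * (r - 1) + (a - 1) * (9 * e ^+ 2)).
      by rewrite ler_pM2l //; lra.
    lra.
  move=> h; apply: (le_trans h).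
  rewrite !big_split /= -!mulr_sumr big_split /= sumrN p1 q1.
  have : 0 <= (a - 1) * (a - 1) * (9 * e ^+ 2).
    by apply: mulr_ge0; [apply: mulr_ge0; lra|apply: mulr_ge0; [lra|exact: sqr_ge0]].
  by lra.
have : \sum_k q k * (p k / q k) `^ a <=
       \sum_k (q k + a * (p k - q k) + (4 * a ^+ 2 * e ^+ 2) * q k).
  apply: ler_sum => k _.
  have := qr k; have := rle k; have := rge k; have := r0 k; have := q0 k.
  set r := p k / q k; move=> qk0 rk0 rl ru pe; rewrite -pe.
  rewrite /powR gt_eqF //; set l := ln r.
  have re : r = expR l by rewrite lnK.
  have lr : l <= r - 1 by rewrite re; have := expR_ge1Dx l; lra.
  have l1 : l <= e by rewrite -ler_expR -re.
  have l2 : - e <= l by rewrite -ler_expR -re.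
  have la : a * l <= 1 by nra.
  have h1 := expR_ltD1x_quad (a * l).
  have h2 : Num.max 1 (expR (a * l)) <= 4.
    rewrite ge_max; apply/andP; split; first by lra.
    by apply: le_trans expR1_le4; rewrite ler_expR.
  have l22 : l ^+ 2 <= e ^+ 2.
    by apply: sqr_le_of_norm; rewrite ler_norml l2.
  have h3 : (a * l) ^+ 2 * Num.max 1 (expR (a * l)) <= (a * l) ^+ 2 * 4.
    by rewrite ler_wpM2l // sqr_ge0.
  have h4 : a ^+ 2 * l ^+ 2 <= a ^+ 2 * e ^+ 2 by rewrite ler_wpM2l // sqr_ge0.
  have h5 : a * l <= a * (r - 1) by rewrite ler_wpM2l //; lra.
  have h6 : expR (a * l) <= 1 + a * (r - 1) + 4 * a ^+ 2 * e ^+ 2.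
    by move: h3; rewrite exprMn; lra.
  have : q k * expR (a * l) <= q k * (1 + a * (r - 1) + 4 * a ^+ 2 * e ^+ 2).
    by rewrite ler_pM2l.
  lra.
move=> h; apply: (le_trans h).
rewrite !big_split /= -!mulr_sumr big_split /= sumrN p1 q1.
have : 0 <= e ^+ 2 by exact: sqr_ge0.
have : 0 <= a * (5 * a - 9) by rewrite mulr_ge0; lra.
by move=> h1 h2; have := mulr_ge0 h1 h2; lra.
Qed.

End renyi_step.

(** * The exponential mechanism *)

Section softmax.
Variables (R : realType) (K : finType).

Definition softmax (s : K -> R) (k : K) : R := expR (s k) / \sum_l expR (s l).

Lemma softmax_sum_gt0 (s : K -> R) (k : K) : 0 < \sum_l expR (s l).
Proof.
rewrite (bigD1 k) //= ltr_pwDl ?expR_gt0 //.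
by apply: sumr_ge0 => l _; exact: expR_ge0.
Qed.

Lemma softmax_gt0 (s : K -> R) k : 0 < softmax s k.
Proof. by rewrite divr_gt0 ?expR_gt0 // (softmax_sum_gt0 s k). Qed.

Lemma softmax_sum1 (s : K -> R) (k0 : K) : \sum_k softmax s k = 1.
Proof. by rewrite -mulr_suml mulfV // gt_eqF // (softmax_sum_gt0 s k0). Qed.

(** Half of [e] is spent on the numerator and half on the normalising sum. *)
Lemma softmax_ratio (s s' : K -> R) (e : R) k :
  (forall l, `|s l - s' l| <= e / 2) ->
  softmax s k <= expR e * softmax s' k.
Proof.
move=> h; rewrite /softmax.
have z := softmax_sum_gt0 s k; have z' := softmax_sum_gt0 s' k.
have h1 l : s l <= e / 2 + s' l.
  by have := h l; rewrite ler_norml => /andP[_]; lra.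
have h2 l : s' l <= e / 2 + s l.
  by have := h l; rewrite ler_norml => /andP[]; lra.
have hz : \sum_l expR (s' l) <= expR (e / 2) * \sum_l expR (s l).
  by rewrite mulr_sumr; apply: ler_sum => l _; rewrite -expRD ler_expR.
rewrite ler_pdivrMr // mulrA mulrAC ler_pdivlMr //.
apply: (@le_trans _ _ ((expR (e / 2) * expR (s' k)) * (expR (e / 2) * \sum_l expR (s l)))).
  by apply: ler_pM => //; rewrite ?expR_ge0 ?(ltW z') // -expRD ler_expR.
by rewrite [e in leRHS]splitr expRD mulrACA !mulrA.
Qed.

(** The excess factor cancels the score in every term, leaving [expR m], and the normalising sum
    already contains [expR m] as the term of a maximiser. *)
Lemma softmax_excess (s : K -> R) (m : R) :
  (forall k, s k <= m) -> (exists k, s k = m) ->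
  \sum_k softmax s k * expR (m - s k) <= #|K|%:R.
Proof.
move=> hm [k0 e0].
have z := softmax_sum_gt0 s k0.
have -> : \sum_k softmax s k * expR (m - s k) = (\sum_(k : K) expR m) / \sum_l expR (s l).
  rewrite mulr_suml; apply: eq_bigr => k _.
  by rewrite /softmax mulrAC -expRD addrC subrK.
rewrite sumr_const ler_pdivrMr // -[expR m *+ _]mulr_natl ler_wpM2l //.
rewrite -e0 (bigD1 k0) //= lerDl.
by apply: sumr_ge0 => l _; exact: expR_ge0.
Qed.

End softmax.

(** * Renyi divergence of finite mixtures *)

Section finite_mixture.
Variables (R : realType) (disp : measure_display) (O : measurableType disp).
Variables (I : finType) (out : I -> O).
Hypothesis measurable_pt : forall y : O, measurable [set y]%classic.
Local Open Scope classical_set_scope.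

(** The image of the weights [w] under [out], described by its values on events; since [out] may
    identify indices, [P] need not determine [w]. *)
Definition mixture (P : probability O R) (w : I -> R) : Prop :=
  forall E : set O, measurable E ->
    P E = (\sum_(i | `[< E (out i) >]) w i)%:E.

Lemma mixture_integral (Q : probability O R) (q : I -> R) (f : O -> \bar R) :
  (forall i, 0 < q i) -> mixture Q q ->
  measurable_fun setT f -> (forall x, (0 <= f x)%E) ->
  (\int[Q]_x f x = \sum_i (q i)%:E * f (out i))%E.
Proof.
move=> q0 hQ mf f0.
(* [msum] adds a sequence of measures indexed by naturals, hence the enumeration of [I]; the default
   values lie beyond [#|I|] and never enter the sum. *)
pose w n : {nonneg R} :=
  if (insub n : option 'I_#|I|) is Some k then NngNum (ltW (q0 (enum_val k))) else NngNum (lexx 0).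
pose pt n : O := if (insub n : option 'I_#|I|) is Some k then out (enum_val k) else point.
pose m_ n : {measure set O -> \bar R} := mscale (w n) \d_(pt n).
have wE (k : 'I_#|I|) : (w k)%:num = q (enum_val k) by rewrite /w valK.
have ptE (k : 'I_#|I|) : pt k = out (enum_val k) by rewrite /pt valK.
have e E : measurable E -> E `<=` setT -> Q E = msum m_ #|I| E.
  move=> mE _; rewrite hQ // /msum /= /mscale.
  rewrite (reindex (@enum_val I I)) /=; last first.
    by exists enum_rank => x _; rewrite ?enum_valK ?enum_rankK.
  rewrite big_mkcond -sumEFin; apply: eq_bigr => k _.
  rewrite wE diracE ptE; case: ifPn.
    by move/asboolP => h; rewrite mem_set // mule1.
  by move/asboolPn => h; rewrite memNset // mule0.
rewrite (eq_measure_integral (msum m_ #|I|)) // ge0_integral_measure_sum //.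
rewrite [RHS](reindex (@enum_val I I)) /=; last first.
  by exists enum_rank => x _; rewrite ?enum_valK ?enum_rankK.
apply: eq_bigr => k _.
by rewrite ge0_integral_mscale // integral_dirac // diracT mul1e wE ptE.
Qed.

(** Convexity of the power a > 1, deduced from the concavity of the power 1/a applied to
    [(y / x) ^ a]. *)
Lemma powR_tangent (x y a : R) : 0 <= x -> 0 < y -> 1 < a ->
  x `^ a + a * x `^ (a - 1) * (y - x) <= y `^ a.
Proof.
move=> x0 y0 a1; have a0 : 0 < a by lra.
have [x00|xn] := eqVneq x 0.
  by rewrite x00 !powR0 ?gt_eqF //; [rewrite mulr0 mul0r addr0 powR_ge0|lra].
have xp : 0 < x by rewrite lt_def xn.
have h : (y / x) <= 1 + (y / x) `^ a / a - 1 / a.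
  have h0 : 0 < (y / x) `^ a by rewrite powR_gt0 // divr_gt0.
  have := @powR_le_affine R ((y / x) `^ a) a^-1 h0.
  rewrite -powRrM mulfV ?gt_eqF // powRr1; last by rewrite ltW // divr_gt0.
  have ai : 0 <= a^-1 <= 1 by rewrite invr_ge0 ltW //= invf_le1 //; lra.
  by move=> /(_ ai); lra.
have h1 : 1 + a * (y / x - 1) <= (y / x) `^ a.
  have : a * (y / x) <= a * (1 + (y / x) `^ a / a - 1 / a) by rewrite ler_pM2l.
  have -> : a * (1 + (y / x) `^ a / a - 1 / a) = a + (y / x) `^ a - 1.
    by field; rewrite gt_eqF.
  lra.
have xa : 0 < x `^ a by rewrite powR_gt0.
have e1 : y `^ a = (y / x) `^ a * x `^ a.
  by rewrite -powRM ?ltW ?divr_gt0 // divfK.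
have e2 : x `^ (a - 1) * x = x `^ a.
  by rewrite -[X in _ * X]powRr1 // -powRD ?xn ?implybT // subrK.
rewrite e1; have -> : x `^ a + a * x `^ (a - 1) * (y - x) = (1 + a * (y / x - 1)) * x `^ a.
  by rewrite -e2; field.
by rewrite ler_pM2r.
Qed.

(* Data processing: as [out] need not be injective, several indices may merge into
   one atom, which by convexity can only decrease the divergence. *)
Lemma renyi_mixture_le (P Q : probability O R) (p q : I -> R) (a c : R) :
  (forall i, 0 < p i) -> (forall i, 0 < q i) -> mixture P p -> mixture Q q ->
  1 < a -> \sum_i q i * (p i / q i) `^ a <= expR (a * (a - 1) * c) ->
  (renyi_div a P Q <= (c * a)%:E)%E.
Proof.
move=> p0 q0 hP hQ a1 hle.
have dom : (P `<< Q)%classic.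
  apply/null_content_dominatesP => E mE QE.
  have : Q E = 0%E := QE; rewrite hP // hQ // => /eqP.
  rewrite eqe psumr_eq0; last by move=> i _; exact: ltW.
  move=> /allP h; congr EFin; apply: big1 => i Ei.
  by have := h i (mem_index_enum _); rewrite Ei /= gt_eqF.
rewrite /renyi_div; case: asboolP => // _.
have {}dom : (charge_of_finite_measure P `<< Q)%classic := dom.
set f := Radon_Nikodym _ _.
have fE : forall y, exists r : R, f y = r%:E.
  move=> y; exists (fine (f y)); rewrite fineK //.
  exact: (@Radon_Nikodym_fin_num _ _ _ (charge_of_finite_measure P) Q).
have [g gE] := choice fE.
(* On an atom the derivative is the ratio of the grouped weights. Testing on singletons determines
   it wherever the mixtures have mass. *)
have grp (y : O) : g y * (\sum_(i | out i == y) q i) = \sum_(i | out i == y) p i.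
  have e (w : I -> R) : \sum_(i | `[< [set y] (out i) >]) w i = \sum_(i | out i == y) w i.
    by apply: eq_bigl => i; apply/asboolP/eqP.
  have := Radon_Nikodym_integral (A := [set y]) dom (measurable_pt y).
  rewrite -/f /= (eq_integral (fun=> (g y)%:E)); last first.
    by move=> x; rewrite inE /= => ->; exact: gE.
  rewrite integral_cst // /charge_of_finite_measure /= hP // hQ // -EFinM !e.
  by case.
have Qpos i : 0 < \sum_(j | out j == out i) q j.
  rewrite (bigD1 i) //= ltr_pwDl // sumr_ge0 // => j _; exact: ltW.
have gpos i : 0 < g (out i).
  have := grp (out i) => h.
  have : 0 < g (out i) * \sum_(j | out j == out i) q j.
    rewrite h (bigD1 i) //= ltr_pwDl // sumr_ge0 // => j _; exact: ltW.
  by rewrite pmulr_lgt0.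
have mf : measurable_fun setT f.
  exact: measurable_int (Radon_Nikodym_integrable dom).
rewrite (mixture_integral q0 hQ) //; last 2 first.
- exact: (measurableT_comp (measurable_poweR a)).
- by move=> x; exact: poweR_ge0.
have -> : (\sum_i (q i)%:E * (f (out i) `^ a) = (\sum_i q i * g (out i) `^ a)%:E)%E.
  by rewrite -sumEFin; apply: eq_bigr => i _; rewrite gE.
set S := \sum_i _.
have Spos : 0 < S.
  have [i0 _] : exists i : I, true.
    apply/existsP; apply: contraT; rewrite negb_exists => /forallP h.
    have := @probability_setT _ _ _ P; rewrite hP // big1 //.
      by case => /eqP; rewrite eq_sym oner_eq0.
    by move=> i; have := h i.
  rewrite /S (bigD1 i0) //= ltr_pwDl ?mulr_gt0 ?powR_gt0 //.
  by apply: sumr_ge0 => j _; rewrite mulr_ge0 ?powR_ge0 // ltW.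
rewrite lne_EFin // -EFinM lee_fin.
have hS : S <= expR (a * (a - 1) * c).
  apply: le_trans hle.
  (* The tangent corrections sum to zero: on each fibre of [out], [g] is constant and equals the
     q-average of [p / q]. Hence [S] is compared with the finer sum term by term, without being
     regrouped by atoms. *)
  have h1 : \sum_i (q i * g (out i) `^ a
      + a * g (out i) `^ (a - 1) * (p i - q i * g (out i))) = S.
    rewrite big_split /= -[RHS]addr0; congr (_ + _).
    have key : \sum_i p i * g (out i) `^ (a - 1) = \sum_i q i * g (out i) * g (out i) `^ (a - 1).
      pose QT i := \sum_(j | out j == out i) q j.
      transitivity (\sum_i \sum_(j | out j == out i)
          q j * (p i * g (out i) `^ (a - 1) / QT i)).
        apply: eq_bigr => i _; rewrite -mulr_suml -/(QT i) [RHS]mulrC divfK //.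
        by rewrite gt_eqF // Qpos.
      rewrite (exchange_big_dep predT) //=; apply: eq_bigr => j _.
      transitivity (\sum_(i | out i == out j) p i * (q j * g (out j) `^ (a - 1) / QT j)).
        apply: eq_big => [i|i /eqP e]; first by rewrite eq_sym.
        by rewrite /QT e; ring.
      rewrite -mulr_suml -grp -/(QT j).
      by field; rewrite gt_eqF // Qpos.
    transitivity (a * (\sum_i p i * g (out i) `^ (a - 1)
        - \sum_i q i * g (out i) * g (out i) `^ (a - 1))).
      by rewrite -sumrB mulr_sumr; apply: eq_bigr => i _; ring.
    by rewrite key subrr mulr0.
  rewrite -h1; apply: ler_sum => i _.
  have r0 : 0 < p i / q i by rewrite divr_gt0.
  have := powR_tangent (ltW (gpos i)) r0 a1.
  move=> h; have {}h := ler_wpM2l (ltW (q0 i)) h; apply: le_trans h.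
  by rewrite le_eqVlt; apply/orP; left; apply/eqP; field; rewrite gt_eqF.
rewrite mulrC ler_pdivrMr; last by lra.
rewrite -ler_expR lnK ?posrE //; apply: (le_trans hS).
by rewrite ler_expR; lra.
Qed.

End finite_mixture.

(** * Sampling from uniform coins *)

Section coin_driven_selection.
Variables (R : realType) (K : finType) (sel : seq K -> R -> K).
Variable p : seq K -> K -> R.
Local Notation coin := (measurableTypeR R).
Local Open Scope classical_set_scope.

Fixpoint selections (N : nat) (past : seq K) (u : seq R) : seq K :=
  if N is M.+1 then
    sel past (head 0 u) ::
      selections M (rcons past (sel past (head 0 u))) (behead u)
  else [::].

Lemma size_selections N past u : size (selections N past u) = N.
Proof. by elim: N past u => //= N IH past u; rewrite IH. Qed.

Hypothesis sel_measurable : forall past k,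
  measurable ([set r | sel past r = k] : set coin).
Hypothesis sel_law : forall past k,
  uniform01 R ([set r | sel past r = k] : set coin) = (p past k)%:E.

Lemma selections_cons_preimage m N past k ks :
  @push_coin R m @^-1` [set u : m.+1.-tuple coin | selections N.+1 past u = k :: ks] =
  [set r | sel past r = k] `*`
  [set u : m.-tuple coin | selections N (rcons past k) u = ks].
Proof.
apply/seteqP; split => [[r u]|[r u]] /=; first by case=> <- <-.
by case=> <- <-.
Qed.

Lemma measurable_selections m N past ks : (N <= m)%N ->
  measurable [set u : m.-tuple coin | selections N past u = ks].
Proof.
elim: m N past ks => [|m IH] [|N] past ks //= Nm.
- have [->|/eqP h] := eqVneq ks [::].
    by rewrite (_ : [set _ | _] = setT) //; apply/seteqP.
  rewrite (_ : [set _ | _] = set0) //; apply/seteqP; split => // u /= e.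
  by rewrite e in h.
- have [->|/eqP h] := eqVneq ks [::].
    by rewrite (_ : [set _ | _] = setT) //; apply/seteqP.
  rewrite (_ : [set _ | _] = set0) //; apply/seteqP; split => // u /= e.
  by rewrite e in h.
case: ks => [|k ks]; first by rewrite (_ : [set _ | _] = set0) //; apply/seteqP; split.
rewrite (_ : [set _ | _] =
  ((fun u : m.+1.-tuple coin => tnth u ord0) @^-1` [set r | sel past r = k]) `&`
  ((fun u : m.+1.-tuple coin => [tuple of behead u]) @^-1`
     [set u : m.-tuple coin | selections N (rcons past k) u = ks])).
  apply: measurableI.
    by rewrite -[X in measurable X]setTI; apply: measurable_tnth.
  by rewrite -[X in measurable X]setTI; apply: measurable_behead => //; exact: IH.
apply/seteqP; split => u; case/tupleP: u => r u /=; rewrite tnth0.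
  by case=> <- <-.
by case=> <- <-.
Qed.

(** Coins beyond the first N integrate out. The slack [N <= m] is needed because the semantics
    grants one coin per unit of the time bound, not one per choice. *)
Lemma selections_law m N past ks : (N <= m)%N -> size ks = N ->
  coins_law R m [set u : m.-tuple coin | selections N past u = ks] =
  (chain p past ks)%:E.
Proof.
elim: m N past ks => [|m IH] [|N] past [|k ks] //= Nm hs.
- rewrite (_ : [set _ | _] = setT); first exact: probability_setT.
  by apply/seteqP.
- rewrite (_ : [set _ | _] = setT); first exact: probability_setT.
  by apply/seteqP.
rewrite /distribution /pushforward (@selections_cons_preimage m N).
rewrite product_measure1E //; last exact: measurable_selections.
rewrite EFinM; congr (_ * _)%E; first exact: sel_law.
by apply: IH => //; case: hs.
Qed.

(** Paths range over a finite type, so every event about the path is measurable, whatever [Q] is. *)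
Lemma selections_mixture m N (Q : seq K -> Prop) : (N <= m)%N ->
  measurable [set u : m.-tuple coin | Q (selections N [::] u)] /\
  coins_law R m [set u : m.-tuple coin | Q (selections N [::] u)] =
  (\sum_(t : N.-tuple K | `[< Q t >]) chain p [::] t)%:E.
Proof.
move=> Nm.
have -> : [set u : m.-tuple coin | Q (selections N [::] u)] =
    \bigcup_(t in [set t : N.-tuple K | `[< Q t >]])
       [set u : m.-tuple coin | selections N [::] u = t].
  apply/seteqP; split => [u /= Qu|u [t /= /asboolP Qt ->] //].
  have hs : size (selections N [::] u) == N by rewrite size_selections.
  by exists (Tuple hs) => //=; apply/asboolP.
have mF (t : N.-tuple K) : measurable [set u : m.-tuple coin | selections N [::] u = t].
  exact: measurable_selections.
have fin : finite_set [set t : N.-tuple K | `[< Q t >]] by exact: finite_finset.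
split; first by apply: fin_bigcup_measurable.
rewrite measure_fin_bigcup //; last first.
  apply/trivIsetP => t t' _ _ /eqP tt'; apply/seteqP; split => // u [/= -> e].
  by case: tt'; apply/val_inj.
rewrite -sumEFin [RHS]bigfs ?index_enum_uniq //; last first.
  by move=> t _; rewrite (mem_index_enum t).
apply: eq_fsbigr => t _; apply: selections_law => //; exact: size_tuple.
Qed.

End coin_driven_selection.

(** * Inverse transform sampling by counting thresholds *)

Section threshold_selection.

(** For a predicate that holds on an initial segment, the count is the place where it turns false.
    The extreme counts 0 and N lose one condition each, so that the first and last cells below are
    unbounded. *)
Lemma count_initial (P : pred nat) (N k : nat) :
  (forall i j, (i <= j)%N -> P j -> P i) -> (k <= N)%N ->
  (\sum_(j < N) P j = k)%N <->
  ((k == 0) || P k.-1) /\ ((k == N) || ~~ P k).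
Proof.
move=> dn kN.
have sumE m : (m <= N)%N -> ((m == 0) || P m.-1) -> ((m == N) || ~~ P m) ->
    (\sum_(j < N) P j = m)%N.
  move=> mN h1 h2.
  rewrite (eq_bigr (fun j : 'I_N => if (j < m)%N then 1%N else 0%N)); last first.
    move=> j _; case: ltnP => jm.
      case/orP: h1 => [/eqP m0|Pm]; first by rewrite m0 in jm.
      by rewrite (dn j m.-1) //; lia.
    case/orP: h2 => [/eqP mN'|/negP Pm]; first by have := ltn_ord j; lia.
    by case: (boolP (P j)) => // Pj; case: Pm; exact: dn Pj.
  by rewrite -big_mkcond /= (big_ord_narrow mN) /= sum1_card card_ord.
split=> [h|[h1 h2]]; last exact: sumE.
have ex : exists m, (m == N) || ~~ P m by exists N; rewrite eqxx.
case: (ex_minnP ex) => m hm mmin.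
have mN : (m <= N)%N by apply: mmin; rewrite eqxx.
have h1 : (m == 0) || P m.-1.
  case: m hm mmin mN => // m hm mmin mN /=; apply: contraT => Pm.
  by have := mmin m; rewrite Pm orbT => /(_ isT); rewrite ltnn.
by have := sumE m mN h1 hm; rewrite h => ->.
Qed.

Variable R : realType.
Local Open Scope classical_set_scope.
Local Notation coin := (measurableTypeR R).

Lemma uniform01E (U : set coin) : measurable U ->
  uniform01 R U = @lebesgue_measure R (U `&` `[0, 1]).
Proof.
move=> mU.
rewrite /uniform01 /= /uniform_prob integral_uniform_pdf.
rewrite (eq_integral (fun=> 1%E)); last first.
  move=> x; rewrite inE => -[_ /=]; rewrite in_itv /= /uniform_pdf => ->.
  by rewrite subr0 invr1.
by rewrite integral_cst ?mul1e //; exact: measurableI.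
Qed.

Variables (D : nat) (w : nat -> R).
Hypothesis w_gt0 : forall j, 0 < w j.

(** The inverse of the cumulative distribution. Only the first D partial sums are compared, so the
    last index takes all remaining values of r; scaling r by the total replaces a normalisation of
    the weights. *)
Definition threshold_index (r : R) : nat :=
  (\sum_(j < D) (\sum_(l < j.+1) w l < r * \sum_(l < D.+1) w l)%R)%N.

Lemma threshold_index_le r : (threshold_index r <= D)%N.
Proof.
rewrite /threshold_index -[leqRHS](card_ord D) -sum1_card.
by apply: leq_sum => j _; case: (_ < _).
Qed.

Let cum (k : nat) : R := (\sum_(l < k) w l) / \sum_(l < D.+1) w l.

Let total_gt0 : 0 < \sum_(l < D.+1) w l.
Proof.
by rewrite big_ord_recr /= ltr_wpDl // sumr_ge0 // => j _; exact: ltW.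
Qed.

Let partial_sums_le i j : (i <= j)%N -> \sum_(l < i) w l <= \sum_(l < j) w l.
Proof.
move=> ij; rewrite -(subnKC ij) -!(big_mkord xpredT) [leRHS](@big_cat_nat _ _ _ i) ?leq_addr //=.
by rewrite lerDl sumr_ge0 // => l _; exact: ltW.
Qed.

Lemma threshold_index_eq r k : (k <= D)%N ->
  threshold_index r = k <->
  ((k == 0) || (cum k < r)) /\ ((k == D) || (r <= cum k.+1)).
Proof.
move=> kD.
have := @count_initial (fun j => \sum_(l < j.+1) w l < r * \sum_(l < D.+1) w l) D k.
rewrite -/(threshold_index r) => ->//; last first.
  by move=> i j ij; apply: le_lt_trans; apply: partial_sums_le.
rewrite /cum -leNgt ler_pdivlMr // ltr_pdivrMr //.
by case: k kD.
Qed.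

Lemma threshold_set_measurable k :
  measurable ([set r | threshold_index r = k] : set coin).
Proof.
have [kD|kD] := leqP k D; last first.
  rewrite (_ : [set _ | _] = set0); first exact: measurable0.
  by apply/seteqP; split => // r /= h; have := threshold_index_le r; rewrite h leqNgt kD.
rewrite (_ : [set _ | _] = (if k == 0 then setT else `]cum k, +oo[) `&`
   (if k == D then setT else `]-oo, cum k.+1])).
  by apply: measurableI; case: ifP => // _; exact: measurable_itv.
apply/seteqP; split => r /=.
  move=> /(threshold_index_eq _ kD) [h1 h2]; split.
    by case: ifP h1 => //= _; rewrite in_itv /= andbT.
  by case: ifP h2 => //= _; rewrite in_itv /=.
case=> h1 h2; apply/(threshold_index_eq _ kD); split.
  by case: (k == 0) h1 => //=; rewrite in_itv /= andbT.
by case: (k == D) h2 => //=; rewrite in_itv /=.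
Qed.

Lemma threshold_set_law k : (k <= D)%N ->
  uniform01 R ([set r | threshold_index r = k] : set coin) =
  (w k / \sum_(l < D.+1) w l)%:E.
Proof.
move=> kD; rewrite uniform01E; last exact: threshold_set_measurable.
have c0 : cum 0 = 0 by rewrite /cum big_ord0 mul0r.
have c1 : cum D.+1 = 1 by rewrite /cum divff // gt_eqF.
have cle i j : (i <= j)%N -> cum i <= cum j.
  by move=> ij; rewrite ler_pM2r ?invr_gt0 // partial_sums_le.
have ck : cum k.+1 - cum k = w k / \sum_(l < D.+1) w l.
  by rewrite /cum -mulrBl big_ord_recr /= addrAC subrr add0r.
have clt : cum k < cum k.+1 by rewrite -subr_gt0 ck divr_gt0.
(* The cells are open on the left and closed on the right, except that the first one also contains
   0. *)
rewrite (_ : _ `&` _ = [set` Interval (BSide (k == 0) (cum k)) (BRight (cum k.+1))]).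
  by rewrite lebesgue_measure_itv /= lte_fin clt -EFinB ck.
have l0 : 0 <= cum k by rewrite -c0 cle.
have l1 : cum k.+1 <= 1 by rewrite -c1 cle.
apply/seteqP; split => r /=; rewrite !itv_boundlr /= ?bnd_simp.
  case=> /(threshold_index_eq _ kD) [h1 h2] /andP[r0 r1].
  apply/andP; split.
    by case: eqP h1 => [->|_] //=; rewrite c0.
  by case: eqP h2 => [->|_] //=; rewrite c1.
case/andP => h1 h2; split.
  apply/(threshold_index_eq _ kD); split.
    by case: (k == 0) h1.
  by rewrite h2 orbT.
apply/andP; split; last exact: le_trans l1.
by case: (k == 0) h1 => /= [|/ltW] h1; exact: le_trans l0 h1.
Qed.

End threshold_selection.

(** * Frank-Wolfe *)

Section averaging.
Variables (R : realType) (K : Type).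
Implicit Types (g : K -> R) (h : nat -> K).

(* Frank-Wolfe iterate after t steps with vertices h 0, h 1, and so on, read through
   g: the iterate is linear in g, so its coordinates and its margins on the samples
   are both of this form. *)
Fixpoint fwavg g h (t : nat) : R :=
  if t is t'.+1 then
    t'%:R / (t' + 2)%:R * fwavg g h t' + 2 / (t' + 2)%:R * g (h t')
  else 0.

Lemma fwavg_ext g h h' t : (forall j, (j < t)%N -> h j = h' j) ->
  fwavg g h t = fwavg g h' t.
Proof.
elim: t => //= t IH e; rewrite IH ?e // => j jt; apply: e; exact: ltnW.
Qed.

Lemma fwavg_coefs (t : nat) : t%:R / (t + 2)%:R + 2 / (t + 2)%:R = 1 :> R.
Proof. by rewrite -mulrDl -natrD divff // pnatr_eq0 addn2. Qed.

Lemma fwavg_bound g h t (L : R) : 0 <= L -> (forall k, `|g k| <= L) ->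
  `|fwavg g h t| <= L.
Proof.
move=> L0 gL; elim: t => [|t IH] /=; first by rewrite normr0.
apply: le_trans (ler_normD _ _) _; rewrite !normrM.
have h1 : 0 <= t%:R / (t + 2)%:R :> R by rewrite divr_ge0.
have h2 : 0 <= 2 / (t + 2)%:R :> R by rewrite divr_ge0.
rewrite -!normrM (normrM (_ / _)) (ger0_norm h1) (normrM (2 / _)) (ger0_norm h2).
have := ler_wpM2l h1 IH; have := ler_wpM2l h2 (gL (h t)).
have := fwavg_coefs t; set a := _ / _ in h1 *; set b := 2 / _ in h2 *.
by move=> e u v; rewrite -[leRHS]mul1r -e mulrDl lerD.
Qed.

Lemma fwavg_sum (I : finType) (c : I -> R) (g : I -> K -> R) h t :
  fwavg (fun k => \sum_i c i * g i k) h t = \sum_i c i * fwavg (g i) h t.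
Proof.
elim: t => [|t IH] /=; first by rewrite big1 // => i _; rewrite mulr0.
rewrite IH !mulr_sumr -big_split; apply: eq_bigr => i _ /=; ring.
Qed.

Lemma fwavg_eq g g' h t : g =1 g' -> fwavg g h t = fwavg g' h t.
Proof. by move=> e; elim: t => //= t ->; rewrite e. Qed.

End averaging.

(** * Convergence with inexactly chosen vertices *)

Section frank_wolfe.
Variables (R : realType) (S : eqType) (K : finType) (X : seq S).
Variables (b : S -> K -> R) (lam : R) (h : nat -> K) (q : K -> R).
Hypothesis lam_ge0 : 0 <= lam.
Hypothesis b_le : forall x k, `|b x k| <= lam.
Hypothesis q_ge0 : forall k, 0 <= q k.
Hypothesis q_sum : \sum_k q k = 1.

Definition margin t x : R := fwavg (b x) h t.
Definition loss t : R := \sum_(x <- X) expR (- margin t x).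
(** Minus the derivative of the loss at the current iterate in the direction of vertex k, so the
    best vertex maximises it. *)
Definition correlation t k : R := \sum_(x <- X) b x k * expR (- margin t x).
Definition opt_margin x : R := \sum_k q k * b x k.
Definition opt_loss : R := \sum_(x <- X) expR (- opt_margin x).

Variable g : nat -> R.
Hypothesis g_gap : forall t k, correlation t k <= correlation t (h t) + g t.
Hypothesis g_ge0 : forall t, 0 <= g t.

Lemma margin_bound t x : `|margin t x| <= lam.
Proof. exact: fwavg_bound. Qed.

Lemma opt_margin_bound x : `|opt_margin x| <= lam.
Proof.
apply: le_trans (ler_norm_sum _ _ _) _.
rewrite -[leRHS]mul1r -q_sum mulr_suml; apply: ler_sum => k _.
by rewrite normrM (ger0_norm (q_ge0 k)) ler_wpM2l.
Qed.

Let curv : R := (size X)%:R * expR lam * (4 * lam ^+ 2).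

(** Smoothness controls the loss after the step, with margins moving by at most 2 lam u; convexity
    bounds the current gap by its linearisation; averaging [g_gap] over [q] compares the comparator
    with the chosen vertex. *)
Lemma frank_wolfe_step t (u := 2 / (t + 2)%:R : R) :
  loss t.+1 - opt_loss <=
  (1 - u) * (loss t - opt_loss) + u * g t + u ^+ 2 * curv.
Proof.
have u0 : 0 <= u by rewrite divr_ge0.
have ut : t%:R / (t + 2)%:R = 1 - u by have := fwavg_coefs R t; rewrite -/u; lra.
have h1 : loss t.+1 <= \sum_(x <- X) (expR (- margin t x)
    - u * (b x (h t) * expR (- margin t x)) + u * (margin t x * expR (- margin t x))
    + u ^+ 2 * (expR lam * (4 * lam ^+ 2))).
  apply: ler_sum => x _.
  have := exp_neg_upper (margin_bound t x) (margin_bound t.+1 x).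
  have -> : margin t.+1 x - margin t x = u * (b x (h t) - margin t x).
    by rewrite /margin /= -/u ut; ring.
  move=> hu; apply: (le_trans hu).
  have h2 : (b x (h t) - margin t x) ^+ 2 <= (2 * lam) ^+ 2.
    apply: sqr_le_of_norm; apply: le_trans (ler_normB _ _) _.
    by have := b_le x (h t); have := margin_bound t x; lra.
  have := ler_wpM2l (mulr_ge0 (expR_ge0 lam) (sqr_ge0 u)) h2.
  by rewrite !exprMn; lra.
have h3 : loss t - opt_loss <= \sum_(x <- X) (opt_margin x * expR (- margin t x)
   - margin t x * expR (- margin t x)).
  rewrite /loss /opt_loss -sumrB; apply: ler_sum => x _.
  have := exp_neg_lower (margin_bound t x) (opt_margin_bound x).
  have : 0 <= expR (- lam) / 4 * (opt_margin x - margin t x) ^+ 2.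
    by rewrite mulr_ge0 ?sqr_ge0 // divr_ge0 // expR_ge0.
  by lra.
have h4 : \sum_(x <- X) opt_margin x * expR (- margin t x) <= correlation t (h t) + g t.
  have -> : \sum_(x <- X) opt_margin x * expR (- margin t x) = \sum_k q k * correlation t k.
    rewrite /correlation; under eq_bigr do rewrite /opt_margin mulr_suml.
    rewrite exchange_big /=; apply: eq_bigr => k _.
    by rewrite mulr_sumr; apply: eq_bigr => x _; rewrite mulrA.
  rewrite -[leRHS]mul1r -q_sum mulr_suml; apply: ler_sum => k _.
  exact: ler_wpM2l.
have e1 : \sum_(x <- X) (expR (- margin t x)
    - u * (b x (h t) * expR (- margin t x)) + u * (margin t x * expR (- margin t x))
    + u ^+ 2 * (expR lam * (4 * lam ^+ 2))) =
  loss t - u * correlation t (h t) + u * (\sum_(x <- X) margin t x * expR (- margin t x))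
    + u ^+ 2 * curv.
  rewrite !big_split /= sumrN -!mulr_sumr; congr (_ + _ + _ + _).
  by rewrite big_const_seq count_predT iter_addr_0 -[lam *+ _]mulr_natl /curv; congr (_ * _); ring.
have e2 : \sum_(x <- X) (opt_margin x * expR (- margin t x)
   - margin t x * expR (- margin t x)) = \sum_(x <- X) opt_margin x * expR (- margin t x)
   - \sum_(x <- X) margin t x * expR (- margin t x) by rewrite sumrB.
rewrite e1 in h1; rewrite e2 in h3.
set mm := \sum_(x <- X) margin t x * _ in h1 h3.
set om := \sum_(x <- X) opt_margin x * _ in h3 h4.
have h5 : u * (loss t - opt_loss) <= u * (correlation t (h t) + g t - mm).
  by rewrite ler_wpM2l //; lra.
lra.
Qed.

(** With steps u = 2 / (t + 2), weighting the gap by t (t + 1) makes the factor 1 - u telescope. The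
    error [g t] then carries the coefficient 2 (t + 1) <= 2 T, so only the plain sum of the errors
    has to be controlled, never a single one. *)
Lemma frank_wolfe_sum T :
  (T * T.+1)%:R * (loss T - opt_loss) <=
  2 * T%:R * (\sum_(t < T) g t) + 4 * T%:R * curv.
Proof.
have curv0 : 0 <= curv by rewrite !mulr_ge0 ?expR_ge0 ?sqr_ge0.
elim: T => [|T IH]; first by rewrite mul0n big_ord0 !(mul0r, mulr0, addr0).
have := frank_wolfe_step T; set u := 2 / _.
have a0 : 0 <= (T.+1 * T.+2)%:R :> R by [].
move=> /(ler_wpM2l a0) hs; apply: (le_trans hs).
have t2 : (T + 2)%:R != 0 :> R by rewrite pnatr_eq0 addn2.
have e1 : (T.+1 * T.+2)%:R * (1 - u) = (T * T.+1)%:R :> R.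
  rewrite /u !natrM -!natr1; field.
  by move: t2; rewrite natrD.
have e2 : (T.+1 * T.+2)%:R * u = 2 * T.+1%:R :> R.
  rewrite /u !natrM -!natr1; field.
  by move: t2; rewrite natrD.
have e3 : (T.+1 * T.+2)%:R * u ^+ 2 <= 4 :> R.
  rewrite expr2 mulrA e2 /u mulrA ler_pdivrMr; last by rewrite ltr0n addn2.
  by rewrite natrD -natr1; lra.
have dist (N v A B c : R) : N * ((1 - v) * A + v * B + v ^+ 2 * c) =
    N * (1 - v) * A + N * v * B + N * v ^+ 2 * c by ring.
rewrite dist e1 e2.
have h1 := ler_wpM2r curv0 e3.
have gs : 0 <= \sum_(t < T) g t by apply: sumr_ge0.
rewrite big_ord_recr /= -natr1.
have h2 : T%:R * (\sum_(t < T) g t) <= (T%:R + 1) * (\sum_(t < T) g t) by rewrite mulrDl mul1r lerDl.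
move: IH h1 h2; rewrite -natr1; set sg := \sum_(t < T) g t; set l := (T * T.+1)%:R * (loss T - opt_loss).
move=> IH h1 h2; move: IH; rewrite natrM -natr1 in l *.
lra.
Qed.

Lemma frank_wolfe_gap T : (0 < T)%N ->
  T.+1%:R * (loss T - opt_loss) <= 2 * (\sum_(t < T) g t) + 4 * curv.
Proof.
move=> T0; have := frank_wolfe_sum T.
have Tp : 0 < T%:R :> R by rewrite ltr0n.
move=> hs; rewrite -(ler_pM2l Tp); move: hs; rewrite natrM; lra.
Qed.

End frank_wolfe.

(** * Private vertex selection *)

Section chain_products.
Variables (R : realType) (K : finType).
Implicit Types (p f : seq K -> K -> R) (past ks : seq K).

Lemma chain_prod (k0 : K) f past ks :
  chain f past ks =
  \prod_(j < size ks) f (past ++ take j ks) (nth k0 ks j).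
Proof.
elim: ks past => [|k ks IH] past /=; first by rewrite big_ord0.
rewrite big_ord_recl /= cats0 IH; congr (_ * _); apply: eq_bigr => j _ /=.
by rewrite cat_rcons.
Qed.

End chain_products.

Section private_selection.
Variables (R : realType) (d T : nat) (lam eta : R).

(* The 2d vertices of the l1 ball: v < d stands for lam * e_v, and d + j for
   - lam * e_j. *)
Definition vertex := 'I_(d.-1 + d).+1.

Definition bit_sign (x : seq bool) (j : nat) : R := spin R (nth false x j).

(* The features of z for the regression of coordinate i, multiplied by the label
   z_i; position i, where z_i itself would stand, carries the constant feature
   whose coefficient is theta_i. *)
Definition feature (i : nat) (x : seq bool) (j : nat) : R :=
  if j == i then bit_sign x i else bit_sign x i * bit_sign x j.

Definition vertex_margin (i : nat) (x : seq bool) (v : nat) : R :=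
  lam * (if (v < d)%N then feature i x v else - feature i x (v - d)).

Definition block (i : nat) (path : seq vertex) (t : nat) : vertex :=
  nth ord0 path (i * T + t).

Definition block_score (X : seq (seq bool)) (i : nat) (h : nat -> vertex) (t v : nat) : R :=
  eta * \sum_(x <- X) vertex_margin i x v *
          expR (- fwavg (fun k : vertex => vertex_margin i x k) h t).

(** The number of choices already made tells where the algorithm stands: position i T + t is step t
    of the regression of coordinate i. *)
Definition score X (past : seq vertex) (v : nat) : R :=
  block_score X (size past %/ T) (block (size past %/ T) past) (size past %% T) v.

Definition selection_prob X past : vertex -> R := softmax (fun v : vertex => score X past v).

Definition select X past (r : R) : vertex :=
  inord (threshold_index (d.-1 + d) (fun v => expR (score X past v)) r).

(** Coordinate j of the final iterate of regression i, divided by lam. *)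
Definition signed_weight (path : seq vertex) (i j : nat) : R :=
  fwavg (fun k : vertex => (k == j :> nat)%:R - (k == d + j :> nat)%N%:R)
    (block i path) T.

Definition estimate (path : seq vertex) : 'M[R]_d :=
  \matrix_(i < d, j < d) if i == j then 0 else lam * signed_weight path i j.

Lemma normr_spin (c : bool) : `|spin R c| = 1.
Proof. by case: c; rewrite /= ?normrN normr1. Qed.

Lemma normr_feature i x j : `|feature i x j| = 1.
Proof. by rewrite /feature; case: ifP; rewrite ?normrM !normr_spin ?mulr1. Qed.

Lemma normr_vertex_margin i x v : 0 <= lam -> `|vertex_margin i x v| = lam.
Proof.
move=> l0; rewrite normrM ger0_norm //.
by case: ifP; rewrite ?normrN normr_feature mulr1.
Qed.

Lemma selection_prob_gt0 X past k : 0 < selection_prob X past k.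
Proof. exact: softmax_gt0. Qed.

Lemma selection_prob_sum1 X past : \sum_k selection_prob X past k = 1.
Proof. exact: (softmax_sum1 _ ord0). Qed.

Lemma select_eq X past (k : vertex) :
  [set r | select X past r = k]%classic =
  [set r | threshold_index (d.-1 + d) (fun v => expR (score X past v)) r = k]%classic.
Proof.
apply/seteqP; split => r /=; rewrite /select.
  move=> /(congr1 (@nat_of_ord _)); rewrite inordK // ltnS.
  exact: threshold_index_le.
by move=> ->; rewrite inord_val.
Qed.

Lemma select_measurable X past (k : vertex) :
  measurable ([set r | select X past r = k]%classic : set (measurableTypeR R)).
Proof.
rewrite select_eq; apply: threshold_set_measurable => j; exact: expR_gt0.
Qed.

Lemma select_law X past (k : vertex) :
  uniform01 R ([set r | select X past r = k]%classic : set (measurableTypeR R)) =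
  (selection_prob X past k)%:E.
Proof.
rewrite select_eq threshold_set_law //; first by move=> j; exact: expR_gt0.
by rewrite -ltnS.
Qed.

Section output_law.
Variables (N m : nat) (X : seq (seq bool)).
Hypothesis Nm : (N <= m)%N.

Definition coin_output (u : m.-tuple (measurableTypeR R)) : matrix_space R d :=
  estimate (selections (select X) N [::] u).

(** One law with two descriptions: as an image of the coins, which is what the program realises, and
    as a finite mixture, on which privacy and accuracy are computed. *)
Lemma output_law : exists P : probability (matrix_space R d) R,
  (forall E : set (matrix_space R d), measurable E ->
     P E = coins_law R m [set u | E (coin_output u)]%classic) /\
  mixture (fun t : N.-tuple vertex => estimate t : matrix_space R d) P
    (fun t => chain (selection_prob X) [::] t).
Proof.
have h Q := @selections_mixture R _ (select X) (selection_prob X)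
  (select_measurable X) (select_law X) m N Q Nm.
have mf : measurable_fun [set: m.-tuple (measurableTypeR R)]%classic coin_output.
  move=> _ Y mY; rewrite setTI.
  exact: (h (fun s => Y (estimate s))).1.
pose f : {mfun (m.-tuple (measurableTypeR R)) >-> (matrix_space R d)} :=
  HB.pack coin_output (isMeasurableFun.Build _ _ _ _ coin_output mf).
exists (distribution (coins_law R m) f); split => // E mE.
exact: (h (fun s => E (estimate s))).2.
Qed.

End output_law.

Lemma measurable_matrix_pt (y : matrix_space R d) : measurable [set y]%classic.
Proof.
have -> : [set y]%classic = (\bigcap_(ij in [set: 'I_d * 'I_d])
    ((fun M : 'M[R]_d => M ij.1 ij.2) @^-1` [set (y : 'M[R]_d) ij.1 ij.2]))%classic.
  apply/seteqP; split => [M /= -> //|M /= h]; apply/matrixP => i j.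
  exact: (h (i, j)).
apply: fin_bigcap_measurable => //.
move=> [i j] _; apply: sub_sigma_algebra; exists i, j, [set (y : 'M[R]_d) i j]%classic.
by split => //; exact: measurable_set1.
Qed.

Lemma output_privacy (N : nat) (X X' : seq (seq bool)) (e a : R)
    (P Q : probability (matrix_space R d) R) :
  (forall past v, `|score X past v - score X' past v| <= e / 2) ->
  mixture (fun t : N.-tuple vertex => estimate t : matrix_space R d) P
    (fun t => chain (selection_prob X) [::] t) ->
  mixture (fun t : N.-tuple vertex => estimate t : matrix_space R d) Q
    (fun t => chain (selection_prob X') [::] t) ->
  1 < a -> (renyi_div a P Q <= (N%:R * (9 * e ^+ 2) * a)%:E)%E.
Proof.
move=> hs hP hQ a1.
have e0 : 0 <= e by have := hs [::] 0%N; have := normr_ge0 (score X [::] 0%N - score X' [::] 0%N); lra.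
have p0 X0 s k : 0 < selection_prob X0 s k := selection_prob_gt0 X0 s k.
apply: (renyi_mixture_le measurable_matrix_pt _ _ hP hQ) => //.
- by move=> t; exact: chain_gt0.
- by move=> t; exact: chain_gt0.
rewrite (eq_bigr (fun t : N.-tuple vertex => chain (selection_prob X') [::] t *
   chain (fun s k => (selection_prob X s k / selection_prob X' s k) `^ a) [::] t)); last first.
  by move=> t _; rewrite chain_powR.
apply: le_trans (chain_expectation_le (b := fun=> expR (a * (a - 1) * (9 * e ^+ 2))) _ _ _ _ _ _) _.
- by move=> *; exact: ltW.
- by move=> *; exact: powR_ge0.
- by move=> _; exact: expR_ge0.
- move=> s; apply: renyi_pure_dp => //; try exact: selection_prob_sum1.
  + by move=> k; apply: softmax_ratio => l; exact: hs.
  + by move=> k; apply: softmax_ratio => l; rewrite distrC; exact: hs.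
by rewrite prodr_const card_ord -expRM_natl; rewrite ler_expR; lra.
Qed.

End private_selection.

(** * Effect of one sample on the scores *)

Section sensitivity.
Variables (R : realType) (d T n : nat) (lam eta : R).
Hypothesis lam_ge0 : 0 <= lam.
Hypothesis eta_ge0 : 0 <= eta.

Definition samples (X : n.-tuple (d.-tuple bool)) : seq (seq bool) :=
  [seq tval x | x <- X].

Lemma big_samples (X : n.-tuple (d.-tuple bool)) (F : seq bool -> R) :
  \sum_(x <- samples X) F x = \sum_(k < n) F (tnth X k).
Proof. by rewrite /samples big_map big_tuple. Qed.

(** Both scores refer to the same past, so only the summand of the changed sample differs. Each
    summand is at most [lam * expR lam], since an iterate built from any past has margins in
    [-lam, lam]. *)
Lemma score_sensitivity (X X' : n.-tuple (d.-tuple bool)) (past : seq (vertex d)) v :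
  neighbors X X' ->
  `|score T lam eta (samples X) past v - score T lam eta (samples X') past v|
    <= eta * (2 * lam * expR lam).
Proof.
move=> /mem_card1 [k0 hk].
rewrite /score /block_score -mulrBr normrM ger0_norm //; apply: ler_wpM2l => //.
set i := (_ %/ _)%N; set t := (_ %% _)%N; set h := block _ _ _.
set F := fun x => vertex_margin d lam i x v *
  expR (- fwavg (fun k : vertex d => vertex_margin d lam i x k) h t).
have FB x : `|F x| <= lam * expR lam.
  rewrite /F normrM normr_vertex_margin // ler_wpM2l //.
  rewrite ger0_norm ?expR_ge0 // ler_expR.
  have := @fwavg_bound R _ (fun k : vertex d => vertex_margin d lam i x k) h t lam lam_ge0.
  rewrite ler_norml => /(_ _)/andP[|+ _]; last by lra.
  by move=> k; rewrite normr_vertex_margin.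
rewrite (big_samples X F) (big_samples X' F) -sumrB (bigD1 k0) //= big1 ?addr0.
  apply: le_trans (ler_normB _ _) _.
  have := FB (tnth X k0); have := FB (tnth X' k0); lra.
move=> k kk0; have := hk k; rewrite !inE (negbTE kk0) => /negbFE/eqP ->.
by rewrite subrr.
Qed.

End sensitivity.

(** * Exponential tail of the accumulated excess *)

Section block_products.
Variable R : realType.

Lemma prod_block (d T i : nat) (F : nat -> R) : (i < d)%N -> (0 < T)%N ->
  \prod_(j < d * T) (if (j %/ T)%N == i then F j else 1) =
  \prod_(s < T) F (i * T + s)%N.
Proof.
move=> id T0.
have h1 : (i * T <= i.+1 * T)%N by rewrite leq_pmul2r.
have h2 : (i.+1 * T <= d * T)%N by rewrite leq_pmul2r.
rewrite -(big_mkord xpredT (fun j => if (j %/ T)%N == i then F j else 1)).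
rewrite (@big_cat_nat _ _ _ (i * T)) //=; last exact: leq_trans h2.
rewrite big_nat_cond big1 ?mul1r; last first.
  move=> j /andP[/andP[_ jT] _]; case: eqP => // e.
  by move: jT; rewrite ltnNge -leq_divRL // e leqnn.
rewrite (@big_cat_nat _ _ _ (i.+1 * T)) //= [X in _ * X]big_nat_cond [X in _ * X]big1 ?mulr1; last first.
  move=> j /andP[/andP[jT _] _]; case: eqP => // e.
  by move: jT; rewrite -leq_divRL // e ltnn.
rewrite -{1}[(i * T)%N]add0n mulSn big_addn addnK big_mkord.
apply: eq_bigr => s _.
by rewrite divnDMl // divn_small // eqxx addnC.
Qed.

End block_products.

Section excess.
Variables (R : realType) (d T : nat) (lam eta : R) (X : seq (seq bool)).
Hypothesis d_gt0 : (0 < d)%N.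
Hypothesis T_gt0 : (0 < T)%N.
Local Notation V := (vertex d).
Local Notation block_scoreX := (block_score lam eta X).
Local Notation scoreX := (score T lam eta X).

Definition excess (i : nat) (h : nat -> V) (s : nat) : R :=
  block_scoreX i h s [arg max_(v > (ord0 : V)) block_scoreX i h s v]%O
  - block_scoreX i h s (h s).

Definition score_excess (past : seq V) (k : V) : R :=
  scoreX past [arg max_(v > (ord0 : V)) scoreX past v]%O - scoreX past k.

Lemma excess_max i h s (v : V) :
  block_scoreX i h s v <= block_scoreX i h s (h s) + excess i h s.
Proof.
rewrite /excess addrC subrK; case: arg_maxP => // w _ h1; exact: h1.
Qed.

Lemma excess_ge0 i h s : 0 <= excess i h s.
Proof. by have := excess_max i h s (h s); rewrite lerDl. Qed.

(** A score depends only on earlier choices of its own block, so the sequential scores seen by the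
    mechanism are those of the i-th regression read off the complete path. *)
Lemma score_take (path : seq V) i s (v : nat) :
  (i * T + s < size path)%N -> (s < T)%N ->
  scoreX (take (i * T + s) path) v = block_scoreX i (block T i path) s v.
Proof.
move=> hs sT; rewrite /score size_takel; last exact: ltnW.
rewrite divnMDl // divn_small // addn0 modnMDl modn_small //.
rewrite /block_score; congr (_ * _); apply: eq_bigr => x _.
congr (_ * expR (- _)); apply: fwavg_ext => j js.
by rewrite /block nth_take // ltn_add2l.
Qed.

Lemma score_excess_take (path : seq V) i s :
  (i * T + s < size path)%N -> (s < T)%N ->
  score_excess (take (i * T + s) path) (nth ord0 path (i * T + s)) =
  excess i (block T i path) s.
Proof.
move=> hs sT; rewrite /score_excess /excess score_take //.
have e : (fun v : V => scoreX (take (i * T + s) path) v) =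
  (fun v : V => block_scoreX i (block T i path) s v).
  by apply/funext => v; rewrite score_take.
by rewrite e score_take.
Qed.

(* The exponential moment of the excess is at most 2d at each step of block i, hence
   (2d)^T in total. *)
Lemma excess_tail (i : nat) (G : R) : (i < d)%N ->
  \sum_(t : (d * T).-tuple V | G < \sum_(s < T) excess i (block T i t) s)
     chain (selection_prob T lam eta X) [::] t <= (d + d)%:R ^+ T * expR (- G).
Proof.
move=> id.
(* The excess is exponentiated inside block i only; elsewhere the factor is 1, so the other
   regressions contribute nothing to the moment. *)
pose f (past : seq V) (k : V) : R :=
  if (size past %/ T)%N == i then expR (score_excess past k) else 1.
pose b (m : nat) : R := if (m %/ T)%N == i then (d + d)%:R else 1.
have f0 (s : seq V) (k : V) : 0 <= f s k by rewrite /f; case: ifP; rewrite // expR_ge0.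
have p0 (s : seq V) (k : V) : 0 <= selection_prob T lam eta X s k by exact/ltW/selection_prob_gt0.
have chainf (t : (d * T).-tuple V) :
    chain f [::] t = expR (\sum_(s < T) excess i (block T i t) s).
  rewrite (chain_prod ord0) size_tuple /f.
  rewrite (eq_bigr (fun j : 'I_(d * T) => if (j %/ T)%N == i then
     expR (score_excess (take j t) (nth ord0 t j)) else 1)); last first.
    by move=> j _; rewrite /= size_takel // size_tuple ltnW.
  rewrite (prod_block (fun j => expR (score_excess (take j t) (nth ord0 t j)))) //.
  rewrite expR_sum; apply: eq_bigr => s _; rewrite score_excess_take //.
  rewrite size_tuple; have := ltn_ord s.
  have : (i.+1 * T <= d * T)%N by rewrite leq_mul2r id orbT.
  by rewrite mulSn; lia.
have hb (s : seq V) : \sum_k selection_prob T lam eta X s k * f s k <= b (size s).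
  rewrite /f /b; case: ifP => _.
    have -> : (d + d)%:R = #|V|%:R :> R by rewrite card_ord -addSn prednK.
    apply: softmax_excess => [k|]; last by eexists.
    by case: arg_maxP => // w _ h1; exact: h1.
  by under eq_bigr do rewrite mulr1; rewrite selection_prob_sum1.
have eb : \prod_(j < d * T) b (size ([::] : seq V) + j)%N = (d + d)%:R ^+ T.
  rewrite /b /= (prod_block (fun=> (d + d)%:R)) //.
  by rewrite prodr_const card_ord.
have b0 m : 0 <= b m by rewrite /b; case: ifP.
have h := chain_expectation_le [::] (d * T) p0 f0 b0 hb.
rewrite eb in h.
rewrite expRN ler_pdivlMr ?expR_gt0 //; apply: le_trans h.
rewrite [leRHS](bigID (fun t : (d * T).-tuple V => G < \sum_(s < T) excess i (block T i t) s)) /=.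
rewrite mulr_suml ler_wpDr //.
  by apply: sumr_ge0 => t _; rewrite mulr_ge0 ?chain_ge0.
apply: ler_sum => t Gt; rewrite ler_wpM2l ?chain_ge0 //.
by rewrite chainf ler_expR ltW.
Qed.

Hypothesis lam_ge0 : 0 <= lam.
Hypothesis eta_gt0 : 0 < eta.

Lemma optimization_gap (i : nat) (h : nat -> V) (q : V -> R) :
  (forall k, 0 <= q k) -> \sum_k q k = 1 ->
  T.+1%:R * (loss X (fun x (k : V) => vertex_margin d lam i x k) h T
     - opt_loss X (fun x (k : V) => vertex_margin d lam i x k) q) <=
  2 * ((\sum_(s < T) excess i h s) / eta)
   + 16 * ((size X)%:R * expR lam * lam ^+ 2).
Proof.
move=> q0 q1; set b := fun (x : seq bool) (k : V) => _.
have bl x k : `|b x k| <= lam by rewrite normr_vertex_margin.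
pose g s := excess i h s / eta.
have gg t k : correlation X b h t k <= correlation X b h t (h t) + g t.
  rewrite -(ler_pM2l eta_gt0) mulrDr.
  have -> : eta * g t = excess i h t by rewrite mulrC divfK ?gt_eqF.
  exact: excess_max.
have g0 t : 0 <= g t by rewrite divr_ge0 ?excess_ge0 // ltW.
have := frank_wolfe_gap lam_ge0 bl q0 q1 gg g0 T_gt0.
rewrite -mulr_suml; lra.
Qed.

End excess.

(** * Program logic *)

Section program_logic.
Variable R : realType.
Implicit Types (s : store R) (u : seq R) (c : cmd).

(** [implements] measures the coins for which some run ends in the event; determinism identifies
    that run with the one exhibited by the program logic. *)
Lemma exec_deterministic c s u t1 s1 u1 t2 s2 u2 :
  exec c s u t1 s1 u1 -> exec c s u t2 s2 u2 -> s1 = s2 /\ u1 = u2.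
Proof.
move=> h; elim: h t2 s2 u2 => {c s u t1 s1 u1}.
- by move=> s u t2 s2 u2 h; inversion h; subst.
- by move=> x e s u t2 s2 u2 h; inversion h; subst.
- by move=> a i j e s u t2 s2 u2 h; inversion h; subst.
- by move=> a i j s r u t2 s2 u2 h; inversion h; subst.
- move=> c1 c2 s0 u0 t1 s1 u1 t2 s2 u2 _ IH1 _ IH2 t3 s3 u3 h.
  inversion h; subst.
  match goal with H : exec c1 _ _ _ _ _ |- _ => case: (IH1 _ _ _ H) => e1 e2; subst end.
  by match goal with H : exec c2 _ _ _ _ _ |- _ => case: (IH2 _ _ _ H) end.
- move=> b c1 c2 s u t s' u' _ IH t2 s2 u2 h; inversion h; subst.
  by match goal with H : exec (if _ then _ else _) _ _ _ _ _ |- _ => exact: IH H end.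
- move=> b c s u nb t2 s2 u2 h; inversion h; subst => //.
  by match goal with H : is_true (beval _ _) |- _ => rewrite H in nb end.
- move=> b c s0 u0 t1 s1 u1 t2 s2 u2 hb _ IH1 _ IH2 t3 s3 u3 h.
  inversion h; subst.
    by match goal with H : is_true (~~ beval _ _) |- _ => rewrite hb in H end.
  match goal with H : exec c _ _ _ _ _ |- _ => case: (IH1 _ _ _ H) => e1 e2; subst end.
  by match goal with H : exec (While _ _) _ _ _ _ _ |- _ => case: (IH2 _ _ _ H) end.
Qed.

(* With M bounding the input size, c takes at most M ^ cost c steps, provided
   every loop makes at most M ^ 2 iterations. *)
Fixpoint cost c : nat :=
  match c with
  | Seq c1 c2 | If _ c1 c2 => (maxn (cost c1) (cost c2)).+1
  | While _ c => (cost c + 4)%N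
  | _ => 0%N
  end.

Definition For (x : nat) (e : iexp) (c : cmd) : cmd :=
  Seq (ISet x (IConst 0))
    (While (ILe (IAdd (IVar x) (IConst 1)) e)
       (Seq c (ISet x (IAdd (IVar x) (IConst 1))))).

Variable M : nat.
Hypothesis M_ge2 : (2 <= M)%N.

Definition wp c (Q : store R -> seq R -> Prop) s u : Prop :=
  exists t s' u', exec c s u t s' u' /\ (t <= M ^ cost c)%N /\ Q s' u'.

Lemma wp_mono c (Q Q' : store R -> seq R -> Prop) s u :
  (forall s' u', Q s' u' -> Q' s' u') -> wp c Q s u -> wp c Q' s u.
Proof.
move=> h [t [s' [u' [h1 [h2 h3]]]]]; exists t, s', u'; split => //; split => //.
exact: h.
Qed.

Lemma wp_skip Q s u : Q s u -> wp Skip Q s u.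
Proof. by move=> h; exists 1%N, s, u; split; [constructor|]. Qed.

Lemma wp_iset x e Q s u : Q (iset s x (ieval s e)) u -> wp (ISet x e) Q s u.
Proof. by move=> h; eexists _, _, _; split; [constructor|]. Qed.

Lemma wp_rset a i j e Q s u :
  Q (rset s a (ieval s i) (ieval s j) (reval s e)) u -> wp (RSet a i j e) Q s u.
Proof. by move=> h; eexists _, _, _; split; [constructor|]. Qed.

Lemma wp_draw a i j Q s r u :
  Q (rset s a (ieval s i) (ieval s j) r) u -> wp (Draw a i j) Q s (r :: u).
Proof. by move=> h; eexists _, _, _; split; [constructor|]. Qed.

Lemma exp_double a : (M ^ a + M ^ a <= M ^ a.+1)%N.
Proof. by rewrite addnn -mul2n expnS leq_mul2r M_ge2 orbT. Qed.

Lemma exp_mono a b : (a <= b)%N -> (M ^ a <= M ^ b)%N.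
Proof. by move=> ab; rewrite leq_exp2l. Qed.

Lemma wp_seq c1 c2 Q s u : wp c1 (wp c2 Q) s u -> wp (Seq c1 c2) Q s u.
Proof.
case=> t1 [s1 [u1 [h1 [l1 [t2 [s2 [u2 [h2 [l2 h]]]]]]]]].
exists (t1 + t2)%N, s2, u2; split; first by econstructor; eassumption.
split => //=; apply: leq_trans (exp_double _); apply: leq_add.
  by apply: leq_trans l1 _; rewrite exp_mono ?leq_maxl.
by apply: leq_trans l2 _; rewrite exp_mono ?leq_maxr.
Qed.

Lemma wp_if b c1 c2 Q s u :
  (beval s b -> wp c1 Q s u) -> (~~ beval s b -> wp c2 Q s u) ->
  wp (If b c1 c2) Q s u.
Proof.
move=> h1 h2.
have [t [s' [u' [h [l q]]]]] : exists t s' u',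
    exec (if beval s b then c1 else c2) s u t s' u' /\
    (t <= M ^ maxn (cost c1) (cost c2))%N /\ Q s' u'.
  case: (boolP (beval s b)) => hb.
    have [t [s' [u' [h [l q]]]]] := h1 hb; exists t, s', u'; split => //; split => //.
    by apply: leq_trans l _; rewrite exp_mono ?leq_maxl.
  have [t [s' [u' [h [l q]]]]] := h2 hb; exists t, s', u'; split => //; split => //.
  by apply: leq_trans l _; rewrite exp_mono ?leq_maxr.
exists t.+1, s', u'; split; first by constructor.
split => //=; apply: leq_trans (exp_double _); rewrite -addn1 leq_add // expn_gt0.
by rewrite (leq_trans _ M_ge2).
Qed.

Lemma wp_for x e c N (I : nat -> store R -> seq R -> Prop) s u :
  (N <= M ^ 2)%N ->
  I 0%N (iset s x 0) u ->
  (forall k s u, I k s u -> ivar s x = k /\ ieval s e = N) ->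
  (forall k s u, (k < N)%N -> I k s u ->
     wp c (fun s' u' => ivar s' x = k /\ I k.+1 (iset s' x k.+1) u') s u) ->
  wp (For x e c) (I N) s u.
Proof.
move=> NM I0 Ix step; apply: wp_seq; apply: wp_iset => /=.
set b := ILe _ _; set c' := Seq _ _.
pose B := (M ^ cost c').+1.
have loop m k s1 u1 : (k + m = N)%N -> I k s1 u1 ->
    exists t s' u', exec (While b c') s1 u1 t s' u' /\ (t <= m * B + 1)%N /\ I N s' u'.
  elim: m k s1 u1 => [|m IH] k s1 u1 km Ik; have [xk eN] := Ix _ _ _ Ik.
    rewrite addn0 in km; exists 1%N, s1, u1; split; last by rewrite -km.
    by constructor; rewrite /= xk eN; lia.
  have kN : (k < N)%N by lia.
  have [t1 [s2 [u2 [h1 [l1 h2]]]]] : wp c' (I k.+1) s1 u1.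
    apply: wp_seq; apply: wp_mono (step k s1 u1 kN Ik) => s' u' [xs' Is'].
    by apply: wp_iset; rewrite /= xs' addn1.
  have [|t2 [s3 [u3 [h3 [l3 h4]]]]] := IH k.+1 s2 u2 _ h2; first by lia.
  exists (t1 + t2).+1, s3, u3; split; last split => //.
    by econstructor; [rewrite /= xk eN; lia|exact: h1|exact: h3].
  by rewrite /B in l3 *; rewrite mulSn; lia.
have [t [s' [u' [h1 [l1 h2]]]]] := loop N 0%N _ u erefl I0.
exists t, s', u'; split => //; split => //; apply: leq_trans l1 _.
(* Of the four extra units, two pay for the at most M^2 iterations, one for the loop test added to
   each, and one for the final test. *)
have -> : cost (While b c') = (cost c' + 4)%N by [].
have M0 : (0 < M)%N by apply: leq_trans M_ge2.
have p1 : (0 < M ^ cost c')%N by rewrite expn_gt0 M0.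
have p2 : (M ^ 2 * B <= M ^ 2 * M ^ (cost c').+1)%N.
  by rewrite leq_mul2l; apply/orP; right; apply: leq_trans (exp_double _); rewrite /B; lia.
have p3 : (N * B <= M ^ 2 * B)%N by rewrite leq_mul2r NM orbT.
have p4 : (M ^ 2 * M ^ (cost c').+1 = M ^ (cost c' + 3))%N.
  by rewrite -expnD; congr (_ ^ _)%N; lia.
have p5 := exp_double (cost c' + 3).
have p6 : (0 < M ^ (cost c' + 3))%N by rewrite expn_gt0 M0.
by rewrite -addnS in p5; lia.
Qed.

Definition frame (vs arrs : seq nat) s0 s : Prop :=
  (forall x, x \notin vs -> ivar s x = ivar s0 x) /\
  (forall a, a \notin arrs -> rcell s a = rcell s0 a).

Lemma frame_refl vs arrs s : frame vs arrs s s.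
Proof. by []. Qed.

Lemma frame_iset vs arrs s0 s x v : x \in vs -> frame vs arrs s0 s ->
  frame vs arrs s0 (iset s x v).
Proof.
move=> xv [h1 h2]; split=> // y yv /=; case: eqP => [e|_]; last exact: h1.
by rewrite e xv in yv.
Qed.

Lemma frame_rset vs arrs s0 s a i j v : a \in arrs -> frame vs arrs s0 s ->
  frame vs arrs s0 (rset s a i j v).
Proof.
move=> xv [h1 h2]; split=> // y yv /=; rewrite -h2 //.
have -> : (y == a) = false by apply/eqP => e; rewrite e xv in yv.
by [].
Qed.

Lemma frame_trans vs arrs vs1 arrs1 vs2 arrs2 s0 s1 s2 :
  all (fun x => x \in vs) (vs1 ++ vs2) ->
  all (fun a => a \in arrs) (arrs1 ++ arrs2) ->
  frame vs1 arrs1 s0 s1 -> frame vs2 arrs2 s1 s2 -> frame vs arrs s0 s2.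
Proof.
move=> /allP hv /allP ha [h1 h2] [h3 h4]; split => y hy.
  rewrite h3 ?h1 //; apply: contra hy => hy; apply: hv; rewrite mem_cat hy ?orbT //.
by rewrite h4 ?h2 //; apply: contra hy => hy; apply: ha; rewrite mem_cat hy ?orbT.
Qed.

End program_logic.

(** * The program *)

Section program.

Definition cell (a : nat) : rexp := RCell a (IConst 0) (IConst 0).
Definition set_cell (a : nat) (e : rexp) : cmd := RSet a (IConst 0) (IConst 0) e.
Definition lam_exp : rexp := RCell 1 (IConst 0) (IConst 0).
Definition rho_exp : rexp := RCell 1 (IConst 0) (IConst 1).
Definition alpha_exp : rexp := RCell 1 (IConst 0) (IConst 2).

(** The number of rounds at which the curvature term 16 n exp(lam) lam^2 drops to half of T n exp(-
    3 lam) alpha^2 / 12; 384 is 16 * 24. *)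
Definition tau_exp : rexp :=
  RDiv (RMul (RMul (RNat (IConst 384)) (RMul lam_exp lam_exp))
             (RExp (RMul (RNat (IConst 4)) lam_exp)))
       (RMul alpha_exp alpha_exp).

(** The square root eps of rho / (9 d T) is written as the exponential of half a logarithm. Dividing
    by 4 lam exp(lam) turns the sensitivity 2 eta lam exp(lam) of the scores into eps / 2. *)
Definition eta_exp : rexp :=
  RDiv (RExp (RDiv (RLn (RDiv rho_exp
          (RMul (RNat (IConst 9)) (RMul (RNat (IVar 1)) (RNat (IVar 3))))))
        (RNat (IConst 2))))
       (RMul (RMul (RNat (IConst 4)) lam_exp) (RExp lam_exp)).

(* Variables: 2 = 2d, 3 = T, 4 = i, 5 = t, 6 = k, 7 = j or v, 8 = selected vertex.
   Arrays: 3 = vertex margins, 4 = margins, 5 = cumulated exponential weights,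
   6 = current iterate, 7 = tau, 8 = eta, 9 = correlation, 10 = total weight,
   11 = coin. *)
Definition setup : cmd :=
  Seq (ISet 2 (IAdd (IVar 1) (IVar 1)))
 (Seq (set_cell 7 tau_exp)
 (Seq (ISet 3 (IConst 0))
 (Seq (For 6 (IVar 0)
        (If (RLe (RNat (IVar 3)) (cell 7)) (ISet 3 (IAdd (IVar 3) (IConst 1))) Skip))
      (set_cell 8 eta_exp)))).

(** Column i first receives lam times the square of the label and is then overwritten by lam times
    the label, the constant feature; columns d to 2d - 1 are the negated copies. *)
Definition compute_features : cmd :=
  For 6 (IVar 0)
   (Seq (RSet 4 (IVar 6) (IConst 0) (RNat (IConst 0)))
   (Seq (For 7 (IVar 1)
          (RSet 3 (IVar 6) (IVar 7)
            (RMul lam_exp (RMul (RCell 0 (IVar 6) (IVar 4)) (RCell 0 (IVar 6) (IVar 7))))))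
   (Seq (RSet 3 (IVar 6) (IVar 4) (RMul lam_exp (RCell 0 (IVar 6) (IVar 4))))
        (For 7 (IVar 1)
          (RSet 3 (IVar 6) (IAdd (IVar 1) (IVar 7))
            (RSub (RNat (IConst 0)) (RCell 3 (IVar 6) (IVar 7)))))))).

Definition reset_weights : cmd :=
  For 7 (IVar 1) (RSet 6 (IVar 7) (IConst 0) (RNat (IConst 0))).

Definition compute_scores : cmd :=
  Seq (set_cell 10 (RNat (IConst 0)))
  (For 7 (IVar 2)
    (Seq (set_cell 9 (RNat (IConst 0)))
    (Seq (For 6 (IVar 0)
      (set_cell 9 (RAdd (cell 9)
        (RMul (RCell 3 (IVar 6) (IVar 7))
              (RExp (RSub (RNat (IConst 0)) (RCell 4 (IVar 6) (IConst 0))))))))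
    (Seq (set_cell 10 (RAdd (cell 10) (RExp (RMul (cell 8) (cell 9)))))
         (RSet 5 (IVar 7) (IConst 0) (cell 10)))))).

Definition select_vertex : cmd :=
  Seq (Draw 11 (IConst 0) (IConst 0))
 (Seq (ISet 8 (IConst 0))
      (For 7 (ISub (IVar 2) (IConst 1))
        (If (RLe (RMul (cell 11) (cell 10)) (RCell 5 (IVar 7) (IConst 0)))
            Skip (ISet 8 (IAdd (IVar 8) (IConst 1)))))).

Definition old_coef : rexp :=
  RDiv (RNat (IVar 5)) (RNat (IAdd (IVar 5) (IConst 2))).
Definition new_coef : rexp :=
  RDiv (RNat (IConst 2)) (RNat (IAdd (IVar 5) (IConst 2))).

Definition update_weights : cmd :=
  Seq (For 7 (IVar 1)
        (RSet 6 (IVar 7) (IConst 0) (RMul old_coef (RCell 6 (IVar 7) (IConst 0)))))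
      (If (ILe (IVar 1) (IVar 8))
        (RSet 6 (ISub (IVar 8) (IVar 1)) (IConst 0)
           (RSub (RCell 6 (ISub (IVar 8) (IVar 1)) (IConst 0)) new_coef))
        (RSet 6 (IVar 8) (IConst 0)
           (RAdd (RCell 6 (IVar 8) (IConst 0)) new_coef))).

Definition update_margins : cmd :=
  For 6 (IVar 0)
    (RSet 4 (IVar 6) (IConst 0)
      (RAdd (RMul old_coef (RCell 4 (IVar 6) (IConst 0)))
            (RMul new_coef (RCell 3 (IVar 6) (IVar 8))))).

Definition fw_step : cmd :=
  Seq compute_scores (Seq select_vertex (Seq update_weights update_margins)).

(** Entry i of the iterate estimates the external field theta_i, so the diagonal is overwritten by
    0. *)
Definition write_row : cmd :=
  Seq (For 7 (IVar 1)
        (RSet 2 (IVar 4) (IVar 7) (RMul lam_exp (RCell 6 (IVar 7) (IConst 0)))))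
      (RSet 2 (IVar 4) (IVar 4) (RNat (IConst 0))).

Definition learner : cmd :=
  Seq setup
    (For 4 (IVar 1)
      (Seq compute_features
      (Seq reset_weights
      (Seq (For 5 (IVar 3) fw_step) write_row)))).

End program.

(** * Correctness of the program *)

Section program_correctness.
Variables (R : realType) (n d : nat).
Hypothesis d_ge2 : (2 <= d)%N.
Local Notation M := (n + d)%N.
Implicit Types (s : store R) (u : seq R).

Let M_ge2 : (2 <= M)%N. Proof. lia. Qed.

Let n_le : (n <= M ^ 2)%N. Proof. rewrite expnS expn1; nia. Qed.
Let d_le : (d <= M ^ 2)%N. Proof. rewrite expnS expn1; nia. Qed.
Let dd_le : (d + d <= M ^ 2)%N. Proof. rewrite expnS expn1; nia. Qed.

(** Rule for loops that draw no coin: the random sequence and the untouched variables are carried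
    along, so [J] need only describe what the loop computes. *)
Lemma wp_for_det x e c N vs arrs (J : nat -> store R -> Prop) s u
    (Q : store R -> seq R -> Prop) :
  x \in vs -> (N <= M ^ 2)%N ->
  (forall s', frame vs arrs s s' -> ieval s' e = N) ->
  J 0%N (iset s x 0) ->
  (forall k s', (k < N)%N -> frame vs arrs s s' -> ivar s' x = k -> J k s' ->
    wp M c (fun s'' u'' => [/\ u'' = u, frame vs arrs s s'', ivar s'' x = k
       & J k.+1 (iset s'' x k.+1)]) s' u) ->
  (forall s', frame vs arrs s s' -> J N s' -> Q s' u) ->
  wp M (For x e c) Q s u.
Proof.
move=> xv NM eN J0 step fin.
pose I k s' (u' : seq R) := [/\ u' = u, frame vs arrs s s', ivar s' x = k & J k s'].
apply: (@wp_mono R M _ (I N)); first by move=> s' u' [-> f _ j]; exact: fin.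
apply: (wp_for M_ge2 NM).
- by split => //=; [apply: frame_iset => //; exact: frame_refl|rewrite eqxx].
- by move=> k s' u' [_ f xk _]; split => //; exact: eN.
move=> k s' u' kN [-> f xk j]; apply: wp_mono (step k s' kN f xk j).
move=> s'' u'' [-> f' xk' j']; split => //; split => //=; last by rewrite eqxx.
exact: frame_iset.
Qed.

(* [rounds tau k] is min (k, floor tau + 1) for tau >= 0: counting replaces the
   missing rounding operation. *)
Fixpoint rounds (tau : R) (k : nat) : nat :=
  if k is k'.+1 then (rounds tau k' + ((rounds tau k')%:R <= tau)%R)%N else 0%N.

Variables (X : n.-tuple (d.-tuple bool)) (lam rho alpha : R).

Definition tau_val : R := 384%:R * (lam * lam) * expR (4%:R * lam) / (alpha * alpha).
Definition T_val : nat := rounds tau_val n.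
Definition eta_val : R :=
  expR (ln (rho / (9%:R * (d%:R * T_val%:R))) / 2%:R) / (4%:R * lam * expR lam).

Local Notation sample k := (nth [::] (samples X) k).

Record env s : Prop := Env {
  env_n : ivar s 0 = n ;
  env_d : ivar s 1 = d ;
  env_D : ivar s 2 = (d + d)%N ;
  env_T : ivar s 3 = T_val ;
  env_X : forall k j, (k < n)%N -> (j < d)%N ->
    rcell s 0 k j = bit_sign R (sample k) j ;
  env_lam : rcell s 1 0 0 = lam ;
  env_eta : rcell s 8 0 0 = eta_val }.

Lemma env_frame vs arrs s s' :
  all (fun x => x \notin vs) [:: 0; 1; 2; 3]%N ->
  all (fun a => a \notin arrs) [:: 0; 1; 8]%N ->
  frame vs arrs s s' -> env s -> env s'.
Proof.
move=> /allP hv /allP ha [h1 h2] [e0 e1 e2 e3 eX el ee].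
have hV y : y \in [:: 0; 1; 2; 3]%N -> ivar s' y = ivar s y by move/hv/h1.
have hA y : y \in [:: 0; 1; 8]%N -> rcell s' y = rcell s y by move/ha/h2.
by split; rewrite ?hV ?hA // => k j kn jd; rewrite hA // eX.
Qed.

Lemma setup_spec u :
  wp M setup (fun s u' => [/\ u' = u, env s & forall i j, rcell s 2 i j = 0])
    (learner_input lam rho alpha X) u.
Proof.
set s0 := learner_input _ _ _ _.
apply: (wp_seq M_ge2); apply: wp_iset; apply: (wp_seq M_ge2); apply: wp_rset.
apply: (wp_seq M_ge2); apply: wp_iset; apply: (wp_seq M_ge2).
set s1 := iset _ 3 _.
apply: (@wp_for_det 6%N _ _ n [:: 6; 3]%N [::]
  (fun k s => ivar s 3 = rounds tau_val k)) => //.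
- by move=> s' [h _] /=; rewrite h.
- move=> k s' kn f xk j3.
  have t7 : reval s' (cell 7) = tau_val by rewrite /= f.2 //= /s0 /=.
  have ge : reval s' (RNat (IVar 3)) = (rounds tau_val k)%:R by rewrite /= j3.
  apply: (wp_if M_ge2); rewrite /beval t7 ge => hb.
    apply: wp_iset; split => //; first exact: frame_iset.
    by rewrite /= j3 hb addn1.
  apply: wp_skip; split => //.
  by rewrite /= j3 (negbTE hb) addn0.
move=> s' f j3; apply: wp_rset; split => //.
  have hv x : x \in [:: 0; 1; 2]%N -> ivar s' x = ivar s1 x.
    by move=> hx; apply: f.1; move: x hx; apply/allP.
  have ha a : rcell s' a = rcell s1 a by apply: f.2.
  split => //=; try by rewrite hv.
  - move=> k j kn jd; rewrite ha /= /samples.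
    rewrite (nth_map (tnth X (Ordinal kn))) ?size_tuple //.
    rewrite [in RHS](nth_map (tnth X (Ordinal kn))) ?size_tuple //.
    rewrite (nth_map false) ?size_tuple //.
  - by rewrite ha.
  - by rewrite (hv 1%N) // !ha j3 /=.
by move=> i j /=; rewrite f.2 //= !nth_nil.
Qed.

Section node.
Variable i : nat.
Hypothesis i_lt : (i < d)%N.

Local Notation vm k v := (vertex_margin d lam i (sample k) v).

Lemma compute_features_spec s u : env s -> ivar s 4 = i ->
  wp M compute_features (fun s' u' =>
    [/\ u' = u, frame [:: 6; 7]%N [:: 3; 4]%N s s',
        forall k, (k < n)%N -> rcell s' 4 k 0 = 0
      & forall k v, (k < n)%N -> (v < d + d)%N -> rcell s' 3 k v = vm k v]) s u.
Proof.
move=> es s4.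
apply: (@wp_for_det 6%N _ _ n [:: 6; 7]%N [:: 3; 4]%N
  (fun k s => (forall k', (k' < k)%N -> rcell s 4 k' 0 = 0) /\
    (forall k' v, (k' < k)%N -> (v < d + d)%N -> rcell s 3 k' v = vm k' v))) => //.
- by move=> s' f; rewrite /= f.1 // (env_n es).
- move=> k s' kn f xk [j1 j2].
  apply: (wp_seq M_ge2); apply: wp_rset.
  set s1 := rset _ _ _ _ _.
  have f1 : frame [:: 6; 7]%N [:: 3; 4]%N s s1 by apply: frame_rset.
  have k1 : ivar s1 6 = k by [].
  have z1 k' : (k' < k.+1)%N -> rcell s1 4 k' 0 = 0.
    rewrite ltnS leq_eqVlt => /orP[/eqP ->|kk]; first by rewrite /= xk eqxx.
    by rewrite /= xk (ltn_eqF kk) /= j1.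
  have o1 k' v : (k' < k)%N -> (v < d + d)%N -> rcell s1 3 k' v = vm k' v := j2 k' v.
  clearbody s1.
  apply: (wp_seq M_ge2).
  apply: (@wp_for_det 7%N _ _ d [:: 7]%N [:: 3]%N
    (fun j s' => (forall k' v, (k' < k)%N -> (v < d + d)%N -> rcell s' 3 k' v = vm k' v)
      /\ forall j', (j' < j)%N -> rcell s' 3 k j' =
           lam * (bit_sign R (sample k) i * bit_sign R (sample k) j'))) => //.
  + by move=> w f'; rewrite /= f'.1 // f1.1 // (env_d es).
  + move=> j w jd f' xj [p1 p2]; apply: wp_rset.
    have e6 : ivar w 6 = k by rewrite f'.1.
    have e4 : ivar w 4 = i by rewrite f'.1 // f1.1 // s4.
    split => //; first exact: frame_rset.
    split=> [k' v kk vd|j'].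
      by rewrite /= e6 (ltn_eqF kk) /= p1.
    rewrite ltnS leq_eqVlt => /orP[/eqP ->|jj].
      rewrite /= e6 xj e4 !eqxx /= !f'.2 // !f1.2 //.
      by rewrite (env_lam es) !(env_X es).
    by rewrite /= e6 xj (ltn_eqF jj) andbF /= p2.
  move=> s2 f2 [p1 p2]; apply: (wp_seq M_ge2); apply: wp_rset.
  have e6 : ivar s2 6 = k by rewrite f2.1.
  have e4 : ivar s2 4 = i by rewrite f2.1 // f1.1 // s4.
  set s3 := rset _ _ _ _ _.
  have f3 : frame [:: 7]%N [:: 3]%N s1 s3 by apply: frame_rset.
  have q1 k' v : (k' < k)%N -> (v < d + d)%N -> rcell s3 3 k' v = vm k' v.
    by move=> kk vd; rewrite /= e6 (ltn_eqF kk) p1.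
  have q2 j : (j < d)%N -> rcell s3 3 k j = lam * feature R i (sample k) j.
    move=> jd; rewrite /= e6 e4 eqxx /= /feature; case: eqP => [_|ne].
      by rewrite !f2.2 // !f1.2 // (env_lam es) (env_X es).
    by rewrite p2.
  clearbody s3.
  apply: (@wp_for_det 7%N _ _ d [:: 7]%N [:: 3]%N
    (fun j s' => (forall k' v, (k' < k)%N -> (v < d + d)%N -> rcell s' 3 k' v = vm k' v)
      /\ forall v, (v < d + j)%N -> rcell s' 3 k v = vm k v)) => //.
  + by move=> w f'; rewrite /= f'.1 // f3.1 // f1.1 // (env_d es).
  + split => //= v; rewrite addn0 => vd; rewrite q2 // /vertex_margin vd //.
  + move=> j w jd f' xj [r1 r2]; apply: wp_rset.
    have e6' : ivar w 6 = k by rewrite f'.1 // f3.1.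
    have e1' : ivar w 1 = d by rewrite f'.1 // f3.1 // f1.1 // (env_d es).
    split => //; first exact: frame_rset.
    split=> [k' v kk vd|v].
      by rewrite /= e6' (ltn_eqF kk) /= r1.
    rewrite addnS ltnS leq_eqVlt => /orP[/eqP ->|jj].
      rewrite /= e6' xj e1' !eqxx /= r2; last by lia.
      rewrite /vertex_margin jd ltnNge leq_addr /= addKn; ring.
    by rewrite /= e6' xj e1' (ltn_eqF jj) andbF /= r2.
  move=> w f4 [r1 r2]; split => //.
  + have f13 : frame [:: 6; 7]%N [:: 3; 4]%N s s3.
      by apply: (frame_trans _ _ f1 f3).
    by apply: (frame_trans _ _ f13 f4).
  + by rewrite f4.1 // f3.1.
  + split=> [k' kk|k' v].
      by rewrite /= f4.2 // f3.2 // z1.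
    rewrite ltnS leq_eqVlt => /orP[/eqP ->|kk] vd /=; [exact: r2|exact: r1].
by move=> s' f [j1 j2].
Qed.

Lemma reset_weights_spec s u : env s ->
  wp M reset_weights (fun s' u' =>
    [/\ u' = u, frame [:: 7]%N [:: 6]%N s s'
      & forall j, (j < d)%N -> rcell s' 6 j 0 = 0]) s u.
Proof.
move=> es.
apply: (@wp_for_det 7%N _ _ d [:: 7]%N [:: 6]%N
  (fun k s => (forall k', (k' < k)%N -> rcell s 6 k' 0 = 0))) => //.
- by move=> s' f; rewrite /= f.1 // (env_d es).
- move=> k s' kn f xk j1; apply: wp_rset; split => //; first exact: frame_rset.
  move=> k'; rewrite ltnS leq_eqVlt => /orP[/eqP ->|kk]; first by rewrite /= xk eqxx.
  by rewrite /= xk (ltn_eqF kk) /= j1.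
Qed.

Section step.
Variables (t : nat) (mg : nat -> R).
Let wgt (v : nat) : R := expR (eta_val * \sum_(k < n) vm k v * expR (- mg k)).

Lemma compute_scores_spec s u : env s ->
  (forall k, (k < n)%N -> rcell s 4 k 0 = mg k) ->
  (forall k v, (k < n)%N -> (v < d + d)%N -> rcell s 3 k v = vm k v) ->
  wp M compute_scores (fun s' u' =>
    [/\ u' = u, frame [:: 6; 7]%N [:: 5; 9; 10]%N s s',
        forall v, (v < d + d)%N -> rcell s' 5 v 0 = \sum_(l < v.+1) wgt l
      & rcell s' 10 0 0 = \sum_(l < d + d) wgt l]) s u.
Proof.
move=> es hm hv; apply: (wp_seq M_ge2); apply: wp_rset; set s1 := rset _ _ _ _ _.
have f1 : frame [:: 6; 7]%N [:: 5; 9; 10]%N s s1 by apply: frame_rset.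
apply: (@wp_for_det 7%N _ _ (d + d) [:: 6; 7]%N [:: 5; 9; 10]%N
  (fun k s => (forall v, (v < k)%N -> rcell s 5 v 0 = \sum_(l < v.+1) wgt l) /\
     rcell s 10 0 0 = \sum_(l < k) wgt l)) => //.
- by move=> s' f; rewrite /= f.1 // (env_D es).
- by split => //=; rewrite big_ord0.
- move=> v s' vd f xv [j1 j2].
  apply: (wp_seq M_ge2); apply: wp_rset; set s2 := rset _ _ _ _ _.
  have f2 : frame [:: 6; 7]%N [:: 5; 9; 10]%N s1 s2 by apply: frame_rset.
  apply: (wp_seq M_ge2).
  apply: (@wp_for_det 6%N _ _ n [:: 6]%N [:: 9]%N
    (fun k s => rcell s 9 0 0 = \sum_(l < k) vm l v * expR (- mg l))) => //.
  + by move=> s3 f3; rewrite /= f3.1 // f2.1 // (env_n es).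
  + by rewrite /= big_ord0.
  + move=> k s3 kn f3 xk j3; apply: wp_rset; split => //; first exact: frame_rset.
    have e7 : ivar s3 7 = v by rewrite f3.1.
    rewrite /= e7 xk big_ord_recr /= j3 !f3.2 // !f2.2 // !f1.2 //.
    by rewrite hm // hv // sub0r.
  move=> s3 f3 j3; apply: (wp_seq M_ge2); apply: wp_rset; apply: wp_rset.
  have e7 : ivar s3 7 = v by rewrite f3.1.
  have e10 : rcell s3 10 0 0 = \sum_(l < v) wgt l by rewrite f3.2.
  have e8 : rcell s3 8 0 0 = eta_val by rewrite f3.2 // f2.2 // f1.2 // (env_eta es).
  have f31 : frame [:: 6; 7]%N [:: 5; 9; 10]%N s1 s3.
    by apply: (frame_trans _ _ f2 f3).
  split => //; first by do 2 apply: frame_rset => //.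
  split; last by rewrite /= e10 e8 j3 big_ord_recr.
  move=> w; rewrite ltnS leq_eqVlt => /orP[/eqP ->|wv].
    by rewrite /= e7 eqxx /= e10 e8 j3 big_ord_recr.
  by rewrite /= e7 (ltn_eqF wv) /= f3.2 //= j1.
move=> s' f [j1 j2]; split => //.
by apply: (frame_trans _ _ f1 f).
Qed.

Lemma select_vertex_spec s r u : env s ->
  (forall v, (v < d + d)%N -> rcell s 5 v 0 = \sum_(l < v.+1) wgt l) ->
  rcell s 10 0 0 = \sum_(l < d + d) wgt l ->
  wp M select_vertex (fun s' u' =>
    [/\ u' = u, frame [:: 7; 8]%N [:: 11]%N s s'
      & ivar s' 8 = threshold_index (d.-1 + d) wgt r]) s (r :: u).
Proof.
move=> es h5 h10; have dD : (d.-1 + d).+1 = (d + d)%N by lia.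
apply: (wp_seq M_ge2); apply: wp_draw; apply: (wp_seq M_ge2); apply: wp_iset.
set s1 := iset _ _ _.
have f1 : frame [:: 7; 8]%N [:: 11]%N s s1 by apply: frame_iset => //; apply: frame_rset.
apply: (@wp_for_det 7%N _ _ (d.-1 + d) [:: 7; 8]%N [::]
  (fun k s => ivar s 8 = (\sum_(j < k)
      (\sum_(l < j.+1) wgt l < r * \sum_(l < (d.-1 + d).+1) wgt l)%R)%N)) => //.
- by rewrite (leq_trans _ dd_le) // -dD.
- by move=> s' f; rewrite /= f.1 // f1.1 // (env_D es) -dD subn1.
- by rewrite /= big_ord0.
- move=> k s' kd f xk j.
  have eb : beval s' (RLe (RMul (cell 11) (cell 10)) (RCell 5 (IVar 7) (IConst 0))) =
     (r * \sum_(l < (d.-1 + d).+1) wgt l <= \sum_(l < k.+1) wgt l).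
    by rewrite /= !f.2 //= xk h10 h5 -?dD // ltnW.
  apply: (wp_if M_ge2); rewrite eb => hb.
    apply: wp_skip; split => //.
    by rewrite /= j [RHS]big_ord_recr /= ltNge hb addn0.
  apply: wp_iset; split => //; first exact: frame_iset.
  by rewrite /= j [RHS]big_ord_recr /= ltNge hb addn1.
move=> s' f j; split => //.
by apply: (frame_trans _ _ f1 f).
Qed.

Lemma update_weights_spec (v : nat) (w : nat -> R) s u : env s ->
  ivar s 5 = t -> ivar s 8 = v -> (v < d + d)%N ->
  (forall j, (j < d)%N -> rcell s 6 j 0 = w j) ->
  wp M update_weights (fun s' u' =>
    [/\ u' = u, frame [:: 7]%N [:: 6]%N s s'
      & forall j, (j < d)%N -> rcell s' 6 j 0 =
          t%:R / (t + 2)%:R * w j +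
          2 / (t + 2)%:R * ((v == j)%:R - (v == d + j)%N%:R)]) s u.
Proof.
move=> es s5 s8 vd hw; apply: (wp_seq M_ge2).
apply: (@wp_for_det 7%N _ _ d [:: 7]%N [:: 6]%N
  (fun k s => forall j, (j < d)%N -> rcell s 6 j 0 =
     if (j < k)%N then t%:R / (t + 2)%:R * w j else w j)) => //.
- by move=> s' f; rewrite /= f.1 // (env_d es).
- move=> k s' kd f xk j1; apply: wp_rset; split => //; first exact: frame_rset.
  have e5 : ivar s' 5 = t by rewrite f.1.
  move=> j jd; rewrite ltnS leq_eqVlt; case: eqP => [->|/eqP ne] /=.
    by rewrite xk e5 eqxx /= j1 // ltnn.
  by rewrite xk e5 (negbTE ne) /= j1.
move=> s1 f j1.
have e5 : ivar s1 5 = t by rewrite f.1.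
have e8 : ivar s1 8 = v by rewrite f.1.
have e1 : ivar s1 1 = d by rewrite f.1 // (env_d es).
apply: (wp_if M_ge2); rewrite /= e1 e8 => hv; apply: wp_rset; split => //.
- exact: frame_rset.
- move=> j jd; rewrite /= e1 e8 e5; case: eqP => [e|ne] /=.
    rewrite -e j1 -?e // jd; have -> : (v == j) = false by apply/eqP; lia.
    have -> : (v == d + j)%N by apply/eqP; lia.
    by rewrite sub0r mulrN mulr1.
  rewrite j1 // jd; have -> : (v == j) = false by apply/eqP; lia.
  have -> : (v == d + j)%N = false by apply/eqP; lia.
  by rewrite subrr mulr0 addr0.
- exact: frame_rset.
- move=> j jd; rewrite /= e8 e5; have -> : (v == d + j)%N = false by apply/eqP; lia.
  rewrite eq_sym; case: eqP => [e|ne] /=.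
    by rewrite e j1 // jd subr0 mulr1.
  by rewrite j1 // jd subr0 mulr0 addr0.
Qed.

Lemma update_margins_spec (v : nat) s u : env s ->
  ivar s 5 = t -> ivar s 8 = v -> (v < d + d)%N ->
  (forall k, (k < n)%N -> rcell s 4 k 0 = mg k) ->
  (forall k v, (k < n)%N -> (v < d + d)%N -> rcell s 3 k v = vm k v) ->
  wp M update_margins (fun s' u' =>
    [/\ u' = u, frame [:: 6]%N [:: 4]%N s s'
      & forall k, (k < n)%N -> rcell s' 4 k 0 =
          t%:R / (t + 2)%:R * mg k + 2 / (t + 2)%:R * vm k v]) s u.
Proof.
move=> es s5 s8 vd hm hv.
apply: (@wp_for_det 6%N _ _ n [:: 6]%N [:: 4]%N
  (fun k s => forall j, (j < n)%N -> rcell s 4 j 0 =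
     if (j < k)%N then t%:R / (t + 2)%:R * mg j + 2 / (t + 2)%:R * vm j v else mg j)) => //.
- by move=> s' f; rewrite /= f.1 // (env_n es).
- move=> k s' kd f xk j1; apply: wp_rset; split => //; first exact: frame_rset.
  have e5 : ivar s' 5 = t by rewrite f.1.
  have e8 : ivar s' 8 = v by rewrite f.1.
  move=> j jd; rewrite ltnS leq_eqVlt; case: eqP => [->|/eqP ne] /=.
    by rewrite xk e5 e8 eqxx /= j1 // ltnn f.2 // hv.
  by rewrite xk e5 (negbTE ne) /= j1.
move=> s' f j1; split => // k kn; by rewrite j1 // kn.
Qed.

End step.
Variables (p : seq (vertex d)).
Hypothesis size_p : size p = (d * T_val)%N.

Definition node_state (t : nat) s : Prop :=
  [/\ ivar s 4 = i,
      forall k v, (k < n)%N -> (v < d + d)%N -> rcell s 3 k v = vm k v,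
      forall k, (k < n)%N -> rcell s 4 k 0 =
        fwavg (fun v : vertex d => vm k v) (block T_val i p) t
    & forall j, (j < d)%N -> rcell s 6 j 0 =
        fwavg (fun k : vertex d => (k == j :> nat)%:R - (k == d + j :> nat)%N%:R)
          (block T_val i p) t].

Lemma fw_step_spec t s r u : env s -> (t < T_val)%N -> ivar s 5 = t ->
  node_state t s ->
  nth ord0 p (i * T_val + t) =
    select T_val lam eta_val (samples X) (take (i * T_val + t) p) r ->
  wp M fw_step (fun s' u' =>
    [/\ u' = u, frame [:: 6; 7; 8]%N [:: 4; 5; 6; 9; 10; 11]%N s s'
      & node_state t.+1 s']) s (r :: u).
Proof.
move=> es tT s5 [s4 h3 h4 h6] sel.
pose mg k := fwavg (fun v : vertex d => vm k v) (block T_val i p) t.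
have ip : (i * T_val + t < size p)%N.
  rewrite size_p; have : (i.+1 * T_val <= d * T_val)%N by rewrite leq_mul2r i_lt orbT.
  by rewrite mulSn; lia.
set v := nth ord0 p (i * T_val + t) in sel.
have bv : block T_val i p t = v by [].
(* The weights accumulated by the program are the exponentiated scores of the current prefix, so its
   count of thresholds is the prescribed choice. *)
have vE : (v : nat) = threshold_index (d.-1 + d)
    (fun l => expR (eta_val * \sum_(k < n) vm k l * expR (- mg k))) r.
  have -> : (fun l => expR (eta_val * \sum_(k < n) vm k l * expR (- mg k))) =
    (fun l => expR (score T_val lam eta_val (samples X) (take (i * T_val + t) p) l)).
    apply/funext => l; rewrite score_take //; last by lia.
    rewrite /block_score; congr (expR (_ * _)).
    rewrite (big_nth [::]) size_map size_tuple big_mkord.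
    by apply: eq_bigr => k _.
  by rewrite sel /select inordK // ltnS threshold_index_le.
have vd : (v < d + d)%N by have := ltn_ord v; lia.
apply: (wp_seq M_ge2); apply: wp_mono (compute_scores_spec _ es h4 h3).
move=> s1 u1 [-> f1 h5 h10].
have es1 : env s1 by apply: env_frame f1 es.
apply: (wp_seq M_ge2); apply: wp_mono (select_vertex_spec _ _ es1 h5 h10).
move=> s2 u2 [-> f2 h8].
have es2 : env s2 by apply: env_frame f2 es1.
have f12 : frame [:: 6; 7; 8]%N [:: 5; 9; 10; 11]%N s s2.
  exact: (frame_trans _ _ f1 f2).
apply: (wp_seq M_ge2).
have e5 : ivar s2 5 = t by rewrite f12.1.
have {}h8 : ivar s2 8 = v := etrans h8 (esym vE).
have h6' j : (j < d)%N -> rcell s2 6 j 0 =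
   fwavg (fun k : vertex d => (k == j :> nat)%:R - (k == d + j :> nat)%N%:R) (block T_val i p) t.
  by move=> jd; rewrite f12.2 // h6.
apply: wp_mono (update_weights_spec _ es2 e5 h8 vd h6').
move=> s3 u3 [-> f3 h63].
have es3 : env s3 by apply: env_frame f3 es2.
have e53 : ivar s3 5 = t by rewrite f3.1.
have e83 : ivar s3 8 = v by rewrite f3.1.
have h4' k : (k < n)%N -> rcell s3 4 k 0 = mg k by move=> kn; rewrite f3.2 // f12.2 // h4.
have h3' k l : (k < n)%N -> (l < d + d)%N -> rcell s3 3 k l = vm k l.
  by move=> kn ld; rewrite f3.2 // f12.2 // h3.
apply: wp_mono (update_margins_spec _ es3 e53 e83 vd h4' h3').
move=> s4' u4 [-> f4 h44]; split => //.
  have g : frame [:: 6; 7; 8]%N [:: 5; 6; 9; 10; 11]%N s s3 by exact: (frame_trans _ _ f12 f3).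
  exact: (frame_trans _ _ g f4).
split.
- by rewrite f4.1 // f3.1 // f12.1.
- by move=> k l kn ld; rewrite f4.2 // h3'.
- by move=> k kn; rewrite h44 //= bv.
- by move=> j jd; rewrite f4.2 // h63 //= bv.
Qed.

(** The path [p] is fixed beforehand from all coins [u0], and the program is shown to follow it.
    Regression i starts after i T coins, which is why the remaining sequence is a [drop] of [u0]. *)
Lemma node_spec (u0 : seq R) s : env s -> ivar s 4 = i ->
  (d * T_val <= size u0)%N ->
  (forall m, (m < d * T_val)%N -> nth ord0 p m =
     select T_val lam eta_val (samples X) (take m p) (nth 0 u0 m)) ->
  wp M (Seq compute_features (Seq reset_weights (Seq (For 5 (IVar 3) fw_step) write_row)))
    (fun s' u' =>
    [/\ u' = drop (i.+1 * T_val) u0,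
        frame [:: 5; 6; 7; 8]%N [:: 2; 3; 4; 5; 6; 9; 10; 11]%N s s',
        forall i' j, i' != i -> rcell s' 2 i' j = rcell s 2 i' j
      & forall j, (j < d)%N -> rcell s' 2 i j =
          if i == j then 0 else lam * signed_weight R T_val p i j]) s (drop (i * T_val) u0).
Proof.
move=> es s4 su sel.
apply: (wp_seq M_ge2); apply: wp_mono (compute_features_spec _ es s4).
move=> s1 u1 [-> f1 h14 h13].
have es1 : env s1 by apply: env_frame f1 es.
apply: (wp_seq M_ge2); apply: wp_mono (reset_weights_spec _ es1).
move=> s2 u2 [-> f2 h26].
have es2 : env s2 by apply: env_frame f2 es1.
have f12 : frame [:: 5; 6; 7; 8]%N [:: 3; 4; 5; 6; 9; 10; 11]%N s s2.
  exact: (frame_trans _ _ f1 f2).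
apply: (wp_seq M_ge2).
pose I t s' u' := [/\ u' = drop (i * T_val + t) u0,
  frame [:: 5; 6; 7; 8]%N [:: 3; 4; 5; 6; 9; 10; 11]%N s2 s', ivar s' 5 = t & node_state t s'].
have iT t : (t < T_val)%N -> (i * T_val + t < d * T_val)%N.
  have : (i.+1 * T_val <= d * T_val)%N by rewrite leq_mul2r i_lt orbT.
  by rewrite mulSn; lia.
have TM : (T_val <= M ^ 2)%N.
  apply: leq_trans n_le; rewrite /T_val; elim: (n) => //= m; case: (_ <= _); lia.
apply: (@wp_mono _ _ _ (I T_val)); last first.
  apply: (wp_for M_ge2 TM).
  - split => //=; [by rewrite addn0|by apply: frame_iset|].
    split=> //=.
    + by rewrite f12.1.
    + by move=> k l kn ld; rewrite f2.2 // h13.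
    + by move=> k kn; rewrite f2.2 // h14.
  - by move=> k s' u' [_ f xk _]; split => //=; rewrite f.1 // (env_T es2).
  move=> t s' u' tT [-> f xt ns].
  have es' : env s' by apply: env_frame f es2.
  rewrite (drop_nth 0); last by apply: leq_trans su; exact: iT.
  apply: wp_mono (fw_step_spec _ es' tT xt ns (sel _ (iT _ tT))).
  move=> s'' u'' [-> f' [n4 n3 nm nw]]; split; first by rewrite f'.1.
  split; [by rewrite addnS| |by []|by split].
  apply: frame_iset => //.
  by apply: (frame_trans _ _ f f').
move=> s3 u3 [-> f3 _ [n4 n3 nm nw]].
have es3 : env s3 by apply: env_frame f3 es2.
apply: (wp_seq M_ge2).
apply: (@wp_for_det 7%N _ _ d [:: 7]%N [:: 2]%N
  (fun k s => (forall i' j, i' != i -> rcell s 2 i' j = rcell s3 2 i' j) /\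
     forall j, (j < k)%N -> rcell s 2 i j = lam * signed_weight R T_val p i j)) => //.
- by move=> s' f; rewrite /= f.1 // (env_d es3).
- move=> k s' kd f xk [j1 j2]; apply: wp_rset; split => //; first exact: frame_rset.
  have e4 : ivar s' 4 = i by rewrite f.1.
  split=> [i' j ne|j]; first by rewrite /= e4 (negbTE ne) /= j1.
  rewrite ltnS leq_eqVlt => /orP[/eqP ->|jk].
    by rewrite /= e4 xk !eqxx /= !f.2 // (env_lam es3) nw.
  by rewrite /= e4 xk (ltn_eqF jk) eqxx /= j2.
move=> s4' f4 [j1 j2]; apply: wp_rset.
have e4 : ivar s4' 4 = i by rewrite f4.1.
have f34 : frame [:: 5; 6; 7; 8]%N [:: 2; 3; 4; 5; 6; 9; 10; 11]%N s s4'.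
  have g1 : frame [:: 5; 6; 7; 8]%N [:: 2; 3; 4; 5; 6; 9; 10; 11]%N s s2.
    by apply: (frame_trans _ _ (frame_refl [::] [::] s) f12).
  have g2 : frame [:: 5; 6; 7; 8]%N [:: 2; 3; 4; 5; 6; 9; 10; 11]%N s s3.
    by apply: (frame_trans _ _ g1 f3).
  by apply: (frame_trans _ _ g2 f4).
split.
- by rewrite mulSn addnC.
- exact: frame_rset.
- by move=> i' j ne; rewrite /= e4 (negbTE ne) /= j1 // f3.2 // f12.2.
- move=> j jd; rewrite /= e4 eqxx /= [j == i]eq_sym; case: eqP => //= _; exact: j2.
Qed.

End node.
Lemma selections_nth (K : finType) (sel : seq K -> R -> K) (k0 : K) N past u m :
  (m < N)%N ->
  nth k0 (selections sel N past u) m =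
  sel (past ++ take m (selections sel N past u)) (nth 0 u m).
Proof.
elim: N past u m => // N IH past u [|m] /= mN; first by rewrite cats0 nth0.
by rewrite IH // cat_rcons nth_behead.
Qed.

Lemma learner_spec (u0 : seq R) : (d * T_val <= size u0)%N ->
  wp M learner (fun s' _ => learner_output d s' =
     estimate T_val lam
       (selections (select T_val lam eta_val (samples X)) (d * T_val) [::] u0))
    (learner_input lam rho alpha X) u0.
Proof.
move=> su; set p := selections _ _ _ _.
have size_p : size p = (d * T_val)%N by rewrite size_selections.
have sel m : (m < d * T_val)%N -> nth ord0 p m =
    select T_val lam eta_val (samples X) (take m p) (nth 0 u0 m).
  by move=> mN; rewrite selections_nth.
apply: (wp_seq M_ge2); apply: wp_mono (setup_spec u0).
move=> s u [-> es _].
pose I i s' u' := [/\ u' = drop (i * T_val) u0, env s', ivar s' 4 = i &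
  forall i' j, (i' < i)%N -> (j < d)%N -> rcell s' 2 i' j =
    if i' == j then 0 else lam * signed_weight R T_val p i' j].
apply: (@wp_mono _ _ _ (I d)).
  move=> s' u' [_ _ _ h]; apply/matrixP => i j.
  by rewrite !mxE h.
apply: (wp_for M_ge2 d_le).
- split => //=; first by rewrite mul0n drop0.
  by apply: (env_frame (vs := [:: 4]%N) (arrs := [::])) es => //; apply: frame_iset.
- by move=> k s' u' [_ es' xk _]; split => //=; rewrite (env_d es').
move=> i s' u' id [-> es' xi hi].
apply: wp_mono (node_spec id size_p es' xi su sel).
move=> s'' u'' [-> f h1 h2]; split; first by rewrite f.1.
split => //=.
- apply: (env_frame (vs := [:: 4; 5; 6; 7; 8]%N) (arrs := [:: 2; 3; 4; 5; 6; 9; 10; 11]%N)) es' => //.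
  apply: frame_iset => //.
  by apply: (frame_trans _ _ (frame_refl [::] [::] s') f).
- move=> i' j; rewrite ltnS leq_eqVlt => /orP[/eqP ->|ii] jd; first exact: h2.
  by rewrite h1 ?hi // (ltn_eqF ii).
Qed.

End program_correctness.

(** * The Ising model *)

Section ising_model.
Variables (R : realType) (d : nat) (A : 'M[R]_d) (theta : 'rV[R]_d).
Hypothesis params : ising_parameters A.
Implicit Types (z : d.-tuple bool) (i j l : 'I_d).

Definition flip i z : d.-tuple bool :=
  [tuple (if j == i then ~~ tnth z j else tnth z j) | j < d].

Lemma flipK i : involutive (flip i).
Proof.
move=> z; apply: eq_from_tnth => j; rewrite !tnth_mktuple.
by case: eqP => // _; rewrite negbK.
Qed.

Lemma bit_sign_tnth z j : bit_sign R z j = spin R (tnth z j).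
Proof. by rewrite /bit_sign (tnth_nth false). Qed.

Lemma bit_sign_flip i z j :
  bit_sign R (flip i z) j = if j == i then - bit_sign R z j else bit_sign R z j.
Proof.
rewrite !bit_sign_tnth tnth_mktuple; case: eqP => // _.
by case: (tnth z j); rewrite /spin /= ?opprK.
Qed.

Lemma sum_flip i (F : d.-tuple bool -> R) : \sum_z F (flip i z) = \sum_z F z.
Proof.
rewrite [RHS](reindex (flip i)) //.
by exists (flip i) => z _; exact: flipK.
Qed.

Definition local_weight i j : R := if j == i then theta 0 i else A i j.

Definition true_margin i z : R := \sum_j local_weight i j * feature R i z j.

Let sg z j : R := bit_sign R z j.

Lemma true_marginE i z :
  true_margin i z = sg z i * (\sum_(j | j != i) A i j * sg z j + theta 0 i).
Proof.
rewrite /true_margin (bigD1 i) //= /local_weight /feature !eqxx addrC mulrDr.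
congr (_ + _); last by rewrite mulrC.
rewrite mulr_sumr; apply: eq_bigr => j ji.
rewrite (negbTE ji); have -> : (j == i :> nat) = false by apply/negbTE.
by rewrite /sg; ring.
Qed.

Definition energy z : R :=
  \sum_(i < d) \sum_(j < d | (i <= j)%N)
           A i j * spin R (tnth z i) * spin R (tnth z j)
        + \sum_(i < d) theta 0 i * spin R (tnth z i).

Definition rest_energy i z : R :=
  (\sum_(a | a != i) \sum_(b | b != i) A a b * sg z a * sg z b) / 2
  + \sum_(a | a != i) theta 0 a * sg z a.

(** By symmetry and the zero diagonal, the pairs with i <= j carry exactly half of the full double
    sum. *)
Lemma pair_energy_sym z :
  \sum_(a < d) \sum_(b < d | (a <= b)%N) A a b * sg z a * sg z b =
  (\sum_a \sum_b A a b * sg z a * sg z b) / 2.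
Proof.
case: params => symA diagA.
have Aab a b : A a b = A b a by rewrite -[in LHS]symA mxE.
set S := LHS; suff -> : \sum_a \sum_b A a b * sg z a * sg z b = S + S by field.
transitivity (\sum_(a < d) (\sum_(b < d | (a <= b)%N) A a b * sg z a * sg z b +
    \sum_(b < d | (b <= a)%N) A a b * sg z a * sg z b)).
  apply: eq_bigr => a _.
  rewrite (bigID (fun b : 'I_d => (a <= b)%N)) /=; congr (_ + _).
  rewrite [RHS](bigD1 a) //= diagA !mul0r add0r; apply: eq_bigl => b.
  by rewrite -ltnNge ltn_neqAle andbC.
rewrite big_split /=; congr (_ + _).
rewrite (exchange_big_dep predT) //=; apply: eq_bigr => b _.
by apply: eq_bigr => a _; rewrite Aab mulrAC.
Qed.

(** Isolates the dependence on spin i: [rest_energy] does not see it, and the margin is odd in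
    it. *)
Lemma energy_split i z : energy z = true_margin i z + rest_energy i z.
Proof.
case: (params) => symA diagA.
have Aab a b : A a b = A b a by rewrite -[in LHS]symA mxE.
rewrite /energy.
under eq_bigr do under eq_bigr do rewrite -!bit_sign_tnth.
under [X in _ + X = _]eq_bigr do rewrite -bit_sign_tnth.
rewrite pair_energy_sym true_marginE /rest_energy -/sg.
rewrite (bigD1 i) //= (bigD1 i (F := fun a => theta 0 a * bit_sign R z a)) //=.
rewrite [\sum_b A i b * _ * _](bigD1 i) //= diagA !mul0r add0r.
rewrite [\sum_(a | a != i) \sum_b _](eq_bigr (fun a => A i a * sg z i * sg z a +
   \sum_(b | b != i) A a b * sg z a * sg z b)); last first.
  by move=> a _; rewrite (bigD1 i) //= Aab mulrAC.
rewrite big_split /=.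
have -> : \sum_(b | b != i) A i b * bit_sign R z i * bit_sign R z b =
   sg z i * \sum_(b | b != i) A i b * sg z b.
  by rewrite mulr_sumr; apply: eq_bigr => b _; rewrite /sg; ring.
by rewrite /sg; field.
Qed.

Lemma rest_energy_flip i z : rest_energy i (flip i z) = rest_energy i z.
Proof.
rewrite /rest_energy; congr (_ / _ + _).
  apply: eq_bigr => a ai; apply: eq_bigr => b bi.
  by rewrite /sg !bit_sign_flip (negbTE ai) (negbTE bi).
by apply: eq_bigr => a ai; rewrite /sg bit_sign_flip (negbTE ai).
Qed.

Lemma feature_flip_label i z j : feature R i (flip i z) j = - feature R i z j.
Proof.
rewrite /feature; case: eqP => [e|ne]; first by rewrite bit_sign_flip eqxx.
rewrite !bit_sign_flip eqxx; have -> : (j == i) = false.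
  by apply/eqP => e; apply: ne; rewrite e.
by rewrite mulNr.
Qed.

Lemma feature_flip i j z l : j != i ->
  feature R i (flip j z) l = if l == j then - feature R i z l else feature R i z l.
Proof.
move=> ji; rewrite /feature !bit_sign_flip [i == j]eq_sym (negbTE ji).
have [e|ne] := eqVneq l j.
  have -> : (l == i :> nat) = false by rewrite e; apply/negbTE.
  by rewrite mulrN.
by case: ifP.
Qed.

Local Notation Z := (\sum_(y : d.-tuple bool) ising_weight A theta y).
Local Notation P := (ising_pmf A theta).

Lemma ising_norm_gt0 : 0 < Z.
Proof.
rewrite (bigD1 [tuple of nseq d true]) //= ltr_pwDl ?expR_gt0 //.
by apply: sumr_ge0 => y _; exact: expR_ge0.
Qed.

Lemma ising_pmf_gt0 z : 0 < P z.
Proof. by rewrite divr_gt0 ?expR_gt0 // ising_norm_gt0. Qed.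

Lemma ising_pmf_sum1 : \sum_z P z = 1.
Proof. by rewrite -mulr_suml divff // gt_eqF // ising_norm_gt0. Qed.

Lemma ising_pmfE i z : P z = expR (true_margin i z) * expR (rest_energy i z) / Z.
Proof. by rewrite -expRD -energy_split. Qed.

(* The factor exp(- margin) cancels the dependence of the probability on the
   sign of z_i, whereas the feature is odd in it. *)
Lemma screening_gradient0 i j :
  \sum_z P z * (feature R i z j * expR (- true_margin i z)) = 0.
Proof.
have e z : P z * (feature R i z j * expR (- true_margin i z)) =
  feature R i z j * (expR (rest_energy i z) / Z).
  have e0 : expR (true_margin i z) * expR (- true_margin i z) = 1.
    by rewrite -expRD subrr expR0.
  transitivity (feature R i z j * (expR (rest_energy i z) / Z)
      * (expR (true_margin i z) * expR (- true_margin i z))).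
    by rewrite (ising_pmfE i); set c := Z^-1; ring.
  by rewrite e0 mulr1.
under eq_bigr do rewrite e.
set S := LHS; have : S = - S.
  rewrite {1}/S -(sum_flip i) -sumrN; apply: eq_bigr => z _.
  by rewrite feature_flip_label rest_energy_flip mulNr.
lra.
Qed.

Variable lam : R.
Hypothesis width_le : ising_width A theta <= lam.

Lemma local_weight_norm i : \sum_j `|local_weight i j| <= lam.
Proof.
case: params => _ diagA; apply: le_trans width_le.
apply: le_trans (le_bigmax _ _ i).
rewrite (bigD1 i) //= [leRHS]addrC; apply: lerD; first by rewrite /local_weight eqxx.
rewrite [leRHS](bigD1 i) //= diagA normr0 add0r.
by apply: ler_sum => j ji; rewrite /local_weight (negbTE ji).
Qed.

Lemma true_margin_bound i z : `|true_margin i z| <= lam.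
Proof.
apply: le_trans (local_weight_norm i); apply: le_trans (ler_norm_sum _ _ _) _.
by apply: ler_sum => j _; rewrite normrM normr_feature mulr1.
Qed.

(** Flipping spin j negates its margin and nothing else in the energy, so the probability is
    multiplied by exp of minus twice a number in [-lam, lam]. *)
Lemma ising_pmf_flip j z : expR (- (2 * lam)) * P z <= P (flip j z).
Proof.
have e : true_margin j (flip j z) = - true_margin j z.
  rewrite /true_margin -sumrN; apply: eq_bigr => l _.
  by rewrite feature_flip_label mulrN.
rewrite !(ising_pmfE j) e rest_energy_flip !mulrA ler_pM2r ?invr_gt0 ?ising_norm_gt0 //.
rewrite ler_pM2r ?expR_gt0 // -expRD ler_expR.
by have := true_margin_bound j z; rewrite ler_norml => /andP[]; lra.
Qed.

(** Pairing z with [flip j z] moves the linear form from q to q - 2 c with |c| = |D j|, and q^2 + (q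
    - 2 c)^2 = 2 (q - c)^2 + 2 c^2 whatever the other coordinates are. *)
Lemma quadratic_lower_bound i j (D : 'I_d -> R) : 0 <= lam -> j != i ->
  expR (- (2 * lam)) * D j ^+ 2 <=
  \sum_z P z * (\sum_l D l * feature R i z l) ^+ 2.
Proof.
move=> lam0 ji; set Q := fun z => \sum_l D l * feature R i z l.
have Qflip z : Q (flip j z) = Q z - 2 * (D j * feature R i z j).
  rewrite /Q (bigD1 j) //= [in RHS](bigD1 j) //= feature_flip // eqxx.
  rewrite (eq_bigr (fun l => D l * feature R i z l)); first by ring.
  by move=> l lj; rewrite feature_flip // (negbTE lj).
have f2 z : feature R i z j ^+ 2 = 1.
  by rewrite -[LHS]real_normK ?num_real // normr_feature expr1n.
rewrite -[leRHS](_ : (\sum_z (P z * Q z ^+ 2 + P (flip j z) * Q (flip j z) ^+ 2)) / 2 = _); last first.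
  by rewrite big_split /= (sum_flip j (fun z => P z * Q z ^+ 2)); field.
rewrite ler_pdivlMr //.
have -> : expR (- (2 * lam)) * D j ^+ 2 * 2 =
  \sum_z (expR (- (2 * lam)) * P z * (2 * D j ^+ 2)).
  rewrite -mulr_suml -mulr_sumr ising_pmf_sum1; ring.
apply: ler_sum => z _.
have h1 : expR (- (2 * lam)) * P z <= P z.
  by apply: ler_piMl; [exact/ltW/ising_pmf_gt0|rewrite -[leRHS]expR0 ler_expR; lra].
have h2 := ising_pmf_flip j z.
have h3 : 2 * D j ^+ 2 <= Q z ^+ 2 + Q (flip j z) ^+ 2.
  rewrite Qflip; have := f2 z; set q := Q z; set f := feature _ _ _ _ => ff.
  have -> : 2 * D j ^+ 2 = 2 * (D j * f) ^+ 2 by rewrite exprMn ff mulr1.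
  have := sqr_ge0 (q - D j * f); nra.
have h0 : 0 <= expR (- (2 * lam)) * P z by rewrite mulr_ge0 ?expR_ge0 // ltW ?ising_pmf_gt0.
apply: (le_trans (ler_wpM2l h0 h3)); rewrite mulrDr.
by apply: lerD; apply: ler_wpM2r => //; exact: sqr_ge0.
Qed.

End ising_model.

(** * Concentration *)

Section concentration.
Variables (R : realType) (S : finType) (p : S -> R) (n : nat).
Hypothesis p_ge0 : forall x, 0 <= p x.
Hypothesis p_sum1 : \sum_x p x = 1.

Definition sample_prob (X : n.-tuple S) : R := \prod_(k < n) p (tnth X k).

Lemma sample_prob_ge0 X : 0 <= sample_prob X.
Proof. exact: prodr_ge0. Qed.

Lemma chain_sample (x0 : S) (f : S -> R) (X : n.-tuple S) :
  chain (fun _ x => f x) [::] X = \prod_(k < n) f (tnth X k).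
Proof.
rewrite (chain_prod x0) size_tuple; apply: eq_bigr => k _.
by rewrite (tnth_nth x0).
Qed.

Lemma inhabited_of_sum : exists x0 : S, true.
Proof.
apply/existsP; apply: contraT; rewrite negb_exists => /forallP h.
have := p_sum1; rewrite big1; first by move/eqP; rewrite eq_sym oner_eq0.
by move=> x; have := h x.
Qed.

Lemma sample_prob_sum1 : \sum_X sample_prob X = 1.
Proof.
have [x0 _] := inhabited_of_sum.
rewrite -[RHS](@chain_sum1 R S (fun _ x => p x) [::] n (fun=> p_sum1)).
by apply: eq_bigr => X _; rewrite (chain_sample x0).
Qed.

(* Chernoff's method with e^y <= y + e^(2 y^2) instead of Hoeffding's lemma. *)
Lemma sum_tail (Y : S -> R) (B s : R) :
  0 < B -> 0 <= s -> (forall x, `|Y x| <= B) -> \sum_x p x * Y x = 0 ->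
  \sum_(X : n.-tuple S | n%:R * s < \sum_(k < n) Y (tnth X k)) sample_prob X <=
  expR (- (n%:R * s ^+ 2 / (8 * B ^+ 2))).
Proof.
move=> B0 s0 YB EY; have [x0 _] := inhabited_of_sum.
(* Minimiser of 2 c^2 B^2 - c s, with minimum - s^2 / (8 B^2). *)
pose c := s / (4 * B ^+ 2).
have c0 : 0 <= c by rewrite divr_ge0 // mulr_ge0 // sqr_ge0.
have B2 : B ^+ 2 != 0 by rewrite expf_neq0 // gt_eqF.
have mgf : \sum_x p x * expR (c * Y x) <= expR (2 * (c * B) ^+ 2).
  have h x : p x * expR (c * Y x) <= c * (p x * Y x) + p x * expR (2 * (c * B) ^+ 2).
    have h1 := expR_le_addl_sqr (c * Y x).
    have h2 : expR (2 * (c * Y x) ^+ 2) <= expR (2 * (c * B) ^+ 2).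
      have hY : Y x ^+ 2 <= B ^+ 2 by exact: sqr_le_of_norm.
      have := ler_wpM2l (sqr_ge0 c) hY.
      by rewrite ler_expR !exprMn; lra.
    have := ler_wpM2l (p_ge0 x) (le_trans h1 (lerD (lexx _) h2)); lra.
  apply: le_trans (ler_sum _ (fun x _ => h x)) _.
  by rewrite big_split /= -mulr_sumr EY mulr0 add0r -mulr_suml p_sum1 mul1r.
have := @chain_expectation_le R S (fun _ x => p x) (fun _ x => expR (c * Y x))
  (fun=> expR (2 * (c * B) ^+ 2)) [::] n (fun _ => p_ge0) (fun _ x => expR_ge0 _)
  (fun=> expR_ge0 _) (fun _ => mgf).
rewrite prodr_const card_ord -expRM_natl.
under eq_bigr do rewrite !(chain_sample x0) -expR_sum -mulr_sumr.
move=> h.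
have -> : - (n%:R * s ^+ 2 / (8 * B ^+ 2)) = n%:R * (2 * (c * B) ^+ 2) + - (c * (n%:R * s)).
  by rewrite /c; field; rewrite gt_eqF.
rewrite expRD expRN ler_pdivlMr ?expR_gt0 //; apply: le_trans h.
rewrite [leRHS](bigID (fun X : n.-tuple S => n%:R * s < \sum_(k < n) Y (tnth X k))) /=.
rewrite mulr_suml ler_wpDr //.
  by apply: sumr_ge0 => X _; rewrite mulr_ge0 ?expR_ge0 ?sample_prob_ge0.
apply: ler_sum => X hX; rewrite ler_wpM2l ?sample_prob_ge0 //.
by rewrite ler_expR ler_wpM2l // ltW.
Qed.

Lemma sum_tail_abs (Y : S -> R) (B s : R) :
  0 < B -> 0 <= s -> (forall x, `|Y x| <= B) -> \sum_x p x * Y x = 0 ->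
  \sum_(X : n.-tuple S | n%:R * s < `|\sum_(k < n) Y (tnth X k)|) sample_prob X <=
  2 * expR (- (n%:R * s ^+ 2 / (8 * B ^+ 2))).
Proof.
move=> B0 s0 YB EY.
have h1 := sum_tail B0 s0 YB EY.
have h2 : \sum_(X : n.-tuple S | n%:R * s < \sum_(k < n) - Y (tnth X k)) sample_prob X <=
  expR (- (n%:R * s ^+ 2 / (8 * B ^+ 2))).
  apply: (@sum_tail (fun x => - Y x)) => //; first by move=> x; rewrite normrN.
  under eq_bigr do rewrite mulrN.
  by rewrite sumrN EY oppr0.
apply: le_trans (_ : _ <= expR (- (n%:R * s ^+ 2 / (8 * B ^+ 2))) +
   expR (- (n%:R * s ^+ 2 / (8 * B ^+ 2)))) _; last by lra.
apply: le_trans (lerD h1 h2).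
rewrite big_mkcond [X in _ <= X + _]big_mkcond [X in _ <= _ + X]big_mkcond /= -big_split /=.
apply: ler_sum => X _; rewrite sumrN; have q0 := sample_prob_ge0 X.
rewrite lter_normr; case: ltP => _ /=; first by case: ltP => _; lra.
by case: ltP => _; lra.
Qed.

End concentration.

(** * The l1 ball as a convex hull of vertices *)

Section vertex_sums.
Variables (R : realType) (d : nat).
Hypothesis d_gt0 : (0 < d)%N.

Lemma sum_vertex (F : nat -> R) :
  \sum_(v : vertex d) F v = \sum_(j < d) (F j + F (d + j)%N).
Proof.
have e : (d.-1 + d).+1 = (d + d)%N by lia.
rewrite -(big_mkord xpredT) e (@big_cat_nat _ _ _ d) ?leq_addr //= big_split /=.
rewrite big_mkord; congr (_ + _).
by rewrite -{1}[d]add0n big_addn addnK big_mkord; apply: eq_bigr => j _; rewrite addnC.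
Qed.

Lemma weights_norm_le1 (h : nat -> vertex d) t :
  \sum_(j < d) `|fwavg (fun k : vertex d => (k == j :> nat)%:R - (k == d + j :> nat)%N%:R) h t|
    <= (1 : R).
Proof.
elim: t => [|t IH] /=; first by rewrite big1 // => j _; rewrite normr0.
have a0 : 0 <= t%:R / (t + 2)%:R :> R by rewrite divr_ge0.
have b0 : 0 <= 2 / (t + 2)%:R :> R by rewrite divr_ge0.
rewrite -[leRHS](fwavg_coefs R t).
apply: (@le_trans _ _ (\sum_(j < d) (t%:R / (t + 2)%:R *
   `|fwavg (fun k : vertex d => (k == j :> nat)%:R - (k == d + j :> nat)%N%:R : R) h t| +
   2 / (t + 2)%:R * `|(h t == j :> nat)%:R - (h t == d + j :> nat)%N%:R|))).
  apply: ler_sum => j _; apply: le_trans (ler_normD _ _) _.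
  have ea (y : R) : `|t%:R / (t + 2)%:R * y| = t%:R / (t + 2)%:R * `|y|.
    by rewrite normrM (ger0_norm a0).
  have eb (y : R) : `|2 / (t + 2)%:R * y| = 2 / (t + 2)%:R * `|y|.
    by rewrite normrM (ger0_norm b0).
  by rewrite ea eb.
rewrite big_split /= -!mulr_sumr; apply: lerD.
  by rewrite -[leRHS]mulr1 ler_wpM2l.
rewrite -[leRHS]mulr1 ler_wpM2l //.
apply: (@le_trans _ _ (\sum_(j < d) ((h t == j :> nat)%:R + (h t == d + j :> nat)%N%:R))).
  apply: ler_sum => j _; apply: le_trans (ler_normB _ _) _.
  by rewrite !normr_nat.
rewrite -(sum_vertex (fun v => (h t == v :> nat)%:R)) (bigD1 (h t)) //= eqxx.
rewrite big1 ?addr0 // => v vh.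
have -> : (h t == v :> nat) = false; last by [].
by apply/negbTE; rewrite eq_sym.
Qed.

Variable lam : R.
Hypothesis lam_gt0 : 0 < lam.

(** Reads the margin of an average of vertices as a linear form in the features, whose coefficients
    are those returned by [estimate] off the diagonal. *)
Lemma fwavg_vertex_margin (h : nat -> vertex d) i x t :
  fwavg (fun v : vertex d => vertex_margin d lam i x v) h t =
  \sum_(j < d) (lam * fwavg (fun k : vertex d => (k == j :> nat)%:R - (k == d + j :> nat)%N%:R) h t)
     * feature R i x j.
Proof.
under [RHS]eq_bigr do rewrite mulrAC.
rewrite -(fwavg_sum (fun j : 'I_d => lam * feature R i x j)).
apply: fwavg_eq => v; rewrite /vertex_margin; case: ltnP => vd.
  rewrite (bigD1 (Ordinal vd)) //= eqxx big1; last first.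
    move=> j jv; have -> : (v == j :> nat) = false.
      by apply/eqP => e; move/eqP: jv; apply; exact: val_inj.
    have -> : (v == d + j :> nat)%N = false by apply/eqP; lia.
    by rewrite subrr mulr0.
  have -> : (v == d + v :> nat)%N = false by apply/eqP; lia.
  by rewrite /= subr0 mulr1n mulr1 addr0.
have vd2 : (v - d < d)%N by have := ltn_ord v; lia.
rewrite (bigD1 (Ordinal vd2)) //= subnKC // eqxx big1; last first.
  move=> j jv; have -> : (v == j :> nat) = false by apply/eqP; have := ltn_ord j; lia.
  have -> : (v == d + j :> nat)%N = false.
    by apply/eqP => e; move/eqP: jv; apply; apply: val_inj => /=; lia.
  by rewrite subrr mulr0.
have -> : (v == (v - d)%N :> nat) = false by apply/eqP; lia.
by rewrite /= mulr0n mulr1n sub0r addr0 mulrN1 mulrN.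
Qed.

(* Convex coefficients of w / lam on the vertices; the slack 1 - |w|_1 / lam is
   spread evenly, which does not matter as opposite vertices cancel. *)
Definition vertex_coefs (w : 'I_d -> R) (v : nat) : R :=
  let r := (1 - (\sum_j `|w j|) / lam) / (d + d)%:R in
  if (v < d)%N then
    if insub v is Some j then (`|w j| + w j) / (2 * lam) + r else r
  else if insub (v - d)%N is Some j then (`|w j| - w j) / (2 * lam) + r else r.

Lemma vertex_coefs_spec (w : 'I_d -> R) : \sum_j `|w j| <= lam ->
  [/\ forall v, 0 <= vertex_coefs w v,
      \sum_(v : vertex d) vertex_coefs w v = 1
    & forall i x, \sum_(v : vertex d) vertex_coefs w v * vertex_margin d lam i x v =
        \sum_j w j * feature R i x j].
Proof.
move=> hw; pose r := (1 - (\sum_j `|w j|) / lam) / (d + d)%:R.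
have d2 : (d + d)%:R != 0 :> R by rewrite pnatr_eq0; lia.
have r0 : 0 <= r.
  by rewrite divr_ge0 // subr_ge0 ler_pdivrMr // mul1r.
have l2 : 0 < 2 * lam by rewrite mulr_gt0.
have ln0 : lam != 0 by rewrite gt_eqF.
have cl (j : 'I_d) : vertex_coefs w j = (`|w j| + w j) / (2 * lam) + r.
  by rewrite /vertex_coefs ltn_ord valK.
have cr (j : 'I_d) : vertex_coefs w (d + j)%N = (`|w j| - w j) / (2 * lam) + r.
  by rewrite /vertex_coefs ltnNge leq_addr addKn valK.
split.
- have hp (y : R) : 0 <= `|y| + y by have := ler_norm (- y); rewrite normrN; lra.
  have hm (y : R) : 0 <= `|y| - y by have := ler_norm y; lra.
  have l2' := ltW l2.
  move=> v; rewrite /vertex_coefs -/r.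
  by case: ifP => _; case: insubP => // j _ _; rewrite addr_ge0 // divr_ge0.
- rewrite (sum_vertex (vertex_coefs w)).
  rewrite (eq_bigr (fun j : 'I_d => `|w j| / lam + 2 * r)); last first.
    by move=> j _; rewrite cl cr; field.
  rewrite big_split /= -mulr_suml sumr_const card_ord -mulr_natl.
  rewrite /r; set Sw := \sum_j _; move: d2; rewrite natrD => d2.
  have d0 : d%:R != 0 :> R by rewrite pnatr_eq0 -lt0n.
  by field; rewrite ?ln0 ?d0 ?d2.
move=> i x.
rewrite (sum_vertex (fun v => vertex_coefs w v * vertex_margin d lam i x v)).
apply: eq_bigr => j _; rewrite cl cr /vertex_margin ltn_ord ltnNge leq_addr addKn /=.
by field.
Qed.

End vertex_sums.

(** * From optimisation gap to parameter error *)

Section recovery.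
Variables (R : realType) (n d T : nat) (A : 'M[R]_d) (theta : 'rV[R]_d) (lam : R).
Hypothesis d_gt0 : (0 < d)%N.
Hypothesis n_gt0 : (0 < n)%N.
Hypothesis lam_gt0 : 0 < lam.
Hypothesis params : ising_parameters A.
Hypothesis width_le : ising_width A theta <= lam.
Local Notation P := (ising_pmf A theta).
Implicit Types (X : n.-tuple (d.-tuple bool)) (i j l : 'I_d).

Definition feature_moment i j l : R :=
  \sum_z P z * (feature R i z j * feature R i z l).

Definition gradient_ok (s1 : R) X i : Prop := forall j,
  `|\sum_(k < n) feature R i (tnth X k) j * expR (- true_margin A theta i (tnth X k))|
    <= n%:R * s1.

Definition moments_ok (s2 : R) X i : Prop := forall j l,
  `|\sum_(k < n) (feature R i (tnth X k) j * feature R i (tnth X k) l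
      - feature_moment i j l)| <= n%:R * s2.

(** The deviations are bounded in sup norm and paired with [D], the difference of two vectors of the
    l1 ball, so |D|_1 <= 2 lam. The gradient costs 2 lam s1; the second moments cost (2 lam)^2 s2,
    multiplied by the strong convexity factor exp(- lam) / 4. *)
Lemma row_error X i (h : nat -> vertex d) (e s1 s2 : R) :
  0 <= s1 -> 0 <= s2 ->
  gradient_ok s1 X i -> moments_ok s2 X i ->
  loss (samples X) (fun x (v : vertex d) => vertex_margin d lam i x v) h T
   - opt_loss (samples X) (fun x (v : vertex d) => vertex_margin d lam i x v)
       (vertex_coefs lam (local_weight A theta i)) <= n%:R * e ->
  forall j, j != i ->
  expR (- (3 * lam)) / 4 * (A i j - lam * fwavg (fun k : vertex d =>
     (k == j :> nat)%:R - (k == d + j :> nat)%N%:R) h T) ^+ 2 <=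
  e + 2 * lam * s1 + expR (- lam) * lam ^+ 2 * s2.
Proof.
move=> s10 s20 grad mom gap j ji.
have lam0 := ltW lam_gt0.
have np : 0 < n%:R :> R by rewrite ltr0n.
pose w l := lam * fwavg (fun k : vertex d =>
     (k == l :> nat)%:R - (k == d + l :> nat)%N%:R) h T.
pose ws := local_weight A theta i.
pose D l := w l - ws l.
have wn : \sum_l `|w l| <= lam.
  rewrite /w; under eq_bigr do rewrite normrM (gtr0_norm lam_gt0).
  by rewrite -mulr_sumr -[leRHS]mulr1 ler_wpM2l // weights_norm_le1.
have wsn : \sum_l `|ws l| <= lam := local_weight_norm params width_le i.
have Dn : \sum_l `|D l| <= 2 * lam.
  apply: le_trans (_ : _ <= \sum_l (`|w l| + `|ws l|)) _.
    by apply: ler_sum => l _; exact: ler_normB.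
  by rewrite big_split /=; lra.
have [q0 q1 qE] := vertex_coefs_spec d_gt0 lam_gt0 wsn.
pose f k l := feature R i (tnth X k) l.
pose mt k := true_margin A theta i (tnth X k).
pose dm k := \sum_l D l * f k l.
have lossE : loss (samples X) (fun x (v : vertex d) => vertex_margin d lam i x v) h T =
    \sum_(k < n) expR (- (mt k + dm k)).
  rewrite /loss /margin (big_samples X (fun x => expR (- fwavg (fun v : vertex d => vertex_margin d lam i x v) h T))).
  apply: eq_bigr => k _ /=; rewrite fwavg_vertex_margin //; congr (expR (- _)).
  by rewrite /mt /dm /true_margin -big_split /=; apply: eq_bigr => l _; rewrite /D /f /w /ws; ring.
have optE : opt_loss (samples X) (fun x (v : vertex d) => vertex_margin d lam i x v)
       (vertex_coefs lam ws) = \sum_(k < n) expR (- mt k).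
  rewrite /opt_loss /opt_margin (big_samples X (fun x => expR (- \sum_(v : vertex d) vertex_coefs lam ws v * vertex_margin d lam i x v))).
  by apply: eq_bigr => k _; rewrite qE.
have mtb k : `|mt k| <= lam := true_margin_bound params width_le i _.
have mdb k : `|mt k + dm k| <= lam.
  have -> : mt k + dm k = \sum_l w l * f k l.
    by rewrite /mt /dm /true_margin -big_split /=; apply: eq_bigr => l _; rewrite /D /f /ws; ring.
  apply: le_trans wn; apply: le_trans (ler_norm_sum _ _ _) _.
  by apply: ler_sum => l _; rewrite normrM normr_feature mulr1.
have low : \sum_(k < n) (- (expR (- mt k) * dm k) + expR (- lam) / 4 * dm k ^+ 2) <= n%:R * e.
  apply: le_trans gap; rewrite lossE optE -sumrB; apply: ler_sum => k _.
  by have := exp_neg_lower (mtb k) (mdb k); rewrite [mt k + dm k]addrC addrK; lra.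
have gradE : \sum_(k < n) expR (- mt k) * dm k <= 2 * lam * (n%:R * s1).
  have -> : \sum_(k < n) expR (- mt k) * dm k =
     \sum_l D l * \sum_(k < n) f k l * expR (- mt k).
    under [RHS]eq_bigr do rewrite mulr_sumr.
    rewrite exchange_big /=; apply: eq_bigr => k _.
    by rewrite /dm mulr_sumr; apply: eq_bigr => l _; ring.
  apply: le_trans (ler_norm _) _; apply: le_trans (ler_norm_sum _ _ _) _.
  apply: (@le_trans _ _ (\sum_l `|D l| * (n%:R * s1))).
    by apply: ler_sum => l _; rewrite normrM ler_wpM2l //; exact: grad.
  by rewrite -mulr_suml ler_wpM2r // mulr_ge0.
have quadE : n%:R * (expR (- (2 * lam)) * D j ^+ 2) - (2 * lam) ^+ 2 * (n%:R * s2)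
    <= \sum_(k < n) dm k ^+ 2.
  have sq (g : 'I_d -> R) : (\sum_l D l * g l) ^+ 2 = \sum_a \sum_b D a * D b * (g a * g b).
    rewrite expr2 mulr_suml; apply: eq_bigr => a _.
    by rewrite mulr_sumr; apply: eq_bigr => b _; ring.
  have e1 : \sum_(k < n) dm k ^+ 2 - n%:R * \sum_z P z * (\sum_l D l * feature R i z l) ^+ 2
    = \sum_a \sum_b D a * D b * \sum_(k < n) (f k a * f k b - feature_moment i a b).
    have -> : \sum_(k < n) dm k ^+ 2 = \sum_a \sum_b D a * D b * \sum_(k < n) (f k a * f k b).
      under eq_bigr do rewrite sq.
      rewrite exchange_big /=; apply: eq_bigr => a _.
      by rewrite exchange_big /=; apply: eq_bigr => b _; rewrite mulr_sumr.
    have -> : \sum_z P z * (\sum_l D l * feature R i z l) ^+ 2 =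
        \sum_a \sum_b D a * D b * feature_moment i a b.
      under eq_bigr do rewrite sq mulr_sumr.
      rewrite exchange_big /=; apply: eq_bigr => a _.
      under eq_bigr do rewrite mulr_sumr.
      rewrite exchange_big /=; apply: eq_bigr => b _.
      by rewrite /feature_moment mulr_sumr; apply: eq_bigr => z _; ring.
    rewrite mulr_sumr -sumrB; apply: eq_bigr => a _.
    rewrite mulr_sumr -sumrB; apply: eq_bigr => b _.
    rewrite sumrB sumr_const card_ord -[feature_moment i a b *+ n]mulr_natl; ring.
  have e2 : `|\sum_a \sum_b D a * D b * \sum_(k < n) (f k a * f k b - feature_moment i a b)|
     <= (2 * lam) ^+ 2 * (n%:R * s2).
    apply: le_trans (ler_norm_sum _ _ _) _.
    apply: (@le_trans _ _ (\sum_a `|D a| * ((2 * lam) * (n%:R * s2)))); last first.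
      have -> : (2 * lam) ^+ 2 * (n%:R * s2) = 2 * lam * (2 * lam * (n%:R * s2)) by ring.
      by rewrite -mulr_suml ler_wpM2r // !mulr_ge0.
    apply: ler_sum => a _; apply: le_trans (ler_norm_sum _ _ _) _.
    apply: (@le_trans _ _ (\sum_b `|D a| * (`|D b| * (n%:R * s2)))).
      apply: ler_sum => b _; rewrite !normrM -mulrA ler_wpM2l // ler_wpM2l //; exact: mom.
    by rewrite -mulr_sumr -mulr_suml ler_wpM2l // ler_wpM2r // mulr_ge0.
  have e3 := quadratic_lower_bound params width_le D lam0 ji.
  have e4 := ler_wpM2l (ltW np) e3.
  by move: e2; rewrite ler_norml => /andP[]; lra.
have Dj : D j ^+ 2 = (A i j - w j) ^+ 2.
  by rewrite /D /ws /local_weight (negbTE ji); ring.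
rewrite -/(w j) -Dj.
have e3l : expR (- (3 * lam)) = expR (- lam) * expR (- (2 * lam)).
  by rewrite -expRD; congr expR; ring.
rewrite -(ler_pM2l np) e3l.
have q4 : 0 <= expR (- lam) / 4 by rewrite divr_ge0 ?expR_ge0.
have := ler_wpM2l q4 quadE.
move: low; rewrite big_split /= sumrN -mulr_sumr; lra.
Qed.

End recovery.

(** * Success probability *)

Section success.
Variables (R : realType) (n d T : nat) (A : 'M[R]_d) (theta : 'rV[R]_d) (lam eta alpha : R).
Hypothesis d_gt0 : (0 < d)%N.
Hypothesis lam_gt0 : 0 < lam.
Hypothesis alpha_gt0 : 0 < alpha.
Hypothesis params : ising_parameters A.
Hypothesis width_le : ising_width A theta <= lam.
Local Notation P := (ising_pmf A theta).
Implicit Types (X : n.-tuple (d.-tuple bool)) (i j l : 'I_d).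

Lemma union_bound (I E : finType) (p : I -> R) (b : E -> pred I) :
  (forall x, 0 <= p x) ->
  \sum_(x | [exists e, b e x]) p x <= \sum_e \sum_(x | b e x) p x.
Proof.
move=> p0; rewrite (exchange_big_dep predT) //= [leLHS]big_mkcond /=.
apply: ler_sum => x _; case: ifP => [/existsP[e be]|_].
  rewrite (bigD1 e) //= lerDl; exact: sumr_ge0.
exact: sumr_ge0.
Qed.

Definition gradient_bad (s1 : R) (ij : 'I_d * 'I_d) : pred (n.-tuple (d.-tuple bool)) :=
  fun X => n%:R * s1 < `|\sum_(k < n) feature R ij.1 (tnth X k) ij.2
     * expR (- true_margin A theta ij.1 (tnth X k))|.

Definition moments_bad (s2 : R) (ijl : 'I_d * ('I_d * 'I_d)) : pred (n.-tuple (d.-tuple bool)) :=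
  fun X => n%:R * s2 < `|\sum_(k < n) (feature R ijl.1 (tnth X k) ijl.2.1
     * feature R ijl.1 (tnth X k) ijl.2.2
      - feature_moment A theta ijl.1 ijl.2.1 ijl.2.2)|.

Definition sample_bad (s1 s2 : R) : pred (n.-tuple (d.-tuple bool)) :=
  fun X => [exists ij, gradient_bad s1 ij X] || [exists ijl, moments_bad s2 ijl X].

Lemma sample_bad_prob (s1 s2 : R) : 0 <= s1 -> 0 <= s2 ->
  \sum_(X | sample_bad s1 s2 X) sample_prob P X <=
  2 * d%:R ^+ 2 * expR (- (n%:R * s1 ^+ 2 / (8 * expR lam ^+ 2))) +
  2 * d%:R ^+ 3 * expR (- (n%:R * s2 ^+ 2 / (8 * 2 ^+ 2))).
Proof.
move=> s10 s20.
have P0 z : 0 <= P z := ltW (ising_pmf_gt0 A theta z).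
have P1 := ising_pmf_sum1 A theta.
have sp0 (X : n.-tuple (d.-tuple bool)) : 0 <= sample_prob P X := sample_prob_ge0 P0 X.
have lam0 := ltW lam_gt0.
apply: (@le_trans _ _ (\sum_(X | [exists ij, gradient_bad s1 ij X]) sample_prob P X +
   \sum_(X | [exists ijl, moments_bad s2 ijl X]) sample_prob P X)).
  rewrite big_mkcond [X in _ <= X + _]big_mkcond [X in _ <= _ + X]big_mkcond /= -big_split /=.
  apply: ler_sum => X _; have := sp0 X; rewrite /sample_bad.
  by case: ([exists ij, gradient_bad s1 ij X]); case: ([exists ijl, moments_bad s2 ijl X]) => /=; lra.
apply: lerD.
  apply: le_trans (union_bound _ sp0) _.
  apply: (@le_trans _ _ (\sum_(ij : 'I_d * 'I_d)
      2 * expR (- (n%:R * s1 ^+ 2 / (8 * expR lam ^+ 2))))); last first.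
    by rewrite sumr_const card_prod card_ord -[leLHS]mulr_natl natrM; lra.
  apply: ler_sum => -[i j] _; rewrite /gradient_bad /=.
  apply: (@sum_tail_abs R _ P n P0 P1 (fun z => feature R i z j * expR (- true_margin A theta i z)))
    => //; first exact: expR_gt0.
    move=> z; rewrite normrM normr_feature mul1r ger0_norm ?expR_ge0 // ler_expR.
    by have := true_margin_bound params width_le i z; rewrite ler_norml => /andP[]; lra.
  exact: screening_gradient0.
apply: le_trans (union_bound _ sp0) _.
apply: (@le_trans _ _ (\sum_(ijl : 'I_d * ('I_d * 'I_d))
    2 * expR (- (n%:R * s2 ^+ 2 / (8 * 2 ^+ 2))))); last first.
  by rewrite sumr_const !card_prod !card_ord -[leLHS]mulr_natl !natrM; lra.
apply: ler_sum => -[i [j l]] _; rewrite /moments_bad /=.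
have fb z : `|feature R i z j * feature R i z l| <= 1 by rewrite normrM !normr_feature mulr1.
apply: (@sum_tail_abs R _ P n P0 P1 (fun z => feature R i z j * feature R i z l
      - feature_moment A theta i j l)) => //.
  move=> z; apply: le_trans (ler_normB _ _) _.
  rewrite -[leRHS]/(1 + 1); apply: lerD => //.
  apply: le_trans (ler_norm_sum _ _ _) _; rewrite -P1; apply: ler_sum => y _.
  by rewrite normrM (ger0_norm (P0 y)) ler_piMr.
under eq_bigr do rewrite mulrBr.
by rewrite sumrB -mulr_suml P1 mul1r subrr.
Qed.

Lemma sample_good (s1 s2 : R) X i : ~~ sample_bad s1 s2 X ->
  gradient_ok A theta s1 X i /\ moments_ok A theta s2 X i.
Proof.
rewrite negb_or !negb_exists => /andP[/forallP h1 /forallP h2]; split.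
  by move=> j; have := h1 (i, j); rewrite /gradient_bad -leNgt.
by move=> j l; have := h2 (i, (j, l)); rewrite /moments_bad -leNgt.
Qed.

Local Open Scope classical_set_scope.

Lemma max_dist_leP (B : 'M[R]_d) :
  max_dist A B <= alpha <-> forall i j, `|A i j - B i j| <= alpha.
Proof.
rewrite /max_dist; split.
  move=> h i j; apply: le_trans h; apply: le_trans (le_bigmax _ _ i).
  exact: le_bigmax.
move=> h; apply: bigmax_le; first exact: ltW.
by move=> i _; apply: bigmax_le => // *; exact: ltW.
Qed.

Lemma measurable_success :
  measurable ([set B : 'M[R]_d | max_dist A B <= alpha] : set (matrix_space R d)).
Proof.
have -> : [set B : 'M[R]_d | max_dist A B <= alpha] = \bigcap_(ij in [set: 'I_d * 'I_d])
    ((fun M : 'M[R]_d => M ij.1 ij.2) @^-1` `[A ij.1 ij.2 - alpha, A ij.1 ij.2 + alpha]).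
  apply/seteqP; split => [B /= /max_dist_leP h [i j] _|B /= h].
    by rewrite /= in_itv /=; have := h i j; rewrite ler_norml => /andP[]; lra.
  apply/max_dist_leP => i j; have := h (i, j) I; rewrite /= in_itv /= ler_norml.
  by move=> /andP[]; lra.
apply: fin_bigcap_measurable => //.
move=> [i j] _; apply: sub_sigma_algebra; exists i, j, `[A i j - alpha, A i j + alpha].
by split => //; exact: measurable_itv.
Qed.

Variable M : n.-tuple (d.-tuple bool) -> probability (matrix_space R d) R.
Hypothesis M_law : forall X,
  mixture (fun t : (d * T).-tuple (vertex d) => estimate T lam t : matrix_space R d) (M X)
    (fun t => chain (selection_prob T lam eta (samples X)) [::] t).

Definition accurate (t : (d * T).-tuple (vertex d)) : Prop :=
  forall i j, `|A i j - estimate T lam t i j| <= alpha.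

Lemma success_probabilityE :
  success_probability A theta alpha M =
  (\sum_(X : n.-tuple (d.-tuple bool)) sample_prob P X * \sum_(t | `[< accurate t >])
      chain (selection_prob T lam eta (samples X)) [::] t)%:E.
Proof.
rewrite /success_probability -sumEFin; apply: eq_bigr => X _.
rewrite (M_law X measurable_success) -EFinM; congr (_ * _)%:E.
by apply: eq_bigl => t; apply: asbool_equiv_eq; exact: max_dist_leP.
Qed.

Lemma selection_chain_sum1 X :
  \sum_(t : (d * T).-tuple (vertex d)) chain (selection_prob T lam eta (samples X)) [::] t = 1.
Proof. by apply: chain_sum1 => s; exact: selection_prob_sum1. Qed.

Lemma estimate_bound (t : seq (vertex d)) i j : `|estimate T lam t i j| <= lam.
Proof.
rewrite mxE; case: eqP => _; first by rewrite normr0 ltW.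
rewrite normrM gtr0_norm // -[leRHS]mulr1 ler_wpM2l ?(ltW lam_gt0) //.
apply: le_trans (weights_norm_le1 R d_gt0 (block T i t) T).
by rewrite (bigD1 j) //= lerDl; apply: sumr_ge0.
Qed.

Lemma entry_bound i j : `|A i j| <= lam.
Proof.
have [e|ji] := eqVneq j i.
  by case: params => _ h; rewrite e h normr0 ltW.
have := local_weight_norm params width_le i; apply: le_trans.
by rewrite (bigD1 j) //= /local_weight (negbTE ji) lerDl; apply: sumr_ge0.
Qed.

(** True and estimated entries both lie in [-lam, lam]. Once this case is removed, alpha < 2 lam
    keeps the number of rounds at least 1 and within the sample size. *)
Lemma success_trivial : 2 * lam <= alpha ->
  ((2 / 3)%:E < success_probability A theta alpha M)%E.
Proof.
move=> la; rewrite success_probabilityE lte_fin.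
rewrite (eq_bigr (fun X : n.-tuple (d.-tuple bool) => sample_prob P X)); last first.
  move=> X _; rewrite (eq_bigl xpredT) ?selection_chain_sum1 ?mulr1 // => t.
  apply/asboolP => i j; apply: le_trans (ler_normB _ _) _.
  by have := estimate_bound t i j; have := entry_bound i j; lra.
rewrite sample_prob_sum1; first by lra.
exact: ising_pmf_sum1.
Qed.

(** A failure probability of 1/12 is allowed to the sample and, for each good sample, 1/12 to the
    selections; (11/12)^2 exceeds 2/3. The hypotheses on [hopt] and [hacc] make the outcome accurate
    off these events. *)
Lemma success_bound (s1 s2 e G : R) :
  (0 < n)%N -> (0 < T)%N -> 0 < eta -> 0 <= s1 -> 0 <= s2 ->
  d%:R * ((d + d)%:R ^+ T * expR (- G)) <= 1 / 12 ->
  2 * (G / eta) + 16 * (n%:R * expR lam * lam ^+ 2) <= T.+1%:R * (n%:R * e) ->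
  e + 2 * lam * s1 + expR (- lam) * lam ^+ 2 * s2 <= expR (- (3 * lam)) / 4 * alpha ^+ 2 ->
  2 * d%:R ^+ 2 * expR (- (n%:R * s1 ^+ 2 / (8 * expR lam ^+ 2))) +
  2 * d%:R ^+ 3 * expR (- (n%:R * s2 ^+ 2 / (8 * 2 ^+ 2))) <= 1 / 12 ->
  ((2 / 3)%:E < success_probability A theta alpha M)%E.
Proof.
move=> n0 T0 eta0 s10 s20 hG hopt hacc hstat.
rewrite success_probabilityE lte_fin.
have P0 z : 0 <= P z := ltW (ising_pmf_gt0 A theta z).
have sp0 (X : n.-tuple (d.-tuple bool)) : 0 <= sample_prob P X := sample_prob_ge0 P0 X.
have lam0 := ltW lam_gt0.
have c0 (X : n.-tuple (d.-tuple bool)) (t : (d * T).-tuple (vertex d)) :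
    0 <= chain (selection_prob T lam eta (samples X)) [::] t.
  by apply: chain_ge0 => s k; exact/ltW/selection_prob_gt0.
pose bad (X : n.-tuple (d.-tuple bool)) (i : 'I_d) (t : (d * T).-tuple (vertex d)) :=
  G < \sum_(s < T) excess lam eta (samples X) i (block T i t) s.
have key X t : ~~ sample_bad s1 s2 X -> ~~ [exists i, bad X i t] -> accurate t.
  move=> gX; rewrite negb_exists => /forallP gt i j.
  have [eij|ij] := eqVneq i j.
    by rewrite mxE eij eqxx; case: params => _ ->; rewrite subrr normr0 ltW.
  have [ok1 ok2] := sample_good i gX.
  have [q0 q1 _] := vertex_coefs_spec d_gt0 lam_gt0 (local_weight_norm params width_le i).
  have gap := optimization_gap (samples X) T0 lam0 eta0 i (block T i t)
     (fun k : vertex d => q0 k) q1.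
  have hE : \sum_(s < T) excess lam eta (samples X) i (block T i t) s <= G.
    by rewrite leNgt; exact: gt.
  have hE' : (\sum_(s < T) excess lam eta (samples X) i (block T i t) s) / eta <= G / eta.
    by rewrite ler_pM2r // invr_gt0.
  have Tp : 0 < T.+1%:R :> R by rewrite ltr0n.
  rewrite size_map size_tuple in gap.
  have gap' := le_trans gap (le_trans (_ : _ <= 2 * (G / eta) + 16 * (n%:R * expR lam * lam ^+ 2)) hopt).
  have {}gap' := gap' ltac:(lra).
  rewrite ler_pM2l // in gap'.
  have ji : j != i by rewrite eq_sym.
  have re := row_error d_gt0 n0 lam_gt0 params width_le s10 s20 ok1 ok2 gap' ji.
  have e0 : 0 < expR (- (3 * lam)) / 4 by rewrite divr_gt0 ?expR_gt0.
  have := le_trans re hacc; rewrite ler_pM2l // => h2.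
  rewrite mxE (negbTE ij) /signed_weight.
  rewrite -(@ler_sqr R) ?nnegrE ?(ltW alpha_gt0) //.
  by rewrite real_normK ?num_real.
have inner (X : n.-tuple (d.-tuple bool)) : ~~ sample_bad s1 s2 X ->
    11 / 12 <= \sum_(t | `[< accurate t >]) chain (selection_prob T lam eta (samples X)) [::] t.
  move=> gX.
  have tot := selection_chain_sum1 X; rewrite (bigID (fun t => `[< accurate t >])) /= in tot.
  have : \sum_(t | ~~ `[< accurate t >]) chain (selection_prob T lam eta (samples X)) [::] t <= 1 / 12.
    apply: (@le_trans _ _ (\sum_(t | [exists i, bad X i t])
       chain (selection_prob T lam eta (samples X)) [::] t)).
      rewrite big_mkcond [leRHS]big_mkcond /=; apply: ler_sum => t _.
      case: ifP => // nt; last by case: ifP.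
      case: ifP => // /negbT gt; move/asboolP: nt; case.
      exact: key gX gt.
    apply: le_trans (union_bound _ (c0 X)) _; apply: le_trans hG.
    apply: (@le_trans _ _ (\sum_(i < d) (d + d)%:R ^+ T * expR (- G))).
      by apply: ler_sum => i _; exact: excess_tail.
    by rewrite sumr_const card_ord -[leLHS]mulr_natl.
  lra.
have stat := sample_bad_prob s10 s20.
have tot := sample_prob_sum1 n (ising_pmf_sum1 A theta).
rewrite (bigID (sample_bad s1 s2)) /= in tot.
apply: (@lt_le_trans _ _ (\sum_(X | ~~ sample_bad s1 s2 X) sample_prob P X * (11 / 12))).
  by rewrite -mulr_suml; lra.
rewrite [leRHS](bigID (sample_bad s1 s2)) /= ler_wpDl //.
  by apply: sumr_ge0 => X _; rewrite mulr_ge0 //; apply: sumr_ge0.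
by apply: ler_sum => X gX; rewrite ler_wpM2l // inner.
Qed.

End success.

(** * Sample size *)

Section sample_size.
Variable R : realType.
Implicit Types (x lam alpha L N : R).

Lemma ln2_ge_half : 1 / 2 <= ln 2 :> R.
Proof.
rewrite -ler_expR lnK ?posrE //.
by apply: (le_trans (expR_le_quad (lexx _))); lra.
Qed.

Lemma rounds_le (tau : R) k : (rounds tau k <= k)%N.
Proof. by elim: k => //= k IH; case: (_ <= _); lia. Qed.

Lemma rounds_spec (tau : R) k : 0 <= tau ->
  (rounds tau k = k \/ tau < (rounds tau k)%:R) /\ (rounds tau k)%:R <= tau + 1.
Proof.
move=> t0; elim: k => [|k [IH1 IH2]] /=; first by split; [left|lra].
case: (lerP (rounds tau k)%:R tau) => h /=; last by rewrite addn0; split => //; right.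
rewrite addn1; split; last by rewrite -natr1; lra.
by left; case: IH1 => [->|] //; rewrite ltNge h.
Qed.

(* x stands for exp lam, L for ln d, N for the number of samples. *)
Lemma moment_exponent (x lam alpha L N : R) :
  0 < lam -> 0 < alpha -> 1 <= x -> lam <= x -> 0 <= L ->
  480 ^+ 2 * (lam ^+ 2 * L * x ^+ 12 / alpha ^+ 4) <= N ->
  10 * L <= N * (x^-1 ^+ 3 * alpha ^+ 2 / (24 * lam)) ^+ 2 / (8 * x ^+ 2) /\
  10 * L <= N * (x^-1 ^+ 2 * alpha ^+ 2 / (12 * lam ^+ 2)) ^+ 2 / (8 * 2 ^+ 2).
Proof.
move=> l0 a0 x1 lx L0 hN.
have x0 : 0 < x by lra.
have [ln0 an0 xn0] : [/\ lam != 0, alpha != 0 & x != 0] by rewrite !gt_eqF.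
have k0 : 0 < alpha ^+ 4 / (lam ^+ 2 * x ^+ 12).
  by rewrite divr_gt0 ?mulr_gt0 ?exprn_gt0.
have hK : 480 ^+ 2 * L <= N * (alpha ^+ 4 / (lam ^+ 2 * x ^+ 12)).
  apply: le_trans (ler_wpM2r (ltW k0) hN).
  rewrite le_eqVlt; apply/orP; left; apply/eqP; field.
  by rewrite an0 ln0 xn0.
set y := N * _ in hK.
have y0 : 0 <= y by lra.
(* In both cases the denominator is 4608 = 8 * 24^2 = 32 * 12^2, and 480^2 / 4608 = 50 is well above
   10. Spare powers of [x] absorb the remaining powers of [lam]. *)
split.
  have -> : N * (x^-1 ^+ 3 * alpha ^+ 2 / (24 * lam)) ^+ 2 / (8 * x ^+ 2) =
     y * x ^+ 4 / 4608%:R.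
    by rewrite /y; field; rewrite ln0 xn0.
  have x4 : 1 <= x ^+ 4 by rewrite exprn_ege1.
  have := ler_wpM2l y0 x4.
  by rewrite mulr1; lra.
have -> : N * (x^-1 ^+ 2 * alpha ^+ 2 / (12 * lam ^+ 2)) ^+ 2 / (8 * 2 ^+ 2) =
     y * (x ^+ 8 / lam ^+ 2) / 4608%:R.
  by rewrite /y; field; rewrite ln0 xn0.
have x8 : 1 <= x ^+ 8 / lam ^+ 2.
  rewrite ler_pdivlMr ?exprn_gt0 // mul1r.
  apply: (@le_trans _ _ (x ^+ 2)); first by rewrite lerXn2r ?nnegrE //; lra.
  by apply: ler_weXn2l.
have := ler_wpM2l y0 x8.
by rewrite mulr1; lra.
Qed.

(** The upper bound ensures that capping the rounds at n does not leave T below tau; the lower bound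
    gives T <= tau + 1 <= 2 tau. *)
Lemma tau_le (x lam alpha L N : R) :
  0 < lam -> 0 < alpha -> alpha < 2 * lam -> 1 <= x -> lam <= x -> 1 / 2 <= L ->
  480 ^+ 2 * (lam ^+ 2 * L * x ^+ 12 / alpha ^+ 4) <= N ->
  1 <= 384%:R * (lam * lam) * x ^+ 4 / (alpha * alpha) <= N.
Proof.
move=> l0 a0 al x1 lx L0 hN.
have x0 : 0 < x by lra.
have [ln0 an0 xn0] : [/\ lam != 0, alpha != 0 & x != 0] by rewrite !gt_eqF.
have al2 : alpha ^+ 2 <= 4 * lam ^+ 2.
  have : alpha ^+ 2 <= (2 * lam) ^+ 2 by rewrite lerXn2r ?nnegrE; lra.
  by rewrite exprMn; lra.
pose t := lam ^+ 2 * x ^+ 4 / alpha ^+ 2.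
have -> : 384%:R * (lam * lam) * x ^+ 4 / (alpha * alpha) = 384%:R * t.
  by rewrite /t; field.
have l2 : 0 < lam ^+ 2 by rewrite exprn_gt0.
have a2 : 0 < alpha ^+ 2 by rewrite exprn_gt0.
have x4 : 1 <= x ^+ 4 by rewrite exprn_ege1.
have t4 : 1 / 4 <= t.
  rewrite /t ler_pdivlMr //.
  by have := ler_wpM2l (ltW l2) x4; lra.
apply/andP; split; first by lra.
apply: le_trans hN.
have -> : lam ^+ 2 * L * x ^+ 12 / alpha ^+ 4 = t * (L * (x ^+ 8 / alpha ^+ 2)).
  by rewrite /t; field.
have x8 : 1 / 4 <= x ^+ 8 / alpha ^+ 2.
  rewrite ler_pdivlMr //.
  have h1 : lam ^+ 2 <= x ^+ 2 by rewrite lerXn2r ?nnegrE //; lra.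
  have h2 : x ^+ 2 <= x ^+ 8 by apply: ler_weXn2l.
  by lra.
have h8 : (1 / 2) * (1 / 4) <= L * (x ^+ 8 / alpha ^+ 2) by rewrite ler_pM //; lra.
have t0 : 0 <= t by lra.
have := ler_wpM2l t0 h8; lra.
Qed.

(** Here [q] and [r] are the square roots of d and rho, and [e0] is the privacy parameter of one
    choice. The total excess will be at most 7 T L and may use a quarter of eta times T n exp(- 3
    lam) alpha^2 / 12, whence 28 = 4 * 7. *)
Lemma privacy_sample_size (x lam alpha L N q r d T e0 : R) :
  0 < lam -> 0 < alpha -> 1 <= x -> 1 / 2 <= L -> 0 < q -> 0 < r -> 0 < T ->
  d = q ^+ 2 ->
  T <= 2 * (384%:R * (lam * lam) * x ^+ 4 / (alpha * alpha)) ->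
  0 < e0 -> e0 ^+ 2 = r ^+ 2 / (9 * (d * T)) ->
  480 ^+ 2 * (q * lam ^+ 2 * L ^+ 2 * x ^+ 9 / (r * alpha ^+ 3)) <= N ->
  28 * L <= e0 / (4 * lam * x) * (N * (x^-1 ^+ 3 * alpha ^+ 2 / 12)).
Proof.
move=> l0 a0 x1 L0 q0 r0 T0 dq hT e00 he hN.
have x0 : 0 < x by lra.
have [ln0 an0 xn0] : [/\ lam != 0, alpha != 0 & x != 0] by rewrite !gt_eqF.
have [qn0 rn0 Tn0] : [/\ q != 0, r != 0 & T != 0] by rewrite !gt_eqF.
pose t := lam ^+ 2 * x ^+ 4 / alpha ^+ 2.
have t0 : 0 < t by rewrite divr_gt0 ?mulr_gt0 ?exprn_gt0.
have {}hT : T <= 768%:R * t.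
  apply: (le_trans hT); rewrite le_eqVlt; apply/orP; left; apply/eqP.
  by rewrite /t; field.
pose u := r * alpha / (q * lam * x ^+ 2).
have u0 : 0 < u by rewrite divr_gt0 ?mulr_gt0 ?exprn_gt0.
(* Eliminates T: its upper bound gives [e0 ^+ 2 >= u ^+ 2 / (9 * 768)], and 9 * 768 = 6912 is below
   84^2 = 7056. *)
have h1 : u / 84%:R <= e0.
  have eT : e0 ^+ 2 * T = u ^+ 2 / 9 * t.
    by rewrite he dq /u /t; field; rewrite ?Tn0 ?qn0 ?ln0 ?xn0 ?an0.
  have h : u ^+ 2 / 9 <= e0 ^+ 2 * 768%:R.
    have := ler_wpM2l (sqr_ge0 e0) hT.
    by rewrite eT [_ * (768%:R * t)]mulrA ler_pM2r.
  have u840 : 0 <= u / 84%:R by lra.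
  rewrite -(@ler_sqr R) ?nnegrE ?(ltW e00) // expr_div_n.
  have : 0 <= u ^+ 2 by exact: sqr_ge0.
  lra.
have L00 : 0 <= L by lra.
pose w := x^-1 ^+ 3 * alpha ^+ 2 / 12.
have w0 : 0 < w.
  by apply: divr_gt0 => //; apply: mulr_gt0; rewrite exprn_gt0 ?invr_gt0.
pose v := (4 * lam * x)^-1.
have v0 : 0 < v by rewrite invr_gt0 !mulr_gt0.
pose N0 := q * lam ^+ 2 * L ^+ 2 * x ^+ 9 / (r * alpha ^+ 3).
have N00 : 0 <= N0.
  by apply: divr_ge0; rewrite ?mulr_ge0 ?exprn_ge0 ?(ltW q0) ?(ltW l0) ?(ltW r0) ?(ltW a0) ?(ltW x0).
have h2 : u / 84%:R * v * (480 ^+ 2 * N0 * w) <= e0 * v * (N * w).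
  have i1 : 0 <= u / 84%:R * v by apply: mulr_ge0; [lra|exact: ltW].
  have i2 : 0 <= 480 ^+ 2 * N0 * w by apply: mulr_ge0; [lra|exact: ltW].
  have i3 : u / 84%:R * v <= e0 * v := ler_wpM2r (ltW v0) h1.
  have i4 : 480 ^+ 2 * N0 * w <= N * w := ler_wpM2r (ltW w0) hN.
  exact: ler_pM.
apply: le_trans h2.
have e1 : u * v * (N0 * w) = L * (L * x ^+ 3) / 48%:R.
  by rewrite /u /v /N0 /w; field; rewrite ?ln0 ?xn0 ?qn0 ?rn0 ?an0.
have -> : u / 84%:R * v * (480 ^+ 2 * N0 * w) = 480 ^+ 2 / 84%:R * (u * v * (N0 * w)).
  by field.
rewrite e1.
(* One logarithm and three powers of [x] are used only through [L * x ^+ 3 >= 1 / 2]. As 480^2 / (84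
   * 48) exceeds 57, half of it is just above 28; of all uses of the constant 480^2, this one has
   the least room. *)
have x3 : 1 <= x ^+ 3 by rewrite exprn_ege1.
have h3 : 1 / 2 <= L * x ^+ 3 by have := ler_wpM2l L00 x3; lra.
have := ler_wpM2l L00 h3; lra.
Qed.

End sample_size.

(** * Running time, privacy and accuracy of the learner *)

Section assembly.
Variables (R : realType) (n d : nat) (lam rho alpha : R).
Hypothesis d_ge2 : (2 <= d)%N.
Hypothesis lam_gt0 : 0 < lam.
Hypothesis rho_gt0 : 0 < rho.
Hypothesis alpha_gt0 : 0 < alpha.
Local Notation T := (T_val n lam alpha).
Local Notation eta := (eta_val n d lam rho alpha).
Local Notation K := (cost learner).

Lemma draws_le : (d * T <= (n + d) ^ K)%N.
Proof.
have TN : (T <= n)%N := rounds_le _ _.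
clear - d_ge2 TN.
apply: (@leq_trans ((n + d) ^ 2)).
  by rewrite expnS expn1; apply: leq_mul; lia.
by rewrite leq_exp2l //; lia.
Qed.

Lemma learner_implements (X : n.-tuple (d.-tuple bool))
    (P : probability (matrix_space R d) R) :
  (forall E : set (matrix_space R d), measurable E ->
     P E = coins_law R ((n + d) ^ K)
       [set u | E (coin_output d T lam eta (d * T) (samples X) u)]%classic) ->
  implements learner ((n + d) ^ K)
    (learner_input lam rho alpha X) (@learner_output R d) P.
Proof.
move=> hP.
have run (u : ((n + d) ^ K).-tuple (measurableTypeR R)) :
    wp (n + d) learner (fun s' _ => learner_output d s' =
      coin_output d T lam eta (d * T) (samples X) u)
     (learner_input lam rho alpha X) u.
  by apply: learner_spec => //; rewrite size_tuple draws_le.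
split.
  move=> u _; have [t [s' [u' [h1 [h2 _]]]]] := run u.
  by exists t, s', u'.
move=> E mE; rewrite hP //; congr (coins_law _ _ _); apply/seteqP; split => u /=.
  have [t [s' [u' [h1 [_ h3]]]]] := run u.
  by move=> Eu; exists t, s', u'; rewrite h3.
case=> t1 [s1 [u1 [e1 E1]]]; have [t [s' [u' [h1 [_ h3]]]]] := run u.
by rewrite -h3; have [<- _] := exec_deterministic e1 h1.
Qed.

Let eps : R := expR (ln (rho / (9%:R * (d%:R * T%:R))) / 2%:R).

Lemma eps_sqr : (0 < T)%N -> eps ^+ 2 = rho / (9%:R * (d%:R * T%:R)).
Proof.
move=> T0; rewrite /eps -expRM_natl mulrC divfK ?pnatr_eq0 // lnK // posrE.
by rewrite divr_gt0 // !mulr_gt0 // ltr0n; lia.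
Qed.

Lemma eta_gt0 : 0 < eta.
Proof. by rewrite divr_gt0 ?expR_gt0 // !mulr_gt0 ?expR_gt0. Qed.

Lemma learner_private (M : n.-tuple (d.-tuple bool) -> probability (matrix_space R d) R) :
  (forall X, mixture (fun t : (d * T).-tuple (vertex d) => estimate T lam t : matrix_space R d)
     (M X) (fun t => chain (selection_prob T lam eta (samples X)) [::] t)) ->
  zCDP rho M.
Proof.
move=> hM X X' nb a a1.
have sens (past : seq (vertex d)) v : `|score T lam eta (samples X) past v - score T lam eta (samples X') past v|
    <= eps / 2.
  apply: le_trans (score_sensitivity T (ltW lam_gt0) (ltW eta_gt0) past v nb) _.
  rewrite le_eqVlt; apply/orP; left; apply/eqP.
  by rewrite /eta_val -/eps; field; rewrite !gt_eqF ?expR_gt0.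
apply: le_trans (output_privacy sens (hM X) (hM X') a1) _.
rewrite lee_fin ler_wpM2r //; first by lra.
(* Without rounds there are no choices and the divergence bound is 0; otherwise d T choices at 9
   eps^2 each cost exactly rho. *)
have [T0|T0] := posnP T; first by rewrite T0 muln0 mul0r ltW.
have dn0 : d%:R != 0 :> R by rewrite pnatr_eq0; lia.
have Tn0 : T%:R != 0 :> R by rewrite pnatr_eq0; lia.
rewrite eps_sqr // natrM le_eqVlt; apply/orP; left; apply/eqP.
by field; rewrite dn0 Tn0.
Qed.

Lemma learner_accurate (A : 'M[R]_d) (theta : 'rV[R]_d)
    (M : n.-tuple (d.-tuple bool) -> probability (matrix_space R d) R) :
  (forall X, mixture (fun t : (d * T).-tuple (vertex d) => estimate T lam t : matrix_space R d)
     (M X) (fun t => chain (selection_prob T lam eta (samples X)) [::] t)) ->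
  ising_parameters A -> ising_width A theta <= lam ->
  480 ^+ 2 * (lam ^+ 2 * ln d%:R * expR (12 * lam) / alpha ^+ 4
     + Num.sqrt d%:R * lam ^+ 2 * ln d%:R ^+ 2
       * expR (9 * lam) / (Num.sqrt rho * alpha ^+ 3)) <= n%:R ->
  ((2 / 3)%:E < success_probability A theta alpha M)%E.
Proof.
move=> hM params width hn.
have d0 : (0 < d)%N by lia.
have [al|al] := leP (2 * lam) alpha; first exact: success_trivial hM al.
pose x := expR lam; pose L : R := ln d%:R.
have x0 : 0 < x := expR_gt0 lam.
have x1 : 1 <= x by rewrite /x -[leLHS]expR0 ler_expR ltW.
have lx : lam <= x by have := expR_ge1Dx lam; rewrite -/x; lra.
have eX k : expR (k%:R * lam) = x ^+ k by rewrite expRM_natl.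
have eN k : expR (- (k%:R * lam)) = x^-1 ^+ k by rewrite expRN eX exprVn.
have dR : 0 < d%:R :> R by rewrite ltr0n.
have d2R : 2 <= d%:R :> R by rewrite ler_nat.
have L2 : 1 / 2 <= L.
  by apply: le_trans (ln2_ge_half R) _; rewrite /L ler_ln ?posrE.
have L0 : 0 <= L by lra.
rewrite (eX 12%N) (eX 9%N) -/L in hn.
have q0 : 0 < Num.sqrt d%:R :> R by rewrite sqrtr_gt0.
have r0 : 0 < Num.sqrt rho by rewrite sqrtr_gt0.
set B1 := lam ^+ 2 * L * x ^+ 12 / alpha ^+ 4 in hn.
set B2 := Num.sqrt d%:R * lam ^+ 2 * L ^+ 2 * x ^+ 9 / (Num.sqrt rho * alpha ^+ 3) in hn.
have B10 : 0 <= B1.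
  by apply: divr_ge0; rewrite ?mulr_ge0 ?exprn_ge0 ?(ltW lam_gt0) ?(ltW alpha_gt0) ?(ltW x0).
have B20 : 0 <= B2.
  by apply: divr_ge0; rewrite ?mulr_ge0 ?exprn_ge0 ?(ltW lam_gt0) ?(ltW alpha_gt0) ?(ltW x0) ?(ltW q0) ?(ltW r0).
have hn1 : 480 ^+ 2 * B1 <= n%:R by lra.
have hn2 : 480 ^+ 2 * B2 <= n%:R by lra.
have [m1 m2] := moment_exponent lam_gt0 alpha_gt0 x1 lx L0 hn1.
have /andP[tau1 taun] := tau_le lam_gt0 alpha_gt0 al x1 lx L2 hn1.
have tauE : tau_val lam alpha = 384%:R * (lam * lam) * x ^+ 4 / (alpha * alpha).
  by rewrite /tau_val (eX 4%N).
rewrite -tauE in tau1 taun.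
have tau0 : 0 <= tau_val lam alpha by lra.
have n0 : (0 < n)%N by rewrite -(ltr0n R); lra.
have [Tn Tle] := rounds_spec n tau0.
have tauT : tau_val lam alpha <= T%:R by rewrite /T_val; case: Tn => [->|/ltW].
have T0 : (0 < T)%N by rewrite -(ltr0n R); lra.
have TR : 0 < T%:R :> R by rewrite ltr0n.
have T2 : T%:R <= 2 * (384%:R * (lam * lam) * x ^+ 4 / (alpha * alpha)).
  by rewrite -tauE; apply: le_trans Tle _; lra.
have priv : 28 * L <= eta * (n%:R * (x^-1 ^+ 3 * alpha ^+ 2 / 12)).
  apply: (privacy_sample_size (q := Num.sqrt d%:R) (r := Num.sqrt rho) (d := d%:R)
     (T := T%:R) lam_gt0 alpha_gt0 x1 L2 q0 r0 TR _ T2 (expR_gt0 _) _ hn2).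
    by rewrite sqr_sqrtr // ltW.
  by rewrite sqr_sqrtr ?(ltW rho_gt0) // eps_sqr.
have ln_mul (k m : nat) : (0 < k)%N -> (k * d <= d ^ m)%N -> ln (k%:R * d%:R) <= m%:R * L.
  move=> k0 km; rewrite /L [leRHS]mulr_natl -lnXn // ler_ln ?posrE ?mulr_gt0 ?exprn_gt0 ?ltr0n //.
  by rewrite -natrX -natrM ler_nat.
have l2d : ln (2%:R * d%:R) <= 2%:R * L by apply: ln_mul => //; rewrite expnS expn1 leq_mul2r d_ge2 orbT.
(* 12 <= 2^4 <= d^4. *)
have l12d : ln (12%:R * d%:R) <= 5%:R * L.
  apply: ln_mul => //; rewrite expnS mulnC leq_mul2l; apply/orP; right.
  by apply: (@leq_trans (2 ^ 4)%N) => //; rewrite leq_exp2r.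
(* Chosen so that d (2d)^T exp(- G) is exactly 1/12. *)
pose G : R := T%:R * ln (2%:R * d%:R) + ln (12%:R * d%:R).
have GL : G <= 7 * (T%:R * L).
  have h1 : T%:R * ln (2%:R * d%:R) <= T%:R * (2%:R * L) by rewrite ler_pM2l.
  have T1 : 1 <= T%:R :> R by rewrite ler1n.
  have h2 : L <= T%:R * L by rewrite ler_peMl.
  by rewrite /G; lra.
(* With these values [e], [2 * lam * s1] and [expR (- lam) * lam ^+ 2 * s2] are equal, each a third
   of exp(- 3 lam) alpha^2 / 4. *)
apply: (success_bound d0 lam_gt0 alpha_gt0 params width hM
  (s1 := x^-1 ^+ 3 * alpha ^+ 2 / (24 * lam))
  (s2 := x^-1 ^+ 2 * alpha ^+ 2 / (12 * lam ^+ 2))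
  (e := x^-1 ^+ 3 * alpha ^+ 2 / 12) (G := G) n0 T0 eta_gt0).
- by apply: divr_ge0; rewrite ?mulr_ge0 ?exprn_ge0 ?invr_ge0 ?(ltW lam_gt0) ?(ltW alpha_gt0) ?(ltW x0).
- by apply: divr_ge0; rewrite ?mulr_ge0 ?exprn_ge0 ?invr_ge0 ?(ltW lam_gt0) ?(ltW alpha_gt0) ?(ltW x0).
- rewrite /G opprD expRD expRN expRM_natl lnK ?posrE ?mulr_gt0 ?ltr0n //.
  rewrite expRN lnK ?posrE ?mulr_gt0 ?ltr0n //.
  have -> : (d + d)%:R = 2%:R * d%:R :> R by rewrite -natrM mul2n addnn.
  have y0 : (2%:R * d%:R) ^+ T != 0 :> R by rewrite expf_neq0 // gt_eqF // mulr_gt0.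
  set Y := _ ^+ T in y0 *.
  rewrite le_eqVlt; apply/orP; left; apply/eqP.
  by field; rewrite y0 gt_eqF.
(* Selection errors and curvature each get half of the optimisation budget. *)
- have h1 : 2 * (G / eta) <= T%:R * (n%:R * (x^-1 ^+ 3 * alpha ^+ 2 / 12)) / 2.
    have h2 : G / eta <= T%:R * (n%:R * (x^-1 ^+ 3 * alpha ^+ 2 / 12)) / 4.
      rewrite ler_pdivrMr ?eta_gt0 //; apply: (le_trans GL).
      by have := ler_wpM2l (ltW TR) priv; lra.
    by lra.
  have h3 : 16 * (n%:R * x * lam ^+ 2) <= T%:R * (n%:R * (x^-1 ^+ 3 * alpha ^+ 2 / 12)) / 2.
    have nn : 0 <= n%:R * (x^-1 ^+ 3 * alpha ^+ 2 / 12).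
      by apply: mulr_ge0 => //; apply: divr_ge0; rewrite ?mulr_ge0 ?exprn_ge0 ?invr_ge0 ?(ltW alpha_gt0) ?(ltW x0).
    have := ler_wpM2r nn tauT.
    have -> : tau_val lam alpha * (n%:R * (x^-1 ^+ 3 * alpha ^+ 2 / 12)) =
       32 * (n%:R * x * lam ^+ 2).
      by rewrite tauE; field; rewrite !gt_eqF.
    by lra.
  have h4 : 0 <= n%:R * (x^-1 ^+ 3 * alpha ^+ 2 / 12).
    by apply: mulr_ge0 => //; apply: divr_ge0; rewrite ?mulr_ge0 ?exprn_ge0 ?invr_ge0 ?(ltW alpha_gt0) ?(ltW x0).
  by rewrite -/x -[T.+1%:R]natr1 mulrDl mul1r; lra.
- rewrite (eN 3%N) expRN -/x le_eqVlt; apply/orP; left; apply/eqP.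
  by field; rewrite !gt_eqF.
(* Each tail is at most d^(-10), so the union bound is at most 2 d^(-8) + 2 d^(-7), which for d >= 2
   is below 1/12. *)
have tail : expR (- (10 * L)) = (d%:R ^+ 10)^-1.
  by rewrite expRN expRM_natl lnK.
have t1 : expR (- (n%:R * (x^-1 ^+ 3 * alpha ^+ 2 / (24 * lam)) ^+ 2 / (8 * x ^+ 2)))
    <= (d%:R ^+ 10)^-1 by rewrite -tail ler_expR lerN2.
have t2 : expR (- (n%:R * (x^-1 ^+ 2 * alpha ^+ 2 / (12 * lam ^+ 2)) ^+ 2 / (8 * 2 ^+ 2)))
    <= (d%:R ^+ 10)^-1 by rewrite -tail ler_expR lerN2.
have pw k : (d%:R ^+ k)^-1 <= (2 ^+ k)^-1 :> R.
  have h : 2 ^+ k <= d%:R ^+ k :> R by rewrite lerXn2r ?nnegrE // ltW.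
  by rewrite lef_pV2 ?posrE ?exprn_gt0.
have dn0 : d%:R != 0 :> R by rewrite gt_eqF.
have e2 : d%:R ^+ 2 * (d%:R ^+ 10)^-1 = (d%:R ^+ 8)^-1 :> R by field.
have e3 : d%:R ^+ 3 * (d%:R ^+ 10)^-1 = (d%:R ^+ 7)^-1 :> R by field.
have w2 := ler_wpM2l (exprn_ge0 2 (ltW dR)) t1.
have w3 := ler_wpM2l (exprn_ge0 3 (ltW dR)) t2.
have p8 := pw 8%N; have p7 := pw 7%N.
rewrite e2 in w2; rewrite e3 in w3.
move: w2 w3 p8 p7; set z1 := expR _; set z2 := expR _; lra.
Qed.

End assembly.

Theorem mainTheorem3 (R : realType) :
  exists C : R, 0 < C /\
  exists (learner : cmd) (K : nat),
  forall (d : nat) (lambda rho alpha : R),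
    (2 <= d)%N -> 0 < lambda -> 0 < rho -> 0 < alpha ->
  forall n : nat,
  exists M : n.-tuple (d.-tuple bool) -> probability (matrix_space R d) R,
    [/\ forall X : n.-tuple (d.-tuple bool),
          implements learner ((n + d) ^ K)
            (learner_input lambda rho alpha X) (@learner_output R d) (M X),
        zCDP rho M
      & forall (A : 'M[R]_d) (theta : 'rV[R]_d),
          ising_parameters A -> ising_width A theta <= lambda ->
          C * (lambda ^+ 2 * ln d%:R * expR (12 * lambda) / alpha ^+ 4
               + Num.sqrt d%:R * lambda ^+ 2 * ln d%:R ^+ 2
                 * expR (9 * lambda) / (Num.sqrt rho * alpha ^+ 3)) <= n%:R ->
          ((2 / 3)%:E < success_probability A theta alpha M)%E].
Proof.
exists (480 ^+ 2); split; first by apply: exprn_gt0; rewrite ltr0n.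
exists learner, (cost learner) => d lam rho alpha d2 lam0 rho0 alpha0 n.
have [M hM] := choice (fun X : n.-tuple (d.-tuple bool) =>
  output_law d (T_val n lam alpha) lam (eta_val n d lam rho alpha) (samples X)
    (draws_le n lam alpha d2)).
exists M; split.
- by move=> X; apply: learner_implements => //; exact: (hM X).1.
- by apply: (@learner_private R n d lam rho alpha) => // X; exact: (hM X).2.
- move=> A theta params width hn.
  by apply: (@learner_accurate R n d lam rho alpha) hn => // X; exact: (hM X).2.
Qed.
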